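(* There are absolute constants $C_1,C_2>0$ such that the following holds. Let $A$ be a real $m\times n$ matrix of rank $n$ with condition number $\kappa=\sigma_{\max}(A)/\sigma_{\min}(A)$ and stable rank $r=\|A\|_F^2/\|A\|^2$, and let $S$ be a $k\times m$ random matrix with i.i.d. isotropic $K$-sub-gaussian rows that satisfy Euclidean concentration with constant $L$. If $r\ge C_1\max\{k,\;L^2\log\kappa,\;K^4L^2\}$, then sketch-and-project with sketching distribution $S$ satisfies, for some $\epsilon\le C_2K^2L/\sqrt r$, $$\mathrm{Rate}(A,k)\ \ge\ (1-\epsilon)\,\frac{\gamma_k\,\sigma_{\min}^2(A)}{\gamma_k\,\sigma_{\min}^2(A)+1}\ \ge\ (1-\epsilon)\Big(1-\frac kn\Big)\frac{k\,\sigma_{\min}^2(A)}{\mathrm{Err}(A,k-1)},$$ where $\gamma_k=k/\mathrm{Err}(A,k-1)$.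
   Context: $\|\cdot\|$ is the Euclidean norm of vectors and the spectral norm of matrices, $\|\cdot\|_F$ the Frobenius norm, $(\cdot)^\dagger$ the Moore-Penrose pseudoinverse. A random vector $x$ is isotropic if $\mathbb{E}[xx^\top]=I$. A real random variable $X$ is $K$-sub-gaussian if $\inf\{t>0:\mathbb{E}\exp(X^2/t^2)\le 2\}\le K$; a random vector $x$ is $K$-sub-gaussian if $v^\top x$ is $K$-sub-gaussian for every unit vector $v$. A random vector $x$ in $\mathbb{R}^d$ satisfies Euclidean concentration with constant $L$ if for every real matrix $M$ with $d$ columns (any number of rows), the random variable $\|Mx\|-\|M\|_F$ is $L\|M\|$-sub-gaussian. $\mathrm{Err}(A,k-1):=\mathbb{E}\,\|A(I-(S'A)^\dagger S'A)\|_F^2$, where $S'$ is a $(k-1)\times m$ random matrix whose rows are i.i.d. with the same distribution as the rows of $S$ (for $k=1$ this is $\|A\|_F^2$). Sketch-and-project: given a consistent linear system $Ax=b$ with unique solution $x_*$ and a starting point $x_0\in\mathbb{R}^n$, set $x_{t+1}=x_t-(S_tA)^\dagger S_t(Ax_t-b)$, $t=0,1,\dots$, where $S_0,S_1,\dots$ are independent copies of $S$. Its worst-case expected convergence rate is $$\mathrm{Rate}(A,k):=\sup\{\rho:\ \mathbb{E}\,\|x_t-x_*\|^2\le(1-\rho)^t\|x_0-x_*\|^2\ \text{ for all } x_0\in\mathbb{R}^n,\ t\ge 0\}.$$ *)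

(* Defs.v *)
From HB Require Import structures.
From mathcomp Require Export all_boot all_order all_algebra finmap.
From mathcomp Require Export all_classical all_reals all_analysis.

Set Implicit Arguments.
Unset Strict Implicit.
Unset Printing Implicit Defensive.

Export Order.TTheory GRing.Theory Num.Theory.
Export numFieldNormedType.Exports.

Local Open Scope classical_set_scope.
Local Open Scope ring_scope.

(* The library norm `|M| of a matrix is the entrywise maximum, so the Euclidean,
   Frobenius and spectral norms are defined here. *)
Section norms.
Context {R : realType}.

Definition enorm {d} (x : 'cV[R]_d) : R := Num.sqrt (\sum_i x i 0 ^+ 2).

Definition fnorm {p d} (M : 'M[R]_(p, d)) : R :=
  Num.sqrt (\sum_i \sum_j M i j ^+ 2).

Definition specnorm {p d} (M : 'M[R]_(p, d)) : R :=
  sup [set enorm (M *m x) | x in [set x : 'cV[R]_d | enorm x <= 1]].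

(* For d > p the kernel contributes the extra value 0 to this set. *)
Definition singular_values {p d} (M : 'M[R]_(p, d)) : set R :=
  [set s | 0 <= s /\ eigenvalue (M^T *m M) (s ^+ 2)].

Definition sigma_max {p d} (M : 'M[R]_(p, d)) : R := sup (singular_values M).

Definition sigma_min {p d} (M : 'M[R]_(p, d)) : R := inf (singular_values M).

Definition cond_number {p d} (M : 'M[R]_(p, d)) : R :=
  sigma_max M / sigma_min M.

Definition stable_rank {p d} (M : 'M[R]_(p, d)) : R :=
  fnorm M ^+ 2 / specnorm M ^+ 2.

End norms.

(* Moore-Penrose pseudoinverse; pinvmx of mxalgebra is only some generalized
   inverse. *)
Section pseudoinverse.
Context {R : realType}.

Definition is_pinv {p d} (M : 'M[R]_(p, d)) (X : 'M[R]_(d, p)) : Prop :=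
  [/\ M *m X *m M = M, X *m M *m X = X,
      (M *m X)^T = M *m X & (X *m M)^T = X *m M].

Definition pinv {p d} (M : 'M[R]_(p, d)) : 'M[R]_(d, p) :=
  xget 0 [set X | is_pinv M X].

Lemma is_pinv_uniq p d (M : 'M[R]_(p, d)) (X Y : 'M[R]_(d, p)) :
  is_pinv M X -> is_pinv M Y -> X = Y.
Proof.
move=> [a1 a2 a3 a4] [b1 b2 b3 b4].
have e1 : M *m X = M *m Y.
  by rewrite -a3 -{1}b1 -[_ *m X]mulmxA trmx_mul a3 b3 mulmxA a1.
have e2 : X *m M = Y *m M.
  rewrite -a4 -{1}b1 mulmxA mulmxA -mulmxA trmx_mul a4 b4.
  by rewrite -mulmxA (mulmxA M) a1.
by rewrite -a2 -mulmxA e1 mulmxA e2 b2.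
Qed.

Lemma mulmx_tr_eq0 p d (M : 'M[R]_(p, d)) : M *m M^T = 0 -> M = 0.
Proof.
move=> MM; apply/matrixP => i j; rewrite mxE.
have := congr1 (fun N : 'M[R]_p => N i i) MM; rewrite !mxE => /eqP.
rewrite psumr_eq0 => [/allP/(_ j)|l _]; last by rewrite mxE -expr2 sqr_ge0.
by rewrite mem_index_enum mxE -expr2 sqrf_eq0 => /(_ isT)/eqP.
Qed.

Lemma gram_unit p d (M : 'M[R]_(p, d)) : row_free M -> M *m M^T \in unitmx.
Proof.
move=> fM; rewrite -row_free_unit -kermx_eq0; apply/eqP.
set N := kermx _; have NM : N *m (M *m M^T) = 0 by exact: mulmx_ker.
have NM0 : N *m M = 0.
  apply: mulmx_tr_eq0; rewrite trmx_mul mulmxA -(mulmxA N) NM.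
  exact: mul0mx.
by apply: (row_free_inj fM); rewrite NM0 mul0mx.
Qed.

Lemma is_pinv_full_rank p q d (C : 'M[R]_(p, q)) (B : 'M[R]_(q, d)) :
  C^T *m C \in unitmx -> B *m B^T \in unitmx ->
  is_pinv (C *m B)
    (B^T *m invmx (B *m B^T) *m invmx (C^T *m C) *m C^T).
Proof.
move=> uC uB; set iB := invmx (B *m B^T); set iC := invmx (C^T *m C).
have sB : iB^T = iB by rewrite /iB trmx_inv trmx_mul trmxK.
have sC : iC^T = iC by rewrite /iC trmx_inv trmx_mul trmxK.
set M := C *m B; set X := (_ *m _).
have MX : M *m X = C *m iC *m C^T.
  by rewrite /M /X !mulmxA -(mulmxA C B) -(mulmxA C) mulmxV // mulmx1.
have XM : X *m M = B^T *m iB *m B.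
  by rewrite /M /X !mulmxA -(mulmxA _ C^T C) -(mulmxA _ iC) mulVmx // mulmx1.
split.
- by rewrite MX /M !mulmxA -(mulmxA _ C^T C) -(mulmxA C) mulVmx // mulmx1.
- rewrite XM /X !mulmxA -(mulmxA _ B B^T) -(mulmxA B^T iB).
  by rewrite mulVmx // mulmx1.
- by rewrite MX !trmx_mul trmxK sC mulmxA.
- by rewrite XM !trmx_mul trmxK sB mulmxA.
Qed.

Lemma pinvP p d (M : 'M[R]_(p, d)) : is_pinv M (pinv M).
Proof.
rewrite /pinv; case: xgetP => [X -> //|/= nX]; exfalso.
have := @is_pinv_full_rank _ _ _ (col_base M) (row_base M).
rewrite mulmx_base => H; apply: (nX _); apply: H.
  rewrite -{2}(trmxK (col_base M)); apply: gram_unit.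
  by rewrite /row_free mxrank_tr; exact: col_base_full.
by apply: gram_unit; exact: row_base_free.
Qed.

End pseudoinverse.

Definition measure_matrix_display : measure_display -> measure_display.
Proof. exact. Qed.

(* Product sigma-algebra on R^(p x d), i.e. the Borel one. *)
Section measurable_matrix.
Context {R : realType} (p d : nat).

Definition mx_cylinder : set (set 'M[R]_(p, d)) :=
  [set U | exists i j (B : set R),
     measurable B /\ U = [set M : 'M[R]_(p, d) | B (M i j)]].

Let mx_set0 : <<s mx_cylinder >> set0.
Proof. exact: sigma_algebra0. Qed.

Let mx_setC U : <<s mx_cylinder >> U -> <<s mx_cylinder >> (~` U).
Proof. exact: sigma_algebraC. Qed.

Let mx_bigcup (F : (set 'M[R]_(p, d))^nat) :
  (forall i, <<s mx_cylinder >> (F i)) -> <<s mx_cylinder >> (\bigcup_i F i).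
Proof. exact: sigma_algebra_bigcup. Qed.

HB.instance Definition _ := @isMeasurable.Build
  (measure_matrix_display default_measure_display) 'M[R]_(p, d)
  <<s mx_cylinder >> mx_set0 mx_setC mx_bigcup.

End measurable_matrix.

Section random_vectors.
Context {R : realType}.
Local Open Scope ereal_scope.

Definition mutually_independent {dO} {Omega : measurableType dO}
    (P : probability Omega R) {I : choiceType} {dT} {T : measurableType dT}
    (X : I -> Omega -> T) : Prop :=
  forall (J : {fset I}) (B : I -> set T), (forall i, measurable (B i)) ->
    P (\bigcap_(i in [set` J]) (X i @^-1` B i)) =
    \prod_(i <- J) P (X i @^-1` B i).

Definition same_law {dO dO' dT} {Omega : measurableType dO}
    {Omega' : measurableType dO'} {T : measurableType dT}
    (P : probability Omega R) (P' : probability Omega' R)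
    (X : Omega -> T) (Y : Omega' -> T) : Prop :=
  forall B : set T, measurable B -> P (X @^-1` B) = P' (Y @^-1` B).

Context {dO : measure_display} {Omega : measurableType dO}.
Variable P : probability Omega R.

(* The infimum is taken in \bar R, so that it is +oo when no t qualifies. *)
Definition subgaussian (K : R) (X : Omega -> R) : Prop :=
  ereal_inf [set t%:E | t in
    [set t : R | (0 < t)%R /\
       'E_P[fun w => expR (X w ^+ 2 / t ^+ 2)] <= 2%:E]] <= K%:E.

Definition vsubgaussian {d} (K : R) (x : Omega -> 'cV[R]_d) : Prop :=
  forall v : 'cV[R]_d, enorm v = 1%R ->
    subgaussian K (fun w => ((v^T *m x w) 0 0)%R).

Definition isotropic {d} (x : Omega -> 'cV[R]_d) : Prop :=
  forall i j, 'E_P[fun w => ((x w *m (x w)^T) i j)%R] =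
    ((1%:M : 'M[R]_d) i j)%R%:E.

Definition euclidean_concentration {d} (L : R) (x : Omega -> 'cV[R]_d) : Prop :=
  forall (p : nat) (M : 'M[R]_(p, d)),
    subgaussian (L * specnorm M)%R (fun w => enorm (M *m x w) - fnorm M)%R.

End random_vectors.

Section sketching.
Context {R : realType}.
Local Open Scope ereal_scope.

Definition rowv {T : Type} {k m} (S : T -> 'M[R]_(k, m)) (i : 'I_k) :
  T -> 'cV[R]_m := fun w => (row i (S w))^T%R.

Definition iid_rows {dO} {Omega : measurableType dO}
    (P : probability Omega R) {k m} (S : Omega -> 'M[R]_(k, m)) : Prop :=
  mutually_independent P (rowv S) /\
  forall i j, same_law P P (rowv S i) (rowv S j).

(* The expectation is finite, being at most fnorm A ^+ 2. *)
Definition Err {dO} {Omega : measurableType dO} (P : probability Omega R)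
    {q m n} (S : Omega -> 'M[R]_(q, m)) (A : 'M[R]_(m, n)) : R :=
  fine 'E_P[fun w =>
    (fnorm (A *m (1%:M - pinv (S w *m A) *m (S w *m A))) ^+ 2)%R].

Fixpoint sketch_project {k m n} (A : 'M[R]_(m, n)) (b : 'cV[R]_m)
    (S : nat -> 'M[R]_(k, m)) (x0 : 'cV[R]_n) (t : nat) : 'cV[R]_n :=
  if t is t'.+1 then
    let x := sketch_project A b S x0 t' in
    (x - pinv (S t' *m A) *m S t' *m (A *m x - b))%R
  else x0.

(* Worst-case expected convergence rate of sketch-and-project run with the
   random matrices S 0, S 1, ... towards the solution xstar of A x = b.
   By linearity it does not depend on the choice of b. *)
Definition Rate {dO} {Omega : measurableType dO} (P : probability Omega R)
    {k m n} (S : nat -> Omega -> 'M[R]_(k, m))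
    (A : 'M[R]_(m, n)) (b : 'cV[R]_m) (xstar : 'cV[R]_n) : \bar R :=
  ereal_sup [set rho%:E | rho in
    [set rho : R | forall (x0 : 'cV[R]_n) (t : nat),
      'E_P[fun w =>
        (enorm (sketch_project A b (S ^~ w) x0 t - xstar) ^+ 2)%R] <=
      ((1 - rho) ^+ t * enorm (x0 - xstar) ^+ 2)%:E]].

End sketching.

(* Main.v *)
(* Write x_i = A^T s_i for the rows s_i of S and Sigma = A^T A.  The projection
   onto the kernel of SA lies below the ridge resolvent
   G_k = lam (sum_i x_i x_i^T + lam)^-1, so the contraction factor of a step is
   at most the top eigenvalue mu of E G_k.  Taking lam = (L / sqrt r) |A|_F^2
   keeps every denominator away from 0, so no degenerate S needs care.
   Sherman-Morrison and exchangeability of the rows give the exact identity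
     I - E G_k = k E [x x^T G_(k-1) / (lam + x^T G_(k-1) x)],
   x being a fresh row.  It is paired with a top eigenvector v on one side and
   w = Sigma^-1 v on the other.  Euclidean concentration replaces the
   denominator by lam + tr (Sigma G_(k-1)), and a bounded-difference variance
   estimate replaces that trace by its mean, which is Err(A, k-1) up to a factor
   1 + O(L / sqrt r).  The first replacement costs
   (K^2 L / sqrt r) (E |A G_(k-1) v|^2)^(1/2) |A w| / |A|_F^2, and this is small
   because E |A G_j v|^2 is almost nondecreasing in j while
   sum_j E |A G_j v|^2 is at most O(|A|_F^2) (1 - mu). *)
From HB Require Import structures.
Require Import Defs.
From mathcomp Require Import ring lra measurable_realfun.

Set Implicit Arguments.
Unset Strict Implicit.
Unset Printing Implicit Defensive.

Local Open Scope classical_set_scope.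
Local Open Scope ring_scope.

(** * Euclidean geometry and ridge resolvents *)

(** The choice w = Sigma^-1 v keeps the condition number out of the loss: as E x x^T = Sigma, the
    numerator on the right averages to v^T G_(k-1) v >= mu, while on the left v^T w = |A w|^2 is at
    most 1 / sigma_min^2. The obstacle is the factor |A w| in the concentration error, for which no
    bound is known in advance. Either (1 - mu) |A w|^2 already reaches k / (lam + mean trace), which
    is more than required, or it is smaller, and then the summed bound gives E |A G_(k-1) v|^2 |A
    w|^2 <= 10, so that the two factors compensate. The level lam balances two errors, with eta = L
    / sqrt r: it shifts every denominator by a relative order eta, and the fourth moment of the
    Euclidean deviation contributes (L |A|)^4 / lam^2, which is of order eta^2 at this level. The
    variance estimate compares k |A|^4 with (eta |A|_F^2)^2, that is k with L^2 r; it closes because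
    L is bounded below by an absolute constant. Since S and S' live on different spaces, all means
    are written as iterates of one Markov operator built from a single row. *)

Section dot_product.
Context {R : realType}.

Definition dotp {d} (u v : 'cV[R]_d) : R := (u^T *m v) 0 0.

Lemma dotpE d (u v : 'cV[R]_d) : dotp u v = \sum_i u i 0 * v i 0.
Proof. by rewrite /dotp mxE; apply: eq_bigr => i _; rewrite mxE. Qed.

Lemma dotpC d (u v : 'cV[R]_d) : dotp u v = dotp v u.
Proof. by rewrite !dotpE; apply: eq_bigr => i _; rewrite mulrC. Qed.

Lemma dotpDr d (u v w : 'cV[R]_d) : dotp u (v + w) = dotp u v + dotp u w.
Proof. by rewrite /dotp mulmxDr mxE. Qed.

Lemma dotpDl d (u v w : 'cV[R]_d) : dotp (v + w) u = dotp v u + dotp w u.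
Proof. by rewrite ![dotp _ u]dotpC dotpDr. Qed.

Lemma dotpZr d (u v : 'cV[R]_d) a : dotp u (a *: v) = a * dotp u v.
Proof. by rewrite /dotp -scalemxAr mxE. Qed.

Lemma dotpZl d (u v : 'cV[R]_d) a : dotp (a *: v) u = a * dotp v u.
Proof. by rewrite ![dotp _ u]dotpC dotpZr. Qed.

Lemma dotpNr d (u v : 'cV[R]_d) : dotp u (- v) = - dotp u v.
Proof. by rewrite -scaleN1r dotpZr mulN1r. Qed.

Lemma dotpNl d (u v : 'cV[R]_d) : dotp (- v) u = - dotp v u.
Proof. by rewrite ![dotp _ u]dotpC dotpNr. Qed.

Definition dotp_lin := (dotpDl, dotpDr, dotpNl, dotpNr, dotpZl, dotpZr).

Lemma dotp_trmx p d (M : 'M[R]_(p, d)) (u : 'cV_p) (v : 'cV_d) :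
  dotp u (M *m v) = dotp (M^T *m u) v.
Proof. by rewrite /dotp trmx_mul trmxK mulmxA. Qed.

Lemma dotpxx_ge0 d (u : 'cV[R]_d) : 0 <= dotp u u.
Proof. by rewrite dotpE sumr_ge0// => i _; rewrite -expr2 sqr_ge0. Qed.

Lemma dotpxx_eq0 d (u : 'cV[R]_d) : dotp u u = 0 -> u = 0.
Proof.
rewrite dotpE => /eqP; rewrite psumr_eq0; last by move=> i _; rewrite -expr2 sqr_ge0.
move=> /allP h; apply/matrixP => i j; rewrite ord1 mxE; apply/eqP.
by have := h i; rewrite mem_index_enum -expr2 sqrf_eq0 => /(_ isT).
Qed.

Lemma enorm2 d (u : 'cV[R]_d) : enorm u ^+ 2 = dotp u u.
Proof.
rewrite /enorm sqr_sqrtr ?dotpE//; last by rewrite sumr_ge0// => i _; rewrite sqr_ge0.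
Qed.

Lemma enorm_ge0 d (u : 'cV[R]_d) : 0 <= enorm u.
Proof. exact: sqrtr_ge0. Qed.

Lemma enorm0 d : enorm (0 : 'cV[R]_d) = 0.
Proof. by rewrite /enorm big1 ?sqrtr0// => i _; rewrite mxE expr0n. Qed.

Lemma enorm_gt0 d (u : 'cV[R]_d) : u != 0 -> 0 < enorm u.
Proof.
move=> u0; rewrite lt_neqAle enorm_ge0 andbT; apply/eqP => e; move/eqP: u0; apply.
by apply: dotpxx_eq0; rewrite -enorm2 -e expr0n.
Qed.

Lemma dotp_delta d (i : 'I_d) (u : 'cV[R]_d) : dotp (delta_mx i 0) u = u i 0.
Proof.
rewrite dotpE (bigD1 i)//= big1 => [|l il]; first by rewrite !mxE !eqxx mul1r addr0.
by rewrite mxE (negPf il) mul0r.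
Qed.

Lemma mx_entry_dotp p q (M : 'M[R]_(p, q)) i j :
  M i j = dotp (delta_mx i 0) (M *m delta_mx j 0).
Proof. by rewrite dotp_delta -colE mxE. Qed.

Lemma enormZ d (u : 'cV[R]_d) (a : R) : enorm (a *: u) = `|a| * enorm u.
Proof.
apply: (@pexpIrn _ 2) => //; rewrite ?nnegrE ?mulr_ge0 ?enorm_ge0//.
by rewrite exprMn !enorm2 !dotp_lin real_normK ?num_real// mulrA.
Qed.

Lemma dotp_cs d (u v : 'cV[R]_d) : dotp u v ^+ 2 <= dotp u u * dotp v v.
Proof.
have [->|v0] := eqVneq v 0.
  by rewrite -(scale0r (0 : 'cV[R]_d)) !dotp_lin !mul0r expr0n mulr0.
have vv : 0 < dotp v v by rewrite -enorm2 exprn_gt0 ?enorm_gt0.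
have := dotpxx_ge0 (dotp v v *: u - dotp u v *: v).
rewrite !dotp_lin (dotpC v u) => h.
have : 0 <= dotp v v * (dotp u u * dotp v v - dotp u v ^+ 2) by lra.
by rewrite pmulr_rge0// subr_ge0.
Qed.

Lemma dotp_cs_enorm d (u v : 'cV[R]_d) : `|dotp u v| <= enorm u * enorm v.
Proof.
rewrite -ler_sqr ?nnegrE ?mulr_ge0 ?enorm_ge0//.
by rewrite real_normK ?num_real// exprMn !enorm2 dotp_cs.
Qed.

End dot_product.

(** * Frobenius and spectral norms *)

Section matrix_norms.
Context {R : realType}.

Lemma fnorm2 p d (M : 'M[R]_(p, d)) : fnorm M ^+ 2 = \tr (M^T *m M).
Proof.
rewrite /fnorm sqr_sqrtr; last first.
  by do 2 rewrite sumr_ge0// => ? _; rewrite sqr_ge0.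
rewrite exchange_big /mxtrace; apply: eq_bigr => j _; rewrite mxE.
by apply: eq_bigr => i _; rewrite mxE expr2.
Qed.

Lemma fnorm2_cols p d (M : 'M[R]_(p, d)) :
  fnorm M ^+ 2 = \sum_j dotp (col j M) (col j M).
Proof.
rewrite fnorm2 /mxtrace; apply: eq_bigr => j _; rewrite dotpE mxE.
by apply: eq_bigr => i _; rewrite !mxE.
Qed.

Lemma fnorm_ge0 p d (M : 'M[R]_(p, d)) : 0 <= fnorm M.
Proof. exact: sqrtr_ge0. Qed.

(** Cauchy-Schwarz row by row. Crude, but it bounds the set whose supremum is [specnorm]. *)
Lemma fnorm_bound p d (M : 'M[R]_(p, d)) (x : 'cV_d) :
  dotp (M *m x) (M *m x) <= fnorm M ^+ 2 * dotp x x.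
Proof.
rewrite fnorm2 mxtrace_mulC /mxtrace mulr_suml dotpE.
apply: ler_sum => i _; rewrite -expr2.
have -> : (M *m x) i 0 = dotp (row i M)^T x.
  by rewrite /dotp trmxK -row_mul [RHS]mxE.
apply: le_trans (dotp_cs _ _) _; rewrite le_eqVlt; apply/orP; left; apply/eqP.
by congr (_ * _); rewrite dotpE mxE; apply: eq_bigr => j _; rewrite !mxE.
Qed.

Lemma specnorm_set_bound p d (M : 'M[R]_(p, d)) :
  has_sup [set enorm (M *m x) | x in [set x : 'cV[R]_d | enorm x <= 1]].
Proof.
split.
  by exists (enorm (M *m 0)), 0 => //=; rewrite enorm0.
exists (fnorm M) => _ [x /= x1 <-].
rewrite -ler_sqr ?nnegrE ?enorm_ge0 ?fnorm_ge0// enorm2.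
apply: le_trans (fnorm_bound _ _) _; rewrite -enorm2 ler_piMr ?sqr_ge0//.
by rewrite exprn_ile1 ?enorm_ge0.
Qed.

Lemma specnorm_ge0 p d (M : 'M[R]_(p, d)) : 0 <= specnorm M.
Proof.
apply: le_trans (sup_upper_bound (specnorm_set_bound M) _); last first.
  by exists 0 => //=; rewrite enorm0.
exact: enorm_ge0.
Qed.

Lemma specnorm_bound p d (M : 'M[R]_(p, d)) (x : 'cV_d) :
  dotp (M *m x) (M *m x) <= specnorm M ^+ 2 * dotp x x.
Proof.
have [->|x0] := eqVneq x 0.
  by rewrite mulmx0 -[X in dotp X _](scale0r (0 : 'cV[R]_p)) dotp_lin mul0r
    mulr_ge0// ?sqr_ge0 ?dotpxx_ge0.
have xx := enorm_gt0 x0.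
have : enorm (M *m ((enorm x)^-1 *: x)) <= specnorm M.
  apply: (sup_upper_bound (specnorm_set_bound M)); exists ((enorm x)^-1 *: x) => //=.
  by rewrite enormZ ger0_norm ?invr_ge0 ?enorm_ge0// mulVf ?gt_eqF.
rewrite -scalemxAr enormZ ger0_norm ?invr_ge0 ?enorm_ge0//.
rewrite mulrC ler_pdivrMr// => h.
by rewrite -!enorm2 -exprMn ler_sqr// ?nnegrE ?mulr_ge0 ?enorm_ge0 ?specnorm_ge0.
Qed.

Lemma specnorm_le p d (M : 'M[R]_(p, d)) (c : R) : 0 <= c ->
  (forall x, dotp (M *m x) (M *m x) <= c ^+ 2 * dotp x x) -> specnorm M <= c.
Proof.
move=> c0 h; apply: ge_sup; first by case: (specnorm_set_bound M).
move=> _ [x /= x1 <-]; rewrite -ler_sqr ?nnegrE ?enorm_ge0// enorm2.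
apply: le_trans (h _) _; rewrite -enorm2 ler_piMr ?sqr_ge0//.
by rewrite exprn_ile1 ?enorm_ge0.
Qed.

(** Cauchy-Schwarz on |M^T u|^2 = <u, M M^T u>, followed by division by |M^T u|^2, avoids any
    singular value decomposition. *)
Lemma specnorm_tr_bound p d (M : 'M[R]_(p, d)) (u : 'cV_p) :
  dotp (M^T *m u) (M^T *m u) <= specnorm M ^+ 2 * dotp u u.
Proof.
set z := M^T *m u.
have e : dotp z z = dotp u (M *m z) by rewrite dotp_trmx.
have := dotp_cs u (M *m z); rewrite -e => h.
have h2 := specnorm_bound M z.
have z0 := dotpxx_ge0 z; have u0 := dotpxx_ge0 u.
have [->|zn] := eqVneq (dotp z z) 0; first by rewrite mulr_ge0// sqr_ge0.
have zp : 0 < dotp z z by rewrite lt_neqAle eq_sym zn.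
rewrite -(ler_pM2r zp) -expr2; apply: le_trans h _.
by rewrite [X in _ <= X * _]mulrC -mulrA ler_wpM2l.
Qed.

Lemma fnorm_specnorm p d (M : 'M[R]_(p, d)) :
  fnorm M ^+ 2 <= d%:R * specnorm M ^+ 2.
Proof.
rewrite fnorm2_cols mulr_natl -[X in _ *+ X]card_ord -sumr_const.
apply: ler_sum => j _; rewrite colE; apply: le_trans (specnorm_bound _ _) _.
by rewrite dotp_delta mxE !eqxx mulr1.
Qed.

End matrix_norms.

(** This is (1 + B / lam)^-1. The factor [lam] normalizes it to the identity at B = 0 and makes it
    decrease to the projection onto ker B as lam tends to 0. The lock keeps [invmx] folded. *)
HB.lock Definition ridge {R : realType} {n} (lam : R) (B : 'M[R]_n) : 'M[R]_n :=
  lam *: invmx (B + lam%:M).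

Section ridge.
Context {R : realType} {n : nat}.
Implicit Types (B : 'M[R]_n) (v w x : 'cV[R]_n).

(** Positive semidefiniteness with an explicit witness: symmetry, nonnegativity and Cauchy-Schwarz
    follow by algebra, without square roots of matrices. The free number of rows lets sums be formed
    by stacking. *)
Definition gram B := exists q (X : 'M[R]_(q, n)), B = X^T *m X.

Lemma gram0 : gram 0.
Proof. by exists 0%N, 0; rewrite mulmx0. Qed.

Lemma gram_add_rank1 B x : gram B -> gram (B + x *m x^T).
Proof.
by move=> [q [X ->]]; exists (q + 1)%N, (col_mx X x^T);
  rewrite tr_col_mx mul_row_col trmxK.
Qed.

Lemma gram_sym B : gram B -> B^T = B.
Proof. by move=> [q [X ->]]; rewrite trmx_mul trmxK. Qed.

Lemma gram_ge0 B v : gram B -> 0 <= dotp v (B *m v).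
Proof. by move=> [q [X ->]]; rewrite -mulmxA dotp_trmx trmxK dotpxx_ge0. Qed.

Lemma gram_cs B v w : gram B ->
  dotp v (B *m w) ^+ 2 <= dotp v (B *m v) * dotp w (B *m w).
Proof.
move=> [q [X ->]].
have e u z : dotp u (X^T *m X *m z) = dotp (X *m u) (X *m z).
  by rewrite -mulmxA dotp_trmx trmxK.
by rewrite !e dotp_cs.
Qed.

Variable lam : R.
Hypothesis lam0 : 0 < lam.

Section fixed_gram.
Variable B : 'M[R]_n.
Hypothesis gB : gram B.
Local Notation G := (ridge lam B).

Lemma ridge_unit : B + lam%:M \in unitmx.
Proof.
rewrite unitmxE unitfE; apply/negP => /det0P[v v0 vB].
move/eqP: v0; apply; apply: trmx_inj; rewrite trmx0.
have : dotp v^T ((B + lam%:M) *m v^T) = 0.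
  rewrite /dotp trmxK mulmxA vB mul0mx; exact: mxE.
rewrite mulmxDl mul_scalar_mx !dotp_lin => /eqP.
rewrite paddr_eq0 ?gram_ge0 ?mulr_ge0 ?dotpxx_ge0 ?ltW// => /andP[_].
by rewrite mulf_eq0 gt_eqF//= => /eqP/dotpxx_eq0.
Qed.

Lemma mul_ridge : (B + lam%:M) *m G = lam%:M.
Proof. by rewrite ridge.unlock -scalemxAr mulmxV ?ridge_unit// scalemx1. Qed.

Lemma ridge_mul : G *m (B + lam%:M) = lam%:M.
Proof. by rewrite ridge.unlock -scalemxAl mulVmx ?ridge_unit// scalemx1. Qed.

Lemma ridge_uniq H : (B + lam%:M) *m H = lam%:M -> H = G.
Proof.
move=> e; rewrite -[H](mulKmx ridge_unit) e ridge.unlock.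
by rewrite -scalemx1 -scalemxAr mulmx1.
Qed.

Lemma ridge_sym : G^T = G.
Proof.
apply: ridge_uniq; have := congr1 trmx ridge_mul.
by rewrite trmx_mul linearD/= (gram_sym gB) !tr_scalar_mx.
Qed.

Lemma ridgeB : G *m B = lam *: (1%:M - G).
Proof.
have := ridge_mul; rewrite mulmxDr mul_mx_scalar => /(canRL (addrK _)) ->.
by rewrite scalerBr scalemx1.
Qed.

(** Exhibits G as a sum of two Gram matrices, whence [gram_ridge]; dropping the second one gives G^2
    <= G, which is [ridge_norm]. *)
Lemma ridgeE : G = G *m G + lam^-1 *: (G *m B *m G).
Proof.
rewrite ridgeB -scalemxAl scalerA mulVf ?gt_eqF// scale1r.
by rewrite mulmxBl mul1mx addrC subrK.
Qed.

Lemma gram_ridge : gram G.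
Proof.
have [q [X BX]] := gB.
exists (n + q)%N, (col_mx G ((Num.sqrt lam)^-1 *: (X *m G))).
rewrite tr_col_mx mul_row_col [LHS]ridgeE ridge_sym; congr (_ + _).
have e : lam^-1 = (Num.sqrt lam)^-1 * (Num.sqrt lam)^-1.
  by rewrite -expr2 exprVn sqr_sqrtr// ltW.
have -> a (M : 'M[R]_(q, n)) : (a *: M)^T = a *: M^T.
  by apply/matrixP => i j; rewrite !mxE.
set a := (Num.sqrt lam)^-1 in e *; set XG := X *m G.
rewrite -(scalemxAl a XG^T) -(scalemxAr a XG^T) scalerA -e; congr (_ *: _).
by rewrite /XG trmx_mul ridge_sym BX !mulmxA.
Qed.

Lemma ridge_norm v : dotp (G *m v) (G *m v) <= dotp v (G *m v).
Proof.
have e z : dotp v (G *m z) = dotp (G *m v) z by rewrite dotp_trmx ridge_sym.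
have -> : dotp v (G *m v) = dotp v ((G *m G + lam^-1 *: (G *m B *m G)) *m v).
  by rewrite -ridgeE.
rewrite mulmxDl dotpDr -scalemxAl. rewrite dotpZr -!mulmxA !e lerDl.
by rewrite mulr_ge0 ?gram_ge0// invr_ge0 ltW.
Qed.

Lemma ridge_form_ge0 v : 0 <= dotp v (G *m v).
Proof. exact: gram_ge0 gram_ridge. Qed.

Lemma ridge_form_le v : dotp v (G *m v) <= dotp v v.
Proof.
have h := ridge_norm v; have := dotp_cs v (G *m v).
have [v0|vn] := eqVneq (dotp v (G *m v)) 0; first by rewrite v0 dotpxx_ge0.
have vp : 0 < dotp v (G *m v) by rewrite lt_neqAle eq_sym vn ridge_form_ge0.
rewrite expr2 => h2; rewrite -(ler_pM2r vp); apply: le_trans h2 _.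
by rewrite ler_wpM2l ?dotpxx_ge0.
Qed.

Lemma ridge_form_bound v w : `|dotp v (G *m w)| <= enorm v * enorm w.
Proof.
rewrite -ler_sqr ?nnegrE ?mulr_ge0 ?enorm_ge0//.
rewrite real_normK ?num_real// exprMn !enorm2.
apply: le_trans (gram_cs _ _ gram_ridge) _.
by rewrite ler_pM ?ridge_form_ge0 ?ridge_form_le.
Qed.

Lemma ridge_den_gt0 x : 0 < lam + dotp x (G *m x).
Proof. by rewrite ltr_wpDr ?ridge_form_ge0. Qed.

End fixed_gram.

Section rank_one_update.
Variables (B : 'M[R]_n) (x : 'cV[R]_n).
Hypothesis gB : gram B.
Local Notation G := (ridge lam B).
Local Notation xi := (dotp x (G *m x)).

Lemma mul_dotp p q (M : 'M[R]_(p, n)) (N : 'M[R]_(n, q)) (y : 'cV[R]_n)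
    (z : 'cV[R]_n) (u : 'cV[R]_p) (v : 'rV[R]_q) :
  u *m (y^T *m z) *m v = dotp y z *: (u *m v).
Proof. by rewrite (mx11_scalar (y^T *m z)) mul_mx_scalar -scalemxAl. Qed.

(** Sherman-Morrison, checked by multiplying the right side by B + x x^T + lam and using
    [ridge_uniq]. *)
Lemma ridge_rank1 : ridge lam (B + x *m x^T) =
  G - (lam + xi)^-1 *: (G *m x *m (G *m x)^T).
Proof.
have gB' := gram_add_rank1 x gB.
have -> : (G *m x)^T = x^T *m G by rewrite trmx_mul ridge_sym.
have xG : x *m x^T *m (G *m x *m (x^T *m G)) = xi *: (x *m (x^T *m G)).
  by rewrite -(mul_dotp 0 0) !mulmxA.
set H := G - _; suff e : (B + x *m x^T + lam%:M) *m H = lam%:M.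
  by rewrite (ridge_uniq gB' e).
have CG := mul_ridge gB; set C := B + lam%:M in CG.
rewrite /H mulmxBr -scalemxAr [_ + lam%:M]addrAC -/C 2!(mulmxDl C) xG.
have -> : C *m (G *m x *m (x^T *m G)) = lam *: (x *m (x^T *m G)).
  by rewrite mulmxA [X in X *m _]mulmxA CG mul_scalar_mx -scalemxAl.
rewrite CG -scalerDl scalerA mulVf ?gt_eqF ?ridge_den_gt0//.
by rewrite scale1r mulmxA addrK.
Qed.

Lemma ridge_rank1_form v w : dotp v (ridge lam (B + x *m x^T) *m w) =
  dotp v (G *m w) - dotp v (G *m x) * dotp x (G *m w) / (lam + xi).
Proof.
rewrite ridge_rank1 mulmxBl !dotp_lin -scalemxAl dotpZr; congr (_ - _).
rewrite mulrC; congr (_ / _).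
rewrite trmx_mul ridge_sym// /dotp -!mulmxA.
rewrite (mx11_scalar (x^T *m (G *m w))) !mul_mx_scalar -!scalemxAr mxE mulrC.
by rewrite !mxE !mulr1n.
Qed.

(** Trades the resolvent that contains x for the one without it, at the price of a scalar; this is
    how independence of x enters the leave-one-out identity. *)
Lemma ridge_rank1_vec : ridge lam (B + x *m x^T) *m x =
  (lam / (lam + xi)) *: (G *m x).
Proof.
rewrite ridge_rank1 mulmxBl -scalemxAl trmx_mul ridge_sym// -!mulmxA.
rewrite (mx11_scalar (x^T *m _)) -/(dotp x (G *m x)) !mul_mx_scalar.
rewrite -scalemxAr scalerA -{1}[G *m x]scale1r -scalerBl; congr (_ *: _).
have := ridge_den_gt0 gB x; set y := dotp _ _ => h.
by field; rewrite gt_eqF.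
Qed.

End rank_one_update.

Section weighted_trace.
Context {m : nat} (A : 'M[R]_(m, n)).

(** The trace of Sigma H with Sigma = A^T A, written so that a Gram factorization of H turns it into
    a sum of squared norms. *)
Definition wtr (H : 'M[R]_n) : R := \tr (A *m H *m A^T).

Lemma wtrB H H' : wtr (H - H') = wtr H - wtr H'.
Proof. by rewrite /wtr mulmxBr mulmxBl linearB. Qed.

Lemma wtrZ a H : wtr (a *: H) = a * wtr H.
Proof. by rewrite /wtr -scalemxAr -scalemxAl linearZ. Qed.

Lemma wtr_rank1 (u : 'cV[R]_n) : wtr (u *m u^T) = dotp (A *m u) (A *m u).
Proof.
rewrite /wtr mulmxA -mulmxA -trmx_mul mxtrace_mulC.
by rewrite /mxtrace big_ord1.
Qed.

Lemma wtr1 : wtr 1%:M = fnorm A ^+ 2.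
Proof. by rewrite /wtr mulmx1 mxtrace_mulC fnorm2. Qed.

Lemma tr_cols q (Y : 'M[R]_(q, n)) :
  \tr (Y^T *m Y) = \sum_j dotp (col j Y^T) (col j Y^T).
Proof. by rewrite mxtrace_mulC -{1}[Y]trmxK -fnorm2 fnorm2_cols. Qed.

Lemma wtr_cols q (Y : 'M[R]_(q, n)) :
  wtr (Y^T *m Y) = \sum_j dotp (A *m col j Y^T) (A *m col j Y^T).
Proof.
rewrite /wtr !mulmxA -mulmxA -[Y *m A^T]trmxK trmx_mul trmxK mxtrace_mulC.
rewrite -fnorm2 fnorm2_cols; apply: eq_bigr => j _.
by rewrite !colE !mulmxA.
Qed.

Lemma wtr_ge0 H : gram H -> 0 <= wtr H.
Proof.
by move=> [q [Y ->]]; rewrite wtr_cols sumr_ge0// => j _; exact: dotpxx_ge0.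
Qed.

Lemma wtr_le H : gram H -> wtr H <= specnorm A ^+ 2 * \tr H.
Proof.
move=> [q [Y ->]]; rewrite wtr_cols tr_cols mulr_sumr.
by apply: ler_sum => j _; exact: specnorm_bound.
Qed.

Lemma wtr_ge H c : gram H ->
  (forall v, c * dotp v v <= dotp (A *m v) (A *m v)) -> c * \tr H <= wtr H.
Proof.
by move=> [q [Y ->]] h; rewrite wtr_cols tr_cols mulr_sumr; apply: ler_sum.
Qed.

End weighted_trace.
End ridge.

(** * The projection onto a kernel and its comparison with the ridge resolvent *)

Section kernel_projection.
Context {R : realType} {q n : nat}.
Variable X : 'M[R]_(q, n).
Local Notation Y := (pinv X).

Definition kerproj : 'M[R]_n := 1%:M - Y *m X.

Lemma kerproj_sym : kerproj^T = kerproj.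
Proof.
by rewrite /kerproj linearB/= trmx1; have [_ _ _ ->] := pinvP X.
Qed.

Lemma mul_kerproj : X *m kerproj = 0.
Proof.
by rewrite /kerproj mulmxBr mulmx1 mulmxA; have [-> _ _ _] := pinvP X; rewrite subrr.
Qed.

Lemma kerproj_idem : kerproj *m kerproj = kerproj.
Proof. by rewrite {1}/kerproj mulmxBl mul1mx -mulmxA mul_kerproj mulmx0 subr0. Qed.

Lemma gram_kerproj : gram kerproj.
Proof. by exists n, kerproj; rewrite kerproj_sym kerproj_idem. Qed.

Lemma kerproj_norm v : dotp (kerproj *m v) (kerproj *m v) = dotp v (kerproj *m v).
Proof. by rewrite dotp_trmx kerproj_sym mulmxA kerproj_idem dotpC. Qed.

(** X Y is a symmetric idempotent, so the deficit q - tr (X Y) is the squared Frobenius norm of 1 -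
    X Y. No rank assumption on X enters. *)
Lemma tr_pinv_le : \tr (Y *m X) <= q%:R.
Proof.
rewrite mxtrace_mulC -subr_ge0.
have [e _ es _] := pinvP X; set Z := X *m Y in es e *.
have ZZ : Z *m Z = Z by rewrite {2}/Z mulmxA e.
have -> : q%:R - \tr Z = fnorm (1%:M - Z) ^+ 2.
  rewrite fnorm2 [(1%:M - Z)^T]linearB/= trmx1 es mulmxBl mul1mx mulmxBr mulmx1 ZZ subrr subr0.
  by rewrite linearB/= mxtrace1.
exact: sqr_ge0.
Qed.

Variable lam : R.
Hypothesis lam0 : 0 < lam.
Local Notation G := (ridge lam (X^T *m X)).

Let gX : gram (X^T *m X). Proof. by exists q, X. Qed.

Lemma ridge_kerproj : G *m kerproj = kerproj.
Proof.
have := ridge_mul lam0 gX; move=> /(congr1 (mulmxr kerproj))/=.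
rewrite -mulmxA mulmxDl -[X in X + _]mulmxA mul_kerproj mulmx0 add0r !mul_scalar_mx.
rewrite -scalemxAr => /(congr1 (fun Z => lam^-1 *: Z)).
by rewrite !scalerA mulVf ?gt_eqF// !scale1r.
Qed.

Lemma kerproj_ridge : kerproj *m G = kerproj.
Proof. by apply: trmx_inj; rewrite trmx_mul ridge_sym// kerproj_sym ridge_kerproj. Qed.

(** G fixes the kernel, so the difference is G Y X, and Y X = X^T X Y Y^T. The explicit factor [lam]
    shows that the resolvents converge to the projection, which serves measurability. *)
Lemma ridge_sub_kerproj : G - kerproj = lam *: ((1%:M - G) *m (Y *m Y^T)).
Proof.
have [_ e2 e3 e4] := pinvP X.
have e : Y *m X = X^T *m X *m (Y *m Y^T).
  have yt : Y^T = X *m Y *m Y^T by rewrite -{1}e2 -mulmxA trmx_mul e3.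
  by rewrite -e4 trmx_mul {1}yt !mulmxA.
have -> : G - kerproj = G *m (Y *m X).
  rewrite -{1}[G]mulmx1 -{1}ridge_kerproj /kerproj -mulmxBr; congr (_ *m _).
  by rewrite opprB addrC subrK.
by rewrite e mulmxA ridgeB// scalemxAl.
Qed.

(** With P the projection, G P = P G = P, so G - P = (1 - P) G (1 - P). *)
Lemma gram_ridge_sub_kerproj : gram (G - kerproj).
Proof.
have [p [N GN]] := gram_ridge lam0 gX.
exists p, (N *m (1%:M - kerproj)).
have sP : (1%:M - kerproj)^T = 1%:M - kerproj.
  by apply/matrixP => i j; rewrite -[in RHS]kerproj_sym !mxE eq_sym.
rewrite trmx_mul sP -mulmxA [N^T *m _]mulmxA -GN.
rewrite mulmxBl mul1mx mulmxBr mulmx1 ridge_kerproj mulmxBr kerproj_ridge.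
by rewrite kerproj_idem subrr subr0.
Qed.

Lemma kerproj_le_ridge v : dotp v (kerproj *m v) <= dotp v (G *m v).
Proof.
have := gram_ge0 v gram_ridge_sub_kerproj.
by rewrite mulmxBl !dotp_lin subr_ge0.
Qed.

(** G - P is positive semidefinite, so its weighted trace is at most |A|^2 times its plain trace,
    and the latter is controlled through the rank bound [tr_pinv_le]. *)
Lemma wtr_ridge_le m (A : 'M[R]_(m, n)) :
  wtr A G - specnorm A ^+ 2 * (q%:R - \tr (1%:M - G)) <= wtr A kerproj.
Proof.
have := wtr_le A gram_ridge_sub_kerproj; rewrite wtrB.
have : \tr (G - kerproj) <= q%:R - \tr (1%:M - G).
  have := tr_pinv_le; rewrite /kerproj !linearB/= !linearN/=; lra.
move=> /(ler_wpM2l (sqr_ge0 (specnorm A))); lra.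
Qed.

End kernel_projection.

(** * Extreme eigenvalues and singular values through Rayleigh quotients *)

Section extreme_eigenvalues.
Context {R : realType} {n : nat}.
Hypothesis n0 : (0 < n)%N.
Variable M : 'M[R]_n.
Hypothesis sM : M^T = M.

Lemma exists_enorm1 : exists v : 'cV[R]_n, enorm v = 1.
Proof.
case: n n0 => // n' _; exists (delta_mx 0 0).
apply: (@pexpIrn _ 2) => //; rewrite ?nnegrE ?enorm_ge0//.
by rewrite enorm2 dotp_delta mxE !eqxx expr1n.
Qed.

Lemma enorm_fnorm (N : 'M[R]_n) v : enorm (N *m v) <= fnorm N * enorm v.
Proof.
rewrite -ler_sqr ?nnegrE ?mulr_ge0 ?enorm_ge0 ?fnorm_ge0//.
by rewrite exprMn !enorm2 fnorm_bound.
Qed.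

Lemma form_fnorm (N : 'M[R]_n) v : `|dotp v (N *m v)| <= fnorm N * dotp v v.
Proof.
apply: le_trans (dotp_cs_enorm _ _) _; rewrite -enorm2 expr2 mulrCA.
by rewrite ler_wpM2l ?enorm_ge0// enorm_fnorm.
Qed.

(** Evaluate the form at v - t N v with t = 1 / (|N|_F + 1); the summand 1 keeps t defined for N =
    0. *)
Lemma psd_norm_le (N : 'M[R]_n) v : N^T = N ->
  (forall x, 0 <= dotp x (N *m x)) ->
  dotp (N *m v) (N *m v) <= (fnorm N + 1) * dotp v (N *m v).
Proof.
move=> sN N0; set F := fnorm N; have F0 : 0 <= F := fnorm_ge0 N.
have F1 : 0 < F + 1 by lra.
set t := (F + 1)^-1; have t0 : 0 < t by rewrite invr_gt0.
have tF : t * (F + 1) = 1 by rewrite mulVf ?gt_eqF.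
set u := N *m v; have := N0 (v - t *: u).
rewrite mulmxBr -scalemxAr !dotp_lin -/u.
have -> : dotp v (N *m u) = dotp u u by rewrite dotp_trmx sN.
have := form_fnorm N u; rewrite -/F ger0_norm ?N0// => h1 h2.
have u0 := dotpxx_ge0 u.
have : t ^+ 2 * dotp u (N *m u) <= t ^+ 2 * (F * dotp u u).
  by rewrite ler_wpM2l ?sqr_ge0.
have -> : t ^+ 2 * (F * dotp u u) = t * dotp u u * (t * (F + 1)) - t ^+ 2 * dotp u u.
  by ring.
rewrite tF => h3.
have h4 : t * dotp u u <= dotp v u.
  by have := mulr_ge0 (sqr_ge0 t) u0; lra.
by rewrite -(ler_pM2l t0) mulrA tF mul1r.
Qed.

(** No compactness is invoked. With mu the infimum of the Rayleigh quotient, N = M - mu is positive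
    semidefinite; if N were invertible, [psd_norm_le] would bound |x|^2 by a multiple f of the form
    of N and lift the quotient to mu + 1/f everywhere. So N is singular, and a kernel vector is an
    eigenvector. *)
Lemma min_eigen : exists (mu : R) (v : 'cV[R]_n), [/\ enorm v = 1,
  M *m v = mu *: v & forall x, mu * dotp x x <= dotp x (M *m x)].
Proof.
pose S := [set dotp x (M *m x) | x in [set x : 'cV[R]_n | enorm x = 1]].
have S0 : has_inf S.
  split; first by have [v v1] := exists_enorm1; exists (dotp v (M *m v)), v.
  exists (- fnorm M) => _ [x /= x1 <-].
  have := form_fnorm M x; rewrite -enorm2 x1 expr1n mulr1 ler_norml => /andP[].
  by [].
pose mu := inf S.
have muP x : mu * dotp x x <= dotp x (M *m x).
  have [->|x0] := eqVneq x 0.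
    by rewrite -(scale0r (0 : 'cV[R]_n)) !dotp_lin !mul0r mulr0.
  have ex := enorm_gt0 x0.
  have : mu <= dotp ((enorm x)^-1 *: x) (M *m ((enorm x)^-1 *: x)).
    apply: (inf_lbound S0.2); exists ((enorm x)^-1 *: x) => //=.
    by rewrite enormZ ger0_norm ?invr_ge0 ?enorm_ge0// mulVf ?gt_eqF.
  rewrite -scalemxAr !dotp_lin mulrA -expr2 exprVn mulrC ler_pdivlMr ?exprn_gt0//.
  by rewrite enorm2.
pose N := M - mu%:M.
have sN : N^T = N by rewrite /N linearB/= sM tr_scalar_mx.
have NE x : dotp x (N *m x) = dotp x (M *m x) - mu * dotp x x.
  by rewrite /N mulmxBl mul_scalar_mx !dotp_lin.
have N0 x : 0 <= dotp x (N *m x) by rewrite NE subr_ge0.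
have [/det0P[v v0 vN]|dN] := boolP (\det N == 0).
  have v1 : 0 < enorm v^T.
    by apply: enorm_gt0; apply: contraNneq v0 => e; rewrite -[v]trmxK e trmx0.
  exists mu, ((enorm v^T)^-1 *: v^T); split=> //.
    by rewrite enormZ ger0_norm ?invr_ge0 ?enorm_ge0// mulVf ?gt_eqF.
  rewrite -scalemxAr scalerA mulrC -scalerA; congr (_ *: _).
  apply/eqP; rewrite -subr_eq0 -mul_scalar_mx -mulmxBl -/N -sN -trmx_mul vN.
  by rewrite trmx0.
exfalso; have uN : N \in unitmx by rewrite unitmxE unitfE.
pose f := fnorm (invmx N) ^+ 2 * (fnorm N + 1).
have fP x : dotp x x <= f * dotp x (N *m x).
  rewrite -{1 2}[x](mulKmx uN); apply: le_trans (fnorm_bound _ _) _.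
  by rewrite /f -mulrA ler_wpM2l ?sqr_ge0// psd_norm_le.
have f0 : 0 < f.
  have [v v1] := exists_enorm1; have := fP v; rewrite -enorm2 v1 expr1n => h.
  rewrite lt_neqAle; apply/andP; split.
    by apply/eqP => e; move: h; rewrite -e mul0r ler10.
  by rewrite /f mulr_ge0 ?sqr_ge0// addr_ge0// fnorm_ge0.
suff : mu + f^-1 <= mu by rewrite gerDl invr_le0 leNgt f0.
apply: lb_le_inf; first by case: S0.
move=> _ [x /= x1 <-]; have := fP x; rewrite NE -enorm2 x1 expr1n mulr1.
by rewrite mulrC -ler_pdivrMr// div1r lerBrDl.
Qed.

End extreme_eigenvalues.

Lemma max_eigen {R : realType} {n : nat} (M : 'M[R]_n) : (0 < n)%N -> M^T = M ->
  exists (mu : R) (v : 'cV[R]_n), [/\ enorm v = 1,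
    M *m v = mu *: v & forall x, dotp x (M *m x) <= mu * dotp x x].
Proof.
move=> n0 sM; have sM' : (- M)^T = - M by rewrite linearN/= sM.
have [mu [v [v1 e h]]] := min_eigen n0 sM'.
exists (- mu), v; split=> //.
  by rewrite scaleNr -e mulNmx opprK.
by move=> x; have := h x; rewrite mulNmx dotpNr lerNr mulNr.
Qed.

Lemma sigma_min_ge0 {R : realType} {m n : nat} (A : 'M[R]_(m, n)) :
  0 <= sigma_min A.
Proof.
have [[s hs]|/forallNP e] := pselect (exists s, singular_values A s).
  by apply: lb_le_inf; [exists s|move=> x []].
rewrite /sigma_min (_ : singular_values A = set0) ?inf0//.
by apply/seteqP; split=> // x /e.
Qed.

(** The minimum of the Rayleigh quotient of A^T A is an eigenvalue, so its square root is a member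
    of [singular_values A] and dominates their infimum. *)
Lemma sigma_min_bound {R : realType} {m n : nat} (A : 'M[R]_(m, n))
    (v : 'cV[R]_n) : (0 < n)%N ->
  sigma_min A ^+ 2 * dotp v v <= dotp (A *m v) (A *m v).
Proof.
move=> n0; have sA : (A^T *m A)^T = A^T *m A by rewrite trmx_mul trmxK.
have [mu [w [w1 e h]]] := min_eigen n0 sA.
have AE x : dotp x (A^T *m A *m x) = dotp (A *m x) (A *m x).
  by rewrite -mulmxA dotp_trmx trmxK.
have mu0 : 0 <= mu.
  have := AE w; rewrite e dotpZr -enorm2 w1 expr1n mulr1 => ->.
  exact: dotpxx_ge0.
suff : sigma_min A ^+ 2 <= mu.
  by move=> /(ler_wpM2r (dotpxx_ge0 v)) /le_trans; apply; rewrite -AE.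
suff : sigma_min A <= Num.sqrt mu.
  by move=> sq; rewrite -[leRHS]sqr_sqrtr// ler_sqr ?nnegrE ?sqrtr_ge0 ?sigma_min_ge0.
apply: ge_inf; first by exists 0 => x [].
split; first exact: sqrtr_ge0.
rewrite sqr_sqrtr//; apply/eigenvalueP; exists w^T.
  by apply: trmx_inj; rewrite trmx_mul trmxK sA e linearZ/= trmxK.
apply/eqP => /(congr1 trmx); rewrite trmxK trmx0 => w0.
by move: w1; rewrite w0 enorm0 => /eqP; rewrite eq_sym oner_eq0.
Qed.

(** * Measurability *)

Section measurable_real.
Context {R : realType} {dT} {T : measurableType dT}.
Implicit Types f g : T -> R.

Lemma measurable_inv_fun f : measurable_fun setT f ->
  measurable_fun setT (fun t => (f t)^-1).
Proof.
suff mi : measurable_fun setT (GRing.inv : R -> R) by exact: measurableT_comp.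
rewrite -(setUv [set (0 : R)]); apply/measurable_funU => //.
  exact: measurableC.
split; first exact: measurable_fun_set1.
apply: open_continuous_measurable_fun; first by rewrite (_ : ~` _ = [set x : R | x != 0]) ?predeqE; [exact: open_neq|split=> /eqP].
move=> x /[!inE]/= x0; apply: inv_continuous.
by apply/eqP.
Qed.

Lemma measurable_sqrt_fun f : measurable_fun setT f ->
  measurable_fun setT (fun t => Num.sqrt (f t)).
Proof.
suff mi : measurable_fun setT (Num.sqrt : R -> R) by exact: measurableT_comp.
by apply: continuous_measurable_fun; exact: sqrt_continuous.
Qed.

Lemma measurable_mul_fun f g : measurable_fun setT f -> measurable_fun setT g ->
  measurable_fun setT (fun t => f t * g t).
Proof. exact: measurable_funM. Qed.

Lemma measurable_add_fun f g : measurable_fun setT f -> measurable_fun setT g ->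
  measurable_fun setT (fun t => f t + g t).
Proof. exact: measurable_funD. Qed.

Lemma measurable_opp_fun f : measurable_fun setT f ->
  measurable_fun setT (fun t => - f t).
Proof. by move=> mf; exact: measurableT_comp. Qed.

Lemma measurable_norm_fun f : measurable_fun setT f ->
  measurable_fun setT (fun t => `|f t|).
Proof. by move=> mf; exact: measurableT_comp. Qed.

End measurable_real.

Section measurable_mx.
Context {R : realType} {dT} {T : measurableType dT}.

Lemma measurable_entry p q (i : 'I_p) (j : 'I_q) :
  measurable_fun setT (fun M : 'M[R]_(p, q) => M i j).
Proof.
move=> _ B mB; rewrite setTI; apply: sub_sigma_algebra.
by exists i, j, B.
Qed.

Lemma measurable_mxP p q (F : T -> 'M[R]_(p, q)) :
  measurable_fun setT F <-> forall i j, measurable_fun setT (fun t => F t i j).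
Proof.
split=> [mF i j|mF].
  by apply: (measurableT_comp (measurable_entry i j)).
apply: (measurability (mx_cylinder (R := R) (p := p) (d := q))) => //.
move=> _ [_ [i [j [B [mB ->]]]] <-].
exact: mF.
Qed.

Lemma measurable_mxD p q (F G : T -> 'M[R]_(p, q)) :
  measurable_fun setT F -> measurable_fun setT G ->
  measurable_fun setT (fun t => F t + G t).
Proof.
move=> /measurable_mxP mF /measurable_mxP mG; apply/measurable_mxP => i j.
by under eq_fun do rewrite mxE; exact: measurable_add_fun.
Qed.

Lemma measurable_mxN p q (F : T -> 'M[R]_(p, q)) :
  measurable_fun setT F -> measurable_fun setT (fun t => - F t).
Proof.
move=> /measurable_mxP mF; apply/measurable_mxP => i j.
by under eq_fun do rewrite mxE; exact: measurable_opp_fun.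
Qed.

Lemma measurable_mxZ p q (a : T -> R) (F : T -> 'M[R]_(p, q)) :
  measurable_fun setT a -> measurable_fun setT F ->
  measurable_fun setT (fun t => a t *: F t).
Proof.
move=> ma /measurable_mxP mF; apply/measurable_mxP => i j.
by under eq_fun do rewrite mxE; exact: measurable_mul_fun.
Qed.

Lemma measurable_mulmx p q r (F : T -> 'M[R]_(p, q)) (G : T -> 'M[R]_(q, r)) :
  measurable_fun setT F -> measurable_fun setT G ->
  measurable_fun setT (fun t => F t *m G t).
Proof.
move=> /measurable_mxP mF /measurable_mxP mG; apply/measurable_mxP => i j.
under eq_fun do rewrite mxE.
by apply: measurable_sum => l; exact: measurable_mul_fun.
Qed.

Lemma measurable_trmx p q (F : T -> 'M[R]_(p, q)) :
  measurable_fun setT F -> measurable_fun setT (fun t => (F t)^T).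
Proof.
move=> /measurable_mxP mF; apply/measurable_mxP => i j.
under eq_fun do rewrite mxE.
exact: mF.
Qed.

Lemma measurable_row p q (i : 'I_p) (F : T -> 'M[R]_(p, q)) :
  measurable_fun setT F -> measurable_fun setT (fun t => row i (F t)).
Proof.
move=> /measurable_mxP mF; apply/measurable_mxP => j l.
under eq_fun do rewrite mxE.
exact: mF.
Qed.

Lemma measurable_dotp p (F G : T -> 'cV[R]_p) :
  measurable_fun setT F -> measurable_fun setT G ->
  measurable_fun setT (fun t => dotp (F t) (G t)).
Proof.
move=> mF mG; have /measurable_mxP/(_ 0 0) : measurable_fun setT (fun t => (F t)^T *m G t).
  by apply: measurable_mulmx => //; exact: measurable_trmx.
by [].
Qed.

Lemma measurable_mxtrace p (F : T -> 'M[R]_p) :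
  measurable_fun setT F -> measurable_fun setT (fun t => \tr (F t)).
Proof.
move=> /measurable_mxP mF; rewrite /mxtrace.
exact: measurable_sum.
Qed.

Lemma measurable_det p (F : T -> 'M[R]_p) :
  measurable_fun setT F -> measurable_fun setT (fun t => \det (F t)).
Proof.
move=> /measurable_mxP mF; rewrite /determinant.
apply: measurable_sum => s; apply: measurable_mul_fun => //.
exact: measurable_prod.
Qed.

Lemma measurable_invmx p (F : T -> 'M[R]_p) :
  measurable_fun setT F -> measurable_fun setT (fun t => invmx (F t)).
Proof.
move=> mF; have md := measurable_det mF; have /measurable_mxP mF' := mF.
rewrite /invmx; under eq_fun do rewrite unitmxE unitfE.
(* [invmx] is the adjugate formula where the determinant is nonzero and returns its argument
   elsewhere, so the two branches are treated separately. *)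
apply: measurable_fun_ifT => //.
  apply: (measurable_fun_bool true).
  rewrite [X in measurable X](_ : _ = (fun t => \det (F t)) @^-1` (~` [set 0])).
    by rewrite -[X in measurable X]setTI; apply: md => //; exact: measurableC.
  by apply/seteqP; split => t /= h; [case: h => _ /eqP|split=> //; apply/eqP].
apply: measurable_mxZ; first exact: measurable_inv_fun.
apply/measurable_mxP => i j; under eq_fun do rewrite mxE.
apply: measurable_mul_fun => //; apply: measurable_det.
apply/measurable_mxP => k l; under eq_fun do rewrite !mxE.
exact: mF'.
Qed.

Lemma measurable_ridge p (lam : R) (F : T -> 'M[R]_p) :
  measurable_fun setT F -> measurable_fun setT (fun t => ridge lam (F t)).
Proof.
move=> mF; rewrite ridge.unlock; apply: measurable_mxZ => //.
by apply: measurable_invmx; exact: measurable_mxD.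
Qed.

(** The pseudoinverse is chosen by [xget], which gives no formula to measure. The projection is
    instead the entrywise limit of ridge resolvents at levels 1/(k+1), by [ridge_sub_kerproj]; the
    constant [C] does not depend on the level. *)
Lemma measurable_kerproj p q (F : T -> 'M[R]_(p, q)) :
  measurable_fun setT F -> measurable_fun setT (fun t => kerproj (F t)).
Proof.
move=> mF; apply/measurable_mxP => i j.
pose h (k : nat) t := ridge k.+1%:R^-1 ((F t)^T *m F t) i j.
apply: (measurable_fun_cvg (h := h)).
  move=> k; have /measurable_mxP : measurable_fun setT
    (fun t => ridge k.+1%:R^-1 ((F t)^T *m F t)); last exact.
  apply: measurable_ridge.
  by apply: measurable_mulmx => //; exact: measurable_trmx.
move=> t _; rewrite /h; set X := F t.
pose C := enorm (delta_mx i 0 : 'cV[R]_q) * enorm (pinv X *m (pinv X)^T *m delta_mx j 0)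
  + `|dotp (delta_mx i 0) (pinv X *m (pinv X)^T *m delta_mx j 0)|.
have Ck k : `|kerproj X i j - ridge k.+1%:R^-1 (X^T *m X) i j| <= k.+1%:R^-1 * C.
  have k0 : 0 < k.+1%:R^-1 :> R by rewrite invr_gt0.
  rewrite distrC !mx_entry_dotp -dotpNr -dotpDr -mulmxBl ridge_sub_kerproj//.
  rewrite -scalemxAl dotpZr normrM gtr0_norm// ler_wpM2l ?(ltW k0)//.
  rewrite -mulmxA mulmxBl mul1mx dotpDr dotpNr.
  apply: le_trans (ler_normB _ _) _; rewrite [leLHS]addrC lerD//.
  by apply: ridge_form_bound => //; exists p, X.
apply/cvgrPdist_le => e e0.
near=> k; apply: le_trans (Ck k) _.
have C0 : 0 <= C by rewrite addr_ge0 ?mulr_ge0 ?enorm_ge0.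
rewrite mulrC -ler_pdivlMr ?invr_gt0// invrK.
rewrite -ler_pdivrMl//.
near: k; exists (Num.trunc (e^-1 * C)) => // k /= hk.
apply: le_trans (ltW (truncnS_gt _)) _.
by rewrite ler_nat.
Unshelve. all: by end_near.
Qed.

End measurable_mx.

(** * Independence *)

Section independent_pair.
Context {R : realType}.
Context {d1 d2 dU dT} {O1 : measurableType d1} {O2 : measurableType d2}
  {U : measurableType dU} {T : measurableType dT}.
Variables (P1 : probability O1 R) (P2 : probability O2 R).
Variables (Y : O1 -> U) (X : O1 -> T) (X' : O2 -> T).
Hypotheses (mY : measurable_fun setT Y) (mX : measurable_fun setT X).
Hypothesis mX' : measurable_fun setT X'.
Hypothesis lawX : same_law P1 P2 X X'.

Definition indep_pair := forall A B, measurable A -> measurable B ->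
  P1 (Y @^-1` A `&` X @^-1` B) = (P1 (Y @^-1` A) * P1 (X @^-1` B))%E.

Hypothesis indYX : indep_pair.

(** The law of (Y, X) is the product of the laws of Y and X', and Tonelli applies. Taking the copy
    X' on a second space separates the fresh variable from the past. *)
Lemma ge0_integral_indep (h : U * T -> \bar R) :
  measurable_fun setT h -> (forall z, (0 <= h z)%E) ->
  (\int[P1]_w h (Y w, X w) = \int[P1]_w \int[P2]_w' h (Y w, X' w'))%E.
Proof.
move=> mh h0.
pose Ym : {RV P1 >-> U} := HB.pack Y (isMeasurableFun.Build _ _ _ _ _ mY).
pose Xm : {RV P2 >-> T} := HB.pack X' (isMeasurableFun.Build _ _ _ _ _ mX').
have mYX : measurable_fun setT (fun w => (Y w, X w)) by exact: measurable_fun_pair.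
pose YX : {RV P1 >-> (U * T)%type} :=
  HB.pack (fun w => (Y w, X w)) (isMeasurableFun.Build _ _ _ _ _ mYX).
transitivity (\int[distribution P1 YX]_z h z)%E.
  by rewrite ge0_integral_distribution.
transitivity (\int[(distribution P1 Ym \x distribution P2 Xm)%E]_z h z)%E.
  apply: eq_measure_integral => A mA _; apply/esym.
  apply: product_measure_unique => // B C mB mC.
  by have := indYX mB mC; rewrite (lawX mC).
rewrite fubini_tonelli1//.
rewrite ge0_integral_distribution; first last.
- by move=> u; apply: integral_ge0.
- exact: measurable_fun_fubini_tonelli_F.
apply: eq_integral => w _ /=.
rewrite /fubini_F ge0_integral_distribution//.
by apply: measurableT_comp => //; exact: measurable_pair1.
Qed.

End independent_pair.

Section past_independence.
Context {R : realType} {dO dT} {O : measurableType dO} {T : measurableType dT}.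
Variables (P : probability O R) (I : choiceType) (X : I -> O -> T).
Hypothesis mX : forall i, measurable_fun setT (X i).
Hypothesis indX : mutually_independent P X.
Variables (past : set I) (i0 : I).
Hypothesis i0past : ~ past i0.

Definition events_of : set (set O) :=
  [set E | exists i (B : set T), [/\ past i, measurable B & E = X i @^-1` B]].

(** The pi-system generating the past. Requiring B i to be the whole space off J lets two cylinders
    be intersected index by index over the union of their index sets. *)
Let cyl : set (set O) := [set E | exists (J : {fset I}) (B : I -> set T),
  [/\ forall i, measurable (B i), forall i, i \in J -> past i,
      forall i, i \notin J -> B i = setT &
      E = \bigcap_(i in [set` J]) (X i @^-1` B i)]].

Let cyl_measurable : cyl `<=` measurable.
Proof.
move=> _ [J [B [mB _ _ ->]]]; apply: fin_bigcap_measurable.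
  exact: finite_fset.
by move=> i _; rewrite -[X in measurable X]setTI; exact: mX.
Qed.

Let cylI : setI_closed cyl.
Proof.
move=> _ _ [J1 [B1 [mB1 p1 T1 ->]]] [J2 [B2 [mB2 p2 T2 ->]]].
exists (J1 `|` J2)%fset, (fun i => B1 i `&` B2 i); split.
- by move=> i; exact: measurableI.
- by move=> i; rewrite inE => /orP[/p1|/p2].
- by move=> i; rewrite inE negb_or => /andP[/T1 -> /T2 ->]; rewrite setIT.
apply/seteqP; split=> w /=.
  move=> [h1 h2] i iJ; split.
    by have [/h1//|/T1 ->] := boolP (i \in J1).
  by have [/h2//|/T2 ->] := boolP (i \in J2).
by move=> h; split=> i /= iJ; have [] // := h i; rewrite /= inE iJ ?orbT.
Qed.

Let events_cyl : events_of `<=` cyl.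
Proof.
move=> _ [i [B [pi mB ->]]]; exists [fset i]%fset, (fun j => if j == i then B else setT).
split.
- by move=> j; case: ifP.
- by move=> j; rewrite inE => /eqP ->.
- by move=> j; rewrite inE => /negPf ->.
apply/seteqP; split=> w /=.
  by move=> Bw j; rewrite /= inE => /eqP ->; rewrite eqxx.
by move=> /(_ i); rewrite /= inE eqxx; apply.
Qed.

(** Dynkin's pi-lambda argument: the events factorizing with X i0 form a Dynkin system, and on
    cylinders the factorization is mutual independence for J enlarged by i0. *)
Lemma past_indep_event (E : set O) (C : set T) : <<s events_of >> E -> measurable C ->
  P (E `&` X i0 @^-1` C) = (P E * P (X i0 @^-1` C))%E.
Proof.
move=> sE mC; set XC := X i0 @^-1` C.
have mXC : measurable XC by rewrite -[X in measurable X]setTI; exact: mX.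
pose D := [set E : set O | measurable E /\ P (E `&` XC) = (P E * P XC)%E].
have dD : dynkin D.
  split.
  - by split=> //; rewrite setTI probability_setT mul1e.
  - move=> F [mF FE]; split; first exact: measurableC.
    rewrite setIC -setDE measureD//; last by rewrite ltey_eq fin_num_measure.
    rewrite [X in (_ - X)%E](_ : _ = P F * P XC)%E; last by rewrite setIC; exact: FE.
    rewrite probability_setC// muleBl ?mul1e//.
    by rewrite fin_num_measure.
  - move=> F tF FE; split; first by apply: bigcupT_measurable => k; case: (FE k).
    rewrite setI_bigcupl measure_bigcup//=; last 2 first.
    + by move=> k _; apply: measurableI => //; case: (FE k).
    + exact: trivIset_setIr.
    rewrite measure_bigcup//; last by move=> k _; case: (FE k).
    rewrite muleC -[P XC]fineK ?fin_num_measure// -nneseriesZl//.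
    by apply: eq_eseriesr => k _; case: (FE k) => _ ->; rewrite fineK ?fin_num_measure// muleC.
suff: D E by case.
have : <<s cyl >> E by move: E sE; exact: sub_smallest2r events_cyl.
rewrite -setI_closed_g_dynkin_g_sigma_algebra//.
move: E {sE}; apply: smallest_sub => //.
move=> _ [J [B [mB pJ TJ ->]]]; split; first by apply: cyl_measurable; exists J, B.
have i0J : i0 \notin J by apply/negP => /pJ.
pose B' i := if i == i0 then C else B i.
have B'E i : i \in J -> B' i = B i.
  by rewrite /B'; case: eqP => // ->; rewrite (negPf i0J).
have := @indX (i0 |` J)%fset B'.
have B'0 : B' i0 = C by rewrite /B' eqxx.
rewrite big_fsetU1//= B'0 -/XC.
rewrite (_ : \bigcap_(i in [set` (i0 |` J)%fset]) _ =
  (\bigcap_(i in [set` J]) X i @^-1` B i) `&` XC); last first.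
  apply/seteqP; split=> w /=.
    move=> h; split; last by have := h i0; rewrite /= !inE eqxx B'0; apply.
    by move=> i /= iJ; have := h i; rewrite /= !inE iJ orbT B'E//; apply.
  move=> [h1 h2] i /=; rewrite !inE => /orP[/eqP ->|iJ].
    by rewrite B'0.
  by rewrite B'E//; exact: h1.
move=> ->; last by move=> i; rewrite /B'; case: ifP.
rewrite muleC indX//; congr (_ * _)%E.
rewrite big_seq [RHS]big_seq; apply: eq_bigr => i iJ.
by rewrite B'E.
Qed.

Lemma measurable_past i : past i ->
  measurable_fun setT (X i : g_sigma_algebraType events_of -> T).
Proof.
by move=> pi _ B mB; rewrite setTI; apply: sub_sigma_algebra; exists i, B.
Qed.

(** Stated for any Y measurable with respect to the past, because it serves twice: for the other
    rows of one sketch and for the earlier sketches of the iteration. *)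
Lemma past_indep dU (U : measurableType dU) (Y : O -> U) :
  measurable_fun setT (Y : g_sigma_algebraType events_of -> U) ->
  measurable_fun setT Y /\ indep_pair P Y (X i0).
Proof.
move=> mY; have sY A : measurable A -> <<s events_of >> (Y @^-1` A).
  by move=> mA; have := mY measurableT A mA; rewrite setTI.
split; last by move=> A B mA mB; apply: past_indep_event => //; exact: sY.
move=> _ A mA; rewrite setTI.
move: (_ @^-1` A) (sY A mA); apply: smallest_sub.
  exact: sigma_algebra_measurable.
by move=> E /events_cyl/cyl_measurable.
Qed.

End past_independence.

(** * Moments of sub-gaussian variables *)

Section real_expectation.
Context {R : realType} {dO} {O : measurableType dO}.
Variable P : probability O R.
Implicit Types f g : O -> R.

Definition Ex f : R := \int[P]_w f w.
Definition integ f := P.-integrable setT (EFin \o f).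

Lemma eq_Ex f g : f =1 g -> Ex f = Ex g.
Proof. by move=> fg; congr Ex; apply/funext. Qed.

Lemma Ex_cst c : Ex (fun=> c) = c.
Proof.
rewrite /Ex Rintegral_cst// (_ : fine _ = 1) ?mulr1//.
by rewrite -[RHS]/(fine 1%:E); congr fine; exact: probability_setT.
Qed.

Lemma integ_dom f g : measurable_fun setT f -> integ g ->
  (forall w, `|f w| <= g w) -> integ f.
Proof.
move=> mf ig fg; apply: (le_integrable measurableT _ _ ig) => //.
  exact/measurable_EFinP.
move=> w _ /=; rewrite lee_fin; apply: le_trans (fg w) _; exact: ler_norm.
Qed.

Lemma integ_cst c : integ (fun=> c).
Proof.
apply: measurable_bounded_integrable => //.
  exact: le_lt_trans (probability_le1 P measurableT) (ltry _).
by exists `|c|; split; [exact: num_real|move=> x cx w _ /=; exact: ltW].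
Qed.

Lemma integ_bounded f c : measurable_fun setT f -> (forall w, `|f w| <= c) -> integ f.
Proof. by move=> mf fc; apply: (integ_dom mf (integ_cst c)). Qed.

Lemma integD f g : integ f -> integ g -> integ (fun w => f w + g w).
Proof. by move=> hf hg; exact: (integrableD measurableT hf hg). Qed.

Lemma integZ c f : integ f -> integ (fun w => c * f w).
Proof. by move=> hf; exact: (integrableZl measurableT c hf). Qed.

Lemma integN f : integ f -> integ (fun w => - f w).
Proof. by move=> hf; exact: (integrableN hf). Qed.

Lemma integB f g : integ f -> integ g -> integ (fun w => f w - g w).
Proof. by move=> hf hg; apply: integD => //; exact: integN. Qed.

Lemma ExD f g : integ f -> integ g -> Ex (fun w => f w + g w) = Ex f + Ex g.
Proof. by move=> hf hg; exact: RintegralD. Qed.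

Lemma ExB f g : integ f -> integ g -> Ex (fun w => f w - g w) = Ex f - Ex g.
Proof. by move=> hf hg; exact: RintegralB. Qed.

Lemma ExZ c f : integ f -> Ex (fun w => c * f w) = c * Ex f.
Proof. by move=> hf; exact: RintegralZl. Qed.

Lemma le_Ex f g : integ f -> integ g -> (forall w, f w <= g w) -> Ex f <= Ex g.
Proof. by move=> hf hg fg; apply: le_Rintegral. Qed.

Lemma Ex_ge0 f : (forall w, 0 <= f w) -> 0 <= Ex f.
Proof. by move=> f0; apply: Rintegral_ge0. Qed.

Lemma Ex_norm f : integ f -> `|Ex f| <= Ex (fun w => `|f w|).
Proof. by move=> hf; apply: le_normr_Rintegral. Qed.

Lemma integ_norm f : integ f -> integ (fun w => `|f w|).
Proof. by move=> hf; exact: (integrable_abse hf). Qed.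

Lemma integ_sum (I : Type) (r : seq I) (F : I -> O -> R) :
  (forall i, integ (F i)) -> integ (fun w => \sum_(i <- r) F i w).
Proof.
move=> iF; elim: r => [|i r IH].
  by under eq_fun do rewrite big_nil; exact: integ_cst.
by under eq_fun do rewrite big_cons; exact: integD.
Qed.

Lemma Ex_sum (I : Type) (r : seq I) (F : I -> O -> R) :
  (forall i, integ (F i)) ->
  Ex (fun w => \sum_(i <- r) F i w) = \sum_(i <- r) Ex (F i).
Proof.
move=> iF; elim: r => [|i r IH].
  by under eq_Ex do rewrite big_nil; rewrite Ex_cst big_nil.
under eq_Ex do rewrite big_cons.
by rewrite ExD// ?IH ?big_cons//; exact: integ_sum.
Qed.

Lemma EFin_Ex f : integ f -> (\int[P]_w (f w)%:E)%E = (Ex f)%:E.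
Proof. by move=> hf; rewrite fineK//; exact: integrable_fin_num. Qed.

Lemma integ_ge0_bound f c : measurable_fun setT f -> (forall w, 0 <= f w) ->
  (\int[P]_w (f w)%:E <= c%:E)%E -> integ f /\ Ex f <= c.
Proof.
move=> mf f0 fc; have hf : integ f.
  apply/integrableP; split; first exact/measurable_EFinP.
  apply: le_lt_trans (ltry c); apply: le_trans fc; rewrite le_eqVlt; apply/orP; left.
  by apply/eqP; apply: eq_integral => w _; rewrite /= ger0_norm.
by split=> //; rewrite -lee_fin -EFin_Ex.
Qed.

Lemma integ_mul_sqr f g : measurable_fun setT f -> measurable_fun setT g ->
  integ (fun w => f w ^+ 2) -> integ (fun w => g w ^+ 2) ->
  integ (fun w => f w * g w).
Proof.
move=> mf mg hf hg; apply: (integ_dom _ (integD hf hg)).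
  exact: measurable_mul_fun.
move=> w; rewrite ler_norml.
have := sqr_ge0 (f w + g w); have := sqr_ge0 (f w - g w); have := sqr_ge0 (f w).
have := sqr_ge0 (g w); lra.
Qed.

Lemma Ex_cauchy_schwarz f g : measurable_fun setT f -> measurable_fun setT g ->
  integ (fun w => f w ^+ 2) -> integ (fun w => g w ^+ 2) ->
  Ex (fun w => `|f w * g w|) ^+ 2 <= Ex (fun w => f w ^+ 2) * Ex (fun w => g w ^+ 2).
Proof.
move=> mf mg hf hg; have hfg := integ_norm (integ_mul_sqr mf mg hf hg).
set a := Ex (fun w => f w ^+ 2); set b := Ex (fun w => g w ^+ 2).
set c := Ex _; have q t : 0 <= t ^+ 2 * a - 2 * t * c + b.
  have i1 := integZ (t ^+ 2) hf; have i2 := integZ (2 * t) hfg.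
  rewrite -!ExZ// -ExB// -ExD//; last exact: integB.
  apply: Ex_ge0 => w; rewrite normrM -[f w ^+ 2]real_normK ?num_real//.
  rewrite -[g w ^+ 2]real_normK ?num_real//.
  have := sqr_ge0 (t * `|f w| - `|g w|); lra.
have a0 : 0 <= a by apply: Ex_ge0 => w; exact: sqr_ge0.
have c0 : 0 <= c by exact: Ex_ge0.
have b0 : 0 <= b by apply: Ex_ge0 => w; exact: sqr_ge0.
have [az|an] := eqVneq a 0.
  have [->|cn] := eqVneq c 0; first by rewrite expr0n mulr_ge0.
  (* For a = 0 the quadratic is affine in t, and this t gives it the value -1. *)
  have := q ((b + 1) / (2 * c)); rewrite az mulr0.
  have -> : 2 * ((b + 1) / (2 * c)) * c = b + 1 by field.
  lra.
have ap : 0 < a by rewrite lt_neqAle eq_sym an.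
have := q (c / a).
have -> : (c / a) ^+ 2 * a - 2 * (c / a) * c + b = (a * b - c ^+ 2) / a by field.
by rewrite pmulr_lge0 ?invr_gt0// subr_ge0.
Qed.

Lemma Ex_le_sqrt f : measurable_fun setT f -> integ (fun w => f w ^+ 2) ->
  integ f /\ Ex (fun w => `|f w|) <= Num.sqrt (Ex (fun w => f w ^+ 2)).
Proof.
move=> mf hf; have i1 : integ (fun=> (1 : R) ^+ 2) by exact: integ_cst.
have m1 : measurable_fun setT (fun _ : O => 1 : R) by exact: measurable_cst.
have := Ex_cauchy_schwarz mf m1 hf i1.
have := integ_mul_sqr mf m1 hf i1.
under eq_fun do rewrite mulr1.
under eq_Ex do rewrite mulr1; rewrite Ex_cst expr1n mulr1 => hi h; split => //.
by rewrite -[leLHS]ger0_norm ?Ex_ge0// -sqrtr_sqr ler_sqrt// Ex_ge0// => w; exact: sqr_ge0.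
Qed.

Lemma expectationE f : ('E_P[f])%E = (\int[P]_w (f w)%:E)%E.
Proof. by rewrite unlock. Qed.

Section subgaussian_moments.
Variables (K : R) (X : O -> R).
Hypothesis mX : measurable_fun setT X.
Hypothesis sX : subgaussian P K X.

(** Attainment of the infimum is not assumed, so moments are bounded at some admissible t below any
    c > K, and c is then lowered to K by contradiction. *)
Lemma subgaussian_lt c : K < c -> exists t : R, [/\ 0 < t, t < c &
  (\int[P]_w (expR (X w ^+ 2 / t ^+ 2))%:E <= 2%:E)%E].
Proof.
move=> Kc; have : (ereal_inf [set t%:E | t in
    [set t : R | (0 < t)%R /\
       ('E_P[fun w => expR (X w ^+ 2 / t ^+ 2)] <= 2%:E)%E]] < c%:E)%E.
  by apply: le_lt_trans sX _; rewrite lte_fin.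
move=> /ereal_inf_lt[_ /= [t [t0 ht] <-]]; rewrite lte_fin => tc.
by exists t; split=> //; rewrite -expectationE.
Qed.

Lemma subgaussian_ge0 : 0 <= K.
Proof.
rewrite leNgt; apply/negP => /subgaussian_lt[t [t0 /ltW]].
by rewrite leNgt t0.
Qed.

(** From exp u >= 1 + u^n / n! at u = X^2 / t^2: the summand 1 uses up half of the bound 2, leaving
    the constant n! alone. *)
Let moment_lt t n : 0 < t ->
  (\int[P]_w (expR (X w ^+ 2 / t ^+ 2))%:E <= 2%:E)%E ->
  integ (fun w => (X w ^+ 2) ^+ n.+1) /\
  Ex (fun w => (X w ^+ 2) ^+ n.+1) <= n.+1`!%:R * (t ^+ 2) ^+ n.+1.
Proof.
move=> t0 ht.
have fP w : (X w ^+ 2) ^+ n.+1 / (n.+1`!%:R * (t ^+ 2) ^+ n.+1) + 1 <= expR (X w ^+ 2 / t ^+ 2).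
  apply: le_trans (expR_ge1Dxn _ _); last by rewrite divr_ge0 ?sqr_ge0.
  by rewrite addrC lerD2l expr_div_n mulrAC invfM mulrA.
have mf : measurable_fun setT (fun w => expR (X w ^+ 2 / t ^+ 2)).
  apply: measurableT_comp => //.
  by apply: measurable_mul_fun => //; exact: measurable_funX.
have [hi hE] := integ_ge0_bound mf (fun w => expR_ge0 _) ht.
have c0 : 0 < n.+1`!%:R * (t ^+ 2) ^+ n.+1 by rewrite mulr_gt0 ?ltr0n ?fact_gt0 ?exprn_gt0.
have mg : measurable_fun setT (fun w => (X w ^+ 2) ^+ n.+1).
  by do 2 apply: measurable_funX.
have ig : integ (fun w => (X w ^+ 2) ^+ n.+1).
  apply: (integ_dom mg (integZ (n.+1`!%:R * (t ^+ 2) ^+ n.+1) hi)) => w.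
  rewrite ger0_norm ?(exprn_ge0 n.+1 (sqr_ge0 _))// -ler_pdivrMl// mulrC.
  by have := fP w; lra.
split=> //; rewrite -[leRHS]mulr1 -ler_pdivrMl// -ExZ//.
apply: le_trans (_ : Ex (fun w => expR (X w ^+ 2 / t ^+ 2) - 1) <= _).
  apply: le_Ex; [exact: integZ|by apply: integB => //; exact: integ_cst|].
  by move=> w /=; rewrite lerBrDr mulrC; exact: fP.
rewrite ExB//; last exact: integ_cst.
by rewrite Ex_cst; lra.
Qed.

Lemma subgaussian_moment2 : integ (fun w => X w ^+ 2) /\
  Ex (fun w => X w ^+ 2) <= K ^+ 2.
Proof.
have K0 := subgaussian_ge0.
have iX t : 0 < t -> (\int[P]_w (expR (X w ^+ 2 / t ^+ 2))%:E <= 2%:E)%E ->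
    integ (fun w => X w ^+ 2) /\ Ex (fun w => X w ^+ 2) <= t ^+ 2.
  move=> t0 /(moment_lt 0 t0).
  by rewrite (_ : 1`! = 1%N)// mul1r !expr1.
split.
  have [t [t0 _ /(iX _ t0)[]]] : exists t : R, [/\ 0 < t, t < K + 1 &
    (\int[P]_w (expR (X w ^+ 2 / t ^+ 2))%:E <= 2%:E)%E].
    by apply: subgaussian_lt; rewrite ltrDl.
  by [].
set a := Ex _; have a0 : 0 <= a by apply: Ex_ge0 => w; exact: sqr_ge0.
rewrite leNgt; apply/negP => Ka.
(* An admissible t below sqrt a would bound the second moment a by t^2 < a. *)
have /subgaussian_lt[t [t0 ta /(iX _ t0)[_]]] : K < Num.sqrt a.
  by rewrite -ltr_sqr ?nnegrE ?sqrtr_ge0// sqr_sqrtr.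
rewrite -/a -[leLHS]sqr_sqrtr// ler_sqr ?nnegrE ?sqrtr_ge0 ?(ltW t0)//.
by rewrite leNgt ta.
Qed.

Lemma subgaussian_moment4 : integ (fun w => X w ^+ 4) /\
  Ex (fun w => X w ^+ 4) <= 2 * K ^+ 4.
Proof.
have K0 := subgaussian_ge0.
have iX t : 0 < t -> (\int[P]_w (expR (X w ^+ 2 / t ^+ 2))%:E <= 2%:E)%E ->
    integ (fun w => X w ^+ 4) /\ Ex (fun w => X w ^+ 4) <= 2 * t ^+ 4.
  move=> t0 /(moment_lt 1 t0).
  rewrite (_ : (fun w => (X w ^+ 2) ^+ 2) = (fun w => X w ^+ 4)) -?exprM//.
  by apply/funext => w; rewrite -exprM.
split.
  have [t [t0 _ /(iX _ t0)[]]] : exists t : R, [/\ 0 < t, t < K + 1 &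
    (\int[P]_w (expR (X w ^+ 2 / t ^+ 2))%:E <= 2%:E)%E].
    by apply: subgaussian_lt; rewrite ltrDl.
  by [].
set a := Ex _; have a0 : 0 <= a.
  by apply: Ex_ge0 => w; rewrite -[4%N]/(2 * 2)%N exprM sqr_ge0.
rewrite leNgt; apply/negP => Ka.
(* The value at which the bound 2 b^4 equals the moment a itself. *)
pose b := Num.sqrt (Num.sqrt (a / 2)).
have b4 : 2 * b ^+ 4 = a.
  rewrite -[4%N]/(2 * 2)%N exprM sqr_sqrtr ?sqrtr_ge0// sqr_sqrtr ?divr_ge0//.
  by field.
have b0 : 0 <= b := sqrtr_ge0 _.
have /subgaussian_lt[t [t0 tb /(iX _ t0)[_]]] : K < b.
  by rewrite -(@ltr_pXn2r _ 4) ?nnegrE//; move: Ka; rewrite -b4; lra.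
rewrite -/a -b4 ler_pM2l// ler_pXn2r ?nnegrE ?(ltW t0)//.
by rewrite leNgt tb.
Qed.

End subgaussian_moments.

End real_expectation.

(** * One isotropic row: fourth moments and concentration of the denominator *)

Section isotropic_row.
Context {R : realType} {dO} {O : measurableType dO} {m : nat}.
Variables (P : probability O R) (s : O -> 'cV[R]_m) (K L : R).
Hypothesis ms : measurable_fun setT s.
Hypothesis iso : isotropic P s.
Hypothesis sub : vsubgaussian P K s.
Hypothesis conc : euclidean_concentration P L s.

Lemma measurable_form z : measurable_fun setT (fun w => dotp z (s w)).
Proof. by apply: measurable_dotp. Qed.

Lemma form_moment4 z : integ P (fun w => dotp z (s w) ^+ 4) /\
  Ex P (fun w => dotp z (s w) ^+ 4) <= 2 * K ^+ 4 * dotp z z ^+ 2.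
Proof.
have [->|z0] := eqVneq z 0.
  have e w : dotp 0 (s w) = 0 by rewrite -(scale0r (0 : 'cV[R]_m)) dotpZl mul0r.
  rewrite (_ : (fun w => dotp 0 (s w) ^+ 4) = fun=> 0); last first.
    by apply/funext => w; rewrite e expr0n.
  rewrite Ex_cst; split; first exact: integ_cst.
  by rewrite mulr_ge0 ?sqr_ge0// mulr_ge0// -[4%N]/(2 * 2)%N exprM sqr_ge0.
have ez := enorm_gt0 z0.
pose v := (enorm z)^-1 *: z.
have v1 : enorm v = 1.
  by rewrite enormZ ger0_norm ?invr_ge0 ?enorm_ge0// mulVf ?gt_eqF.
have [iv hv] := subgaussian_moment4 (measurable_form v) (sub v1).
have e w : dotp z (s w) ^+ 4 = enorm z ^+ 4 * dotp v (s w) ^+ 4.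
  by rewrite -exprMn /v dotpZl mulrA mulfV ?gt_eqF// mul1r.
rewrite (_ : (fun w => dotp z (s w) ^+ 4) = fun w => enorm z ^+ 4 * dotp v (s w) ^+ 4); last first.
  by apply/funext => w; rewrite e.
split; first exact: integZ.
rewrite ExZ// -enorm2 -exprM mulrC ler_wpM2r// exprn_ge0//; exact: ltW.
Qed.

Lemma form_integ2 z : integ P (fun w => dotp z (s w) ^+ 2).
Proof.
have mz := measurable_form z.
apply: (integ_dom _ (integD (integ_cst P 1) (form_moment4 z).1)).
  exact: measurable_funX.
move=> w; rewrite ger0_norm ?sqr_ge0// -[4%N]/(2 * 2)%N exprM.
have := sqr_ge0 (dotp z (s w) ^+ 2 - 1); have := sqr_ge0 (dotp z (s w)); lra.
Qed.

Lemma form_integM z z' : integ P (fun w => dotp z (s w) * dotp z' (s w)).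
Proof.
by apply: integ_mul_sqr; [exact: measurable_form|exact: measurable_form|
  exact: form_integ2|exact: form_integ2].
Qed.

Lemma Ex_form z z' : Ex P (fun w => dotp z (s w) * dotp z' (s w)) = dotp z z'.
Proof.
have iij i j : integ P (fun w => s w i 0 * s w j 0).
  by have := form_integM (delta_mx i 0) (delta_mx j 0); under eq_fun do rewrite !dotp_delta.
have Eij i j : Ex P (fun w => s w i 0 * s w j 0) = (i == j)%:R.
  have := iso i j; rewrite expectationE mxE /Ex /Rintegral => e.
  rewrite -[RHS]/(fine (i == j)%:R%:E) -e; congr fine.
  apply: eq_integral => w _; congr EFin.
  by rewrite mxE big_ord1 !mxE.
transitivity (Ex P (fun w => \sum_i z i 0 * \sum_j z' j 0 * (s w i 0 * s w j 0))).
  apply: eq_Ex => w; rewrite !dotpE mulr_suml; apply: eq_bigr => i _.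
  rewrite -mulrA; congr (_ * _); rewrite mulr_sumr; apply: eq_bigr => j _; ring.
rewrite Ex_sum => [|i]; last by apply: integZ; apply: integ_sum => j; exact: integZ.
rewrite dotpE; apply: eq_bigr => i _.
rewrite ExZ; last by apply: integ_sum => j; exact: integZ.
congr (_ * _); rewrite Ex_sum => [|j]; last exact: integZ.
under eq_bigr => j _ do rewrite ExZ// Eij.
rewrite (bigD1 i)//= eqxx mulr1 big1 ?addr0// => j ji.
by rewrite eq_sym (negPf ji) mulr0.
Qed.

Lemma form_integ4 z z' : integ P (fun w => (dotp z (s w) * dotp z' (s w)) ^+ 2).
Proof.
have mz := measurable_form z; have mz' := measurable_form z'.
under eq_fun do rewrite exprMn.
apply: integ_mul_sqr; [exact: measurable_funX|exact: measurable_funX|..].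
  by under eq_fun do rewrite -exprM; exact: (form_moment4 z).1.
by under eq_fun do rewrite -exprM; exact: (form_moment4 z').1.
Qed.

Lemma Ex_form4 z z' : Ex P (fun w => (dotp z (s w) * dotp z' (s w)) ^+ 2) <=
  2 * K ^+ 4 * (dotp z z * dotp z' z').
Proof.
have mz := measurable_form z; have mz' := measurable_form z'.
have sq z0 : (fun w => (dotp z0 (s w) ^+ 2) ^+ 2) = (fun w => dotp z0 (s w) ^+ 4).
  by apply/funext => w; rewrite -exprM.
have := @Ex_cauchy_schwarz _ _ _ P (fun w => dotp z (s w) ^+ 2) (fun w => dotp z' (s w) ^+ 2)
  (measurable_funX 2 mz) (measurable_funX 2 mz').
rewrite !sq => /(_ (form_moment4 z).1 (form_moment4 z').1).
under eq_Ex do rewrite -exprMn ger0_norm ?sqr_ge0//.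
set e := Ex P _ => h.
have K4 : 0 <= K ^+ 4 by rewrite -[4%N]/(2 * 2)%N exprM sqr_ge0.
have b0 : 0 <= 2 * K ^+ 4 * (dotp z z * dotp z' z').
  by apply: mulr_ge0; [exact: mulr_ge0|apply: mulr_ge0; exact: dotpxx_ge0].
rewrite -ler_sqr ?nnegrE//; last by apply: Ex_ge0 => w; exact: sqr_ge0.
apply: le_trans h _.
have -> : (2 * K ^+ 4 * (dotp z z * dotp z' z')) ^+ 2 =
  (2 * K ^+ 4 * dotp z z ^+ 2) * (2 * K ^+ 4 * dotp z' z' ^+ 2) by ring.
apply: ler_pM.
- by apply: Ex_ge0 => w; rewrite -[4%N]/(2 * 2)%N exprM sqr_ge0.
- by apply: Ex_ge0 => w; rewrite -[4%N]/(2 * 2)%N exprM sqr_ge0.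
- exact: (form_moment4 z).2.
- exact: (form_moment4 z').2.
Qed.

Section one_step.
Context {n : nat} (A : 'M[R]_(m, n)) (lam : R) (B : 'M[R]_n).
Hypotheses (lam0 : 0 < lam) (gB : gram B).
Local Notation G := (ridge lam B).
Local Notation x := (fun w => A^T *m s w).
Local Notation xi := (fun w => dotp (A^T *m s w) (G *m (A^T *m s w))).
Local Notation tau := (wtr A G).
Local Notation S := (specnorm A ^+ 2).
Hypothesis tau0 : 0 < tau.

(** The exact relative error of replacing xi by tau: 1 / (lam + xi) = (1 - W) / (lam + tau). *)
Let W w := (xi w - tau) / (lam + xi w).

Lemma measurable_xi : measurable_fun setT xi.
Proof. by apply: measurable_dotp; do ?apply: measurable_mulmx. Qed.

Lemma xi_ge0 w : 0 <= xi w.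
Proof. exact: ridge_form_ge0. Qed.

Lemma measurable_W : measurable_fun setT W.
Proof.
have mx := measurable_xi.
apply: measurable_mul_fun; first exact: measurable_add_fun.
by apply: measurable_inv_fun; exact: measurable_add_fun.
Qed.

(* With [r0 = sqrt tau] and [r = sqrt xi]: if [r >= r0/2] the first term
   dominates, otherwise [D >= r0/2] and the second one does. *)
Lemma ratio_bound (D r0 : R) : 0 < r0 -> 0 <= r0 + D ->
  (((r0 + D) ^+ 2 - r0 ^+ 2) / (lam + (r0 + D) ^+ 2)) ^+ 2 <=
  36 * D ^+ 2 / r0 ^+ 2 + 16 * D ^+ 4 / lam ^+ 2.
Proof.
move=> r00 r0D; set r := r0 + D.
have l2 : 0 < lam ^+ 2 by rewrite exprn_gt0.
have r02 : 0 < r0 ^+ 2 by rewrite exprn_gt0.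
have den : 0 < lam + r ^+ 2 by rewrite ltr_wpDr ?sqr_ge0.
have D4 : 0 <= D ^+ 4 by rewrite -[4%N]/(2 * 2)%N exprM sqr_ge0.
have p1 : 0 <= 36 * D ^+ 2 / r0 ^+ 2.
  by apply: mulr_ge0; [apply: mulr_ge0; rewrite ?sqr_ge0|rewrite invr_ge0 ltW].
have p2 : 0 <= 16 * D ^+ 4 / lam ^+ 2.
  by apply: mulr_ge0; [apply: mulr_ge0|rewrite invr_ge0 ltW].
rewrite expr_div_n ler_pdivrMr ?exprn_gt0//.
have [hr|hr] := lerP (r0 / 2) r.
  apply: (@le_trans _ _ (36 * D ^+ 2 / r0 ^+ 2 * (lam + r ^+ 2) ^+ 2)); last first.
    by rewrite ler_wpM2r ?sqr_ge0// lerDl.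
  have h1 : (r ^+ 2 - r0 ^+ 2) ^+ 2 <= 9 * D ^+ 2 * r ^+ 2.
    have -> : r ^+ 2 - r0 ^+ 2 = D * (r + r0) by rewrite /r; ring.
    have -> : 9 * D ^+ 2 * r ^+ 2 = D ^+ 2 * (3 * r) ^+ 2 by ring.
    by rewrite exprMn ler_wpM2l ?sqr_ge0// ler_sqr ?nnegrE; lra.
  apply: le_trans h1 _; rewrite [leRHS]mulrAC ler_pdivlMr//.
  have -> : 36 * D ^+ 2 * (lam + r ^+ 2) ^+ 2 = 9 * D ^+ 2 * (4 * (lam + r ^+ 2) ^+ 2) by ring.
  have -> : 9 * D ^+ 2 * r ^+ 2 * r0 ^+ 2 = 9 * D ^+ 2 * (r ^+ 2 * r0 ^+ 2) by ring.
  apply: ler_wpM2l; first by apply: mulr_ge0; rewrite ?sqr_ge0.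
  have h2 : r0 ^+ 2 <= 4 * r ^+ 2.
    have -> : 4 * r ^+ 2 = (2 * r) ^+ 2 by ring.
    by rewrite ler_sqr ?nnegrE; lra.
  apply: (@le_trans _ _ (r ^+ 2 * (4 * r ^+ 2))); first by rewrite ler_wpM2l ?sqr_ge0.
  have -> : r ^+ 2 * (4 * r ^+ 2) = 4 * (r ^+ 2) ^+ 2 by ring.
  by rewrite ler_pM2l// ler_sqr ?nnegrE ?addr_ge0 ?sqr_ge0 ?(ltW lam0)// lerDr (ltW lam0).
apply: (@le_trans _ _ (16 * D ^+ 4 / lam ^+ 2 * (lam + r ^+ 2) ^+ 2)); last first.
  by rewrite ler_wpM2r ?sqr_ge0// lerDr.
have hD : (r0 / 2) ^+ 4 <= D ^+ 4.
  have -> : D ^+ 4 = (- D) ^+ 4 by ring.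
  by apply: lerXn2r; rewrite ?nnegrE; move: hr; rewrite /r; lra.
have h1 : (r ^+ 2 - r0 ^+ 2) ^+ 2 <= r0 ^+ 4.
  have -> : r0 ^+ 4 = (r0 ^+ 2) ^+ 2 by ring.
  rewrite -sqrrN opprB ler_sqr ?nnegrE ?sqr_ge0//; first by have := sqr_ge0 r; lra.
  rewrite subr_ge0 ler_sqr ?nnegrE//; [lra|exact: ltW].
apply: le_trans h1 _; rewrite [leRHS]mulrAC ler_pdivlMr//.
apply: ler_pM; rewrite ?sqr_ge0//.
- by rewrite -[4%N]/(2 * 2)%N exprM sqr_ge0.
- move: hD; rewrite expr_div_n; lra.
- rewrite ler_sqr ?nnegrE ?(ltW den) ?(ltW lam0)//.
  by rewrite lerDl sqr_ge0.
Qed.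

(** Factor G = N^T N and put M = N A^T: then xi = |M s|^2 and tau = |M|_F^2, so Euclidean
    concentration applies to M, whose norm is at most |A| because G <= 1. The second and fourth
    moments of the deviation feed the two terms of [ratio_bound]. *)
Lemma W_moment2 : integ P (fun w => W w ^+ 2) /\ Ex P (fun w => W w ^+ 2) <=
  36 * (L ^+ 2 * S) / tau + 32 * (L ^+ 4 * S ^+ 2) / lam ^+ 2.
Proof.
have [q [N GN]] := gram_ridge lam0 gB.
pose M := N *m A^T.
have xiE w : xi w = enorm (M *m s w) ^+ 2.
  by rewrite enorm2 GN -mulmxA dotp_trmx trmxK !mulmxA.
have tauE : tau = fnorm M ^+ 2.
  by rewrite fnorm2 /wtr GN trmx_mul trmxK !mulmxA.
have fM : 0 < fnorm M.
  by rewrite lt_neqAle fnorm_ge0 andbT; apply/eqP => e; move: tau0; rewrite tauE -e expr0n ltxx.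
pose D w := enorm (M *m s w) - fnorm M.
have mD : measurable_fun setT D.
  apply: measurable_add_fun => //.
  have -> : (fun w => enorm (M *m s w)) = (fun w => Num.sqrt (xi w)).
    by apply/funext => w; rewrite xiE sqrtr_sqr ger0_norm ?enorm_ge0.
  exact: measurable_sqrt_fun measurable_xi.
have sD := conc M.
have [i2 h2] := subgaussian_moment2 mD sD.
have [i4 h4] := subgaussian_moment4 mD sD.
have sM : specnorm M <= specnorm A.
  apply: specnorm_le => [|u]; first exact: specnorm_ge0.
  apply: le_trans (specnorm_tr_bound A u).
  apply: le_trans (ridge_form_le lam0 gB (A^T *m u)).
  by rewrite GN -[N^T *m N *m _]mulmxA [leRHS]dotp_trmx trmxK /M !mulmxA.
have sM2 : specnorm M ^+ 2 <= S by rewrite ler_sqr ?nnegrE ?specnorm_ge0.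
have sM4 : specnorm M ^+ 4 <= S ^+ 2.
  by rewrite -exprM; apply: lerXn2r; rewrite ?nnegrE ?specnorm_ge0.
have WD w : W w ^+ 2 <= (36 / tau) * D w ^+ 2 + (16 / lam ^+ 2) * D w ^+ 4.
  have := @ratio_bound (D w) _ fM; rewrite /D [fnorm M + _]addrC subrK.
  rewrite /W xiE tauE => /(_ (enorm_ge0 _)) /le_trans; apply.
  by rewrite mulrAC [X in _ + X]mulrAC.
have iR := integD (integZ (36 / tau) i2) (integZ (16 / lam ^+ 2) i4).
have iW : integ P (fun w => W w ^+ 2).
  apply: integ_dom iR _; first by apply: measurable_funX; exact: measurable_W.
  by move=> w; rewrite ger0_norm ?sqr_ge0// WD.
split=> //; apply: le_trans (le_Ex iW iR WD) _.
rewrite ExD ?ExZ//; [|exact: integZ|exact: integZ].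
apply: lerD.
  rewrite mulrAC ler_wpM2r ?invr_ge0 ?(ltW tau0)// ler_wpM2l//.
  by apply: le_trans h2 _; rewrite exprMn ler_wpM2l ?sqr_ge0.
rewrite mulrAC ler_wpM2r ?invr_ge0 ?sqr_ge0//.
have -> : 32 * (L ^+ 4 * S ^+ 2) = 16 * (2 * (L ^+ 4 * S ^+ 2)) by ring.
rewrite ler_wpM2l//; apply: le_trans h4 _; rewrite ler_wpM2l// exprMn ler_wpM2l//.
by rewrite -[4%N]/(2 * 2)%N exprM sqr_ge0.
Qed.

Lemma integ_ratio z z' :
  integ P (fun w => dotp z (s w) * dotp z' (s w) / (lam + xi w)).
Proof.
have i1 := integZ lam^-1 (integ_norm (form_integM z z')).
apply: (integ_dom _ i1) => [|w].
  apply: measurable_mul_fun; first by apply: measurable_mul_fun; exact: measurable_form.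
  by apply: measurable_inv_fun; apply: measurable_add_fun => //; exact: measurable_xi.
rewrite normrM mulrC ler_wpM2r//.
by rewrite normfV gtr0_norm ?ridge_den_gt0// lef_pV2 ?posrE ?ridge_den_gt0// lerDl xi_ge0.
Qed.

(** By isotropy the difference is the mean of - <z,s> <z',s> W / (lam + tau); Cauchy-Schwarz with
    the fourth moments of the forms yields the factor sqrt 2 K^2. *)
Lemma Ex_ratio V z z' : Ex P (fun w => W w ^+ 2) <= V ->
  `|Ex P (fun w => dotp z (s w) * dotp z' (s w) / (lam + xi w)) - dotp z z' / (lam + tau)| <=
  Num.sqrt (2 * V) * K ^+ 2 * (enorm z * enorm z') / (lam + tau).
Proof.
move=> hV; pose f w := dotp z (s w) * dotp z' (s w).
have lt0 : 0 < lam + tau by rewrite addr_gt0.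
have mf : measurable_fun setT f by apply: measurable_mul_fun; exact: measurable_form.
have [iW _] := W_moment2.
have cs := Ex_cauchy_schwarz mf measurable_W (form_integ4 z z') iW.
have ifW := integ_mul_sqr mf measurable_W (form_integ4 z z') iW.
have -> : Ex P (fun w => dotp z (s w) * dotp z' (s w) / (lam + xi w)) - dotp z z' / (lam + tau) =
    Ex P (fun w => - (lam + tau)^-1 * (f w * W w)).
  rewrite -Ex_form [X in _ - X]mulrC -ExZ; last exact: form_integM.
  rewrite -ExB; [|exact: integ_ratio|exact/integZ/form_integM].
  apply: eq_Ex => w; rewrite /f /W.
  have d : lam + xi w != 0 by rewrite gt_eqF ?ridge_den_gt0.
  have d' : lam + tau != 0 by rewrite gt_eqF.
  by move: d d'; set y := dotp (_ *m _) _; set t := wtr _ _ => d d'; field; rewrite d d'.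
rewrite ExZ// normrM normrN normfV (gtr0_norm lt0) mulrC ler_wpM2r ?invr_ge0 ?(ltW lt0)//.
apply: le_trans (Ex_norm ifW) _.
have V0 : 0 <= V by apply: le_trans hV; apply: Ex_ge0 => w; exact: sqr_ge0.
rewrite -ler_sqr ?nnegrE; last 2 first.
- by apply: Ex_ge0 => w.
- by apply: mulr_ge0; rewrite mulr_ge0 ?sqrtr_ge0 ?sqr_ge0 ?enorm_ge0.
apply: le_trans cs _.
have -> : (Num.sqrt (2 * V) * K ^+ 2 * (enorm z * enorm z')) ^+ 2 =
  Num.sqrt (2 * V) ^+ 2 * K ^+ 4 * (enorm z ^+ 2 * enorm z' ^+ 2) by ring.
rewrite sqr_sqrtr ?mulr_ge0// !enorm2.
have -> : 2 * V * K ^+ 4 * (dotp z z * dotp z' z') =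
  2 * K ^+ 4 * (dotp z z * dotp z' z') * V by ring.
by apply: ler_pM => //; [apply: Ex_ge0 => w; exact: sqr_ge0|
  apply: Ex_ge0 => w; exact: sqr_ge0|exact: Ex_form4].
Qed.

Lemma Ex_shrink V : Ex P (fun w => W w ^+ 2) <= V ->
  Ex P (fun w => lam / (lam + xi w)) <= lam / (lam + tau) * (1 + Num.sqrt V).
Proof.
move=> hV; have lt0 : 0 < lam + tau by rewrite addr_gt0.
have [iW _] := W_moment2; have [iW1 hW1] := Ex_le_sqrt measurable_W iW.
have iR := integZ (lam / (lam + tau)) (integD (integ_cst P 1) (integ_norm iW1)).
have lW w : lam / (lam + xi w) <= lam / (lam + tau) * (1 + `|W w|).
  have -> : lam / (lam + xi w) = lam / (lam + tau) * (1 - W w).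
    have d : lam + xi w != 0 by rewrite gt_eqF ?ridge_den_gt0.
    have d' : lam + tau != 0 by rewrite gt_eqF.
    rewrite /W; move: d d'; set y := dotp (_ *m _) _; set t := wtr _ _ => d d'.
    by field; rewrite d d'.
  rewrite ler_wpM2l ?divr_ge0 ?(ltW lam0) ?(ltW lt0)// lerD2l.
  by apply: le_trans (ler_norm _) _; rewrite normrN.
have iL : integ P (fun w => lam / (lam + xi w)).
  apply: (integ_dom _ iR) => [|w].
    apply: measurable_mul_fun => //; apply: measurable_inv_fun.
    by apply: measurable_add_fun => //; exact: measurable_xi.
  by rewrite ger0_norm// divr_ge0 ?(ltW lam0)// ltW// ridge_den_gt0.
apply: le_trans (le_Ex iL iR lW) _.
rewrite ExZ; last by apply: integD; [exact: integ_cst|exact: integ_norm].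
rewrite ExD; [|exact: integ_cst|exact: integ_norm].
rewrite Ex_cst ler_wpM2l ?divr_ge0 ?(ltW lam0) ?(ltW lt0)// lerD2l.
by apply: le_trans hW1 _; rewrite ler_wsqrtr.
Qed.

End one_step.

End isotropic_row.

Lemma measurable_Ex {R : realType} {dU dO} {U : measurableType dU}
    {O : measurableType dO} (P : probability O R) (h : U * O -> R) :
  measurable_fun setT h -> measurable_fun setT (fun u => Ex P (fun w => h (u, w))).
Proof.
move=> mh; rewrite /Ex /Rintegral.
apply: measurableT_comp; first exact: fine_measurable.
have mE : measurable_fun setT (EFin \o h) by exact/measurable_EFinP.
rewrite (_ : (fun u => _) = (fun u => (\int[P]_w (EFin \o h)^\+ (u, w)) -
    (\int[P]_w (EFin \o h)^\- (u, w)))%E); last first.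
  apply/funext => u; rewrite integralE.
  by congr (_ - _)%E; apply: eq_integral => w _; rewrite ?funeposE ?funenegE.
apply: emeasurable_funB.
  apply: (measurable_fun_fubini_tonelli_F ((EFin \o h)^\+)%E) => //.
  exact: measurable_funepos.
apply: (measurable_fun_fubini_tonelli_F ((EFin \o h)^\-)%E) => //.
exact: measurable_funeneg.
Qed.

(** * Integrating out an independent variable through a copy of it *)

Section same_law_expectation.
Context {R : realType} {d1 d2 dT} {O1 : measurableType d1} {O2 : measurableType d2}
  {T : measurableType dT}.
Variables (P1 : probability O1 R) (P2 : probability O2 R).
Variables (X : O1 -> T) (X' : O2 -> T).
Hypotheses (mX : measurable_fun setT X) (mX' : measurable_fun setT X').
Hypothesis lawX : same_law P1 P2 X X'.

Lemma ge0_integral_law (h : T -> \bar R) : measurable_fun setT h ->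
  (forall z, (0 <= h z)%E) -> (\int[P1]_w h (X w) = \int[P2]_w h (X' w))%E.
Proof.
move=> mh h0.
pose X1 : {RV P1 >-> T} := HB.pack X (isMeasurableFun.Build _ _ _ _ _ mX).
pose X2 : {RV P2 >-> T} := HB.pack X' (isMeasurableFun.Build _ _ _ _ _ mX').
transitivity (\int[distribution P1 X1]_z h z)%E.
  by rewrite ge0_integral_distribution.
transitivity (\int[distribution P2 X2]_z h z)%E.
  by apply: eq_measure_integral => A mA _; exact: lawX.
by rewrite ge0_integral_distribution.
Qed.

Lemma integ_law (g : T -> R) : measurable_fun setT g -> (forall z, 0 <= g z) ->
  integ P2 (fun w => g (X' w)) ->
  integ P1 (fun w => g (X w)) /\
  Ex P1 (fun w => g (X w)) = Ex P2 (fun w => g (X' w)).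
Proof.
move=> mg g0 ig.
have e : (\int[P1]_w (g (X w))%:E = \int[P2]_w (g (X' w))%:E)%E.
  by apply: (ge0_integral_law (h := EFin \o g)) => //; exact/measurable_EFinP.
split; last by rewrite /Ex /Rintegral e.
apply: (integ_ge0_bound (c := Ex P2 (fun w => g (X' w))) _ _ _).1 => //.
  exact: measurableT_comp.
by rewrite e EFin_Ex.
Qed.

Context {dU} {U : measurableType dU}.
Variable Y : O1 -> U.
Hypothesis mY : measurable_fun setT Y.
Hypothesis indYX : indep_pair P1 Y X.

(** The dominating g depends on the fresh variable only, so adding it makes the integrand
    nonnegative and reduces the signed case to Tonelli. *)
Lemma Ex_indep (h : U * T -> R) (g : T -> R) :
  measurable_fun setT h -> measurable_fun setT g ->
  integ P2 (fun w => g (X' w)) -> (forall w x, `|h (Y w, x)| <= g x) ->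
  integ P1 (fun w => h (Y w, X w)) /\
  Ex P1 (fun w => h (Y w, X w)) = Ex P1 (fun w => Ex P2 (fun w' => h (Y w, X' w'))).
Proof.
move=> mh mg ig hg.
have O1ne : forall x, 0 <= g x.
  by move=> x; apply: le_trans (hg point x).
have [ig1 eg] := integ_law mg O1ne ig.
have mYX : measurable_fun setT (fun w => (Y w, X w)) by exact: measurable_fun_pair.
have mhYX : measurable_fun setT (fun w => h (Y w, X w)).
  by apply: (measurableT_comp mh mYX).
have ih : integ P1 (fun w => h (Y w, X w)) by apply: (integ_dom _ ig1).
split=> //.
have mhX' u : measurable_fun setT (fun w' => h (u, X' w')).
  apply: (measurableT_comp (f := fun x => h (u, x))) => //.
  by apply: (measurableT_comp mh); exact: measurable_pair1.
have ih' w : integ P2 (fun w' => h (Y w, X' w')) by apply: (integ_dom _ ig).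
have mI : measurable_fun setT (fun w => Ex P2 (fun w' => h (Y w, X' w'))).
  pose k (z : O1 * O2) := h (Y z.1, X' z.2).
  apply: (@measurable_Ex _ _ _ _ _ P2 k).
  apply: (measurableT_comp mh); apply/measurable_fun_pairP; split.
    exact: measurableT_comp mY (@measurable_fst _ _ _ _).
  exact: measurableT_comp mX' (@measurable_snd _ _ _ _).
have iI : integ P1 (fun w => Ex P2 (fun w' => h (Y w, X' w'))).
  apply: (@integ_bounded _ _ _ P1 _ (Ex P2 (fun w => g (X' w)))) => // w.
  apply: le_trans (Ex_norm (ih' w)) _.
  by apply: le_Ex => //; exact: integ_norm.
(* Domination by g is known only for first components in the range of Y; the maximum with 0 gives
   nonnegativity on the whole product and changes nothing on that range. *)
pose h1 (z : U * T) := Num.max 0 (g z.2 + h z).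
have mh1 : measurable_fun setT h1.
  apply: measurable_maxr => //; apply: measurable_add_fun => //.
  exact: measurableT_comp mg (@measurable_snd _ _ _ _).
have h10 z : 0 <= h1 z by rewrite le_max lexx.
have h1E w x : h1 (Y w, x) = g x + h (Y w, x).
  by apply/max_r; have := hg w x; rewrite ler_norml => /andP[h2 _] /=; lra.
have tonelli : (\int[P1]_w (h1 (Y w, X w))%:E =
    \int[P1]_w \int[P2]_w' (h1 (Y w, X' w'))%:E)%E.
  apply: (ge0_integral_indep mY mX mX' lawX indYX (h := EFin \o h1)).
    exact/measurable_EFinP.
  by move=> z; rewrite lee_fin.
have lhs : (\int[P1]_w (h1 (Y w, X w))%:E)%E =
    (Ex P1 (fun w => g (X w)) + Ex P1 (fun w => h (Y w, X w)))%:E.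
  rewrite -ExD// -EFin_Ex; last exact: integD.
  by apply: eq_integral => w _; rewrite h1E.
have rhs : (\int[P1]_w \int[P2]_w' (h1 (Y w, X' w'))%:E)%E =
    (Ex P2 (fun w => g (X' w)) + Ex P1 (fun w => Ex P2 (fun w' => h (Y w, X' w'))))%:E.
  have ic := integ_cst P1 (Ex P2 (fun w => g (X' w))).
  rewrite -[X in (X + _)%:E](Ex_cst P1) -ExD// -EFin_Ex; last exact: integD.
  apply: eq_integral => w _; rewrite -ExD// -EFin_Ex; last exact: integD.
  by apply: eq_integral => w' _; rewrite h1E.
by move: tonelli; rewrite lhs rhs eg => -[] /addrI.
Qed.

End same_law_expectation.

(** Counts the rank-one updates since 0. The count bounds how far the weighted trace has dropped,
    which [gram] alone does not record. *)
Inductive reach {R : realType} {n : nat} : nat -> 'M[R]_n -> Prop :=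
| reach0 : reach 0 0
| reachS j (B : 'M[R]_n) (x : 'cV[R]_n) : reach j B -> reach j.+1 (B + x *m x^T).

Lemma reach_gram {R : realType} {n j : nat} (B : 'M[R]_n) : reach j B -> gram B.
Proof. by elim=> [|i C x _]; [exact: gram0|exact: gram_add_rank1]. Qed.

(** * The Markov chain of Gram matrices that gains one row per step *)

Section transfer_operator.
Context {R : realType} {dO} {O : measurableType dO} {n : nat}.
Variables (P : probability O R) (x : O -> 'cV[R]_n).
Hypothesis mx : measurable_fun setT x.
Implicit Types (f g : 'M[R]_n -> R) (B : 'M[R]_n).

(** The Markov operator of the chain B -> B + x x^T. Its j-th iterate is the mean of f after j
    independent rows, obtained without a sequence of rows on a common space. *)
Definition transfer f B : R := Ex P (fun w => f (B + x w *m (x w)^T)).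

Definition iterT j f := iter j transfer f.

(** Bounds are asked only on Gram matrices, where [ridge] is controlled; measurability is asked
    everywhere. *)
Definition gram_bounded f := measurable_fun setT f /\
  exists c, forall B, gram B -> `|f B| <= c.

Lemma measurable_update f B : measurable_fun setT f ->
  measurable_fun setT (fun w => f (B + x w *m (x w)^T)).
Proof.
move=> mf; apply: (measurableT_comp mf); apply: measurable_mxD => //.
by apply: measurable_mulmx => //; exact: measurable_trmx.
Qed.

Lemma transfer_integ f B : gram_bounded f -> gram B ->
  integ P (fun w => f (B + x w *m (x w)^T)).
Proof.
move=> [mf [c fc]] gB; apply: (@integ_bounded _ _ _ P _ c).
  exact: measurable_update.
by move=> w; apply: fc; exact: gram_add_rank1.
Qed.

Lemma gram_bounded_transfer f : gram_bounded f -> gram_bounded (transfer f).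
Proof.
move=> hf; have [mf [c fc]] := hf; split.
  pose h (z : 'M[R]_n * O) := f (z.1 + x z.2 *m (x z.2)^T).
  apply: (@measurable_Ex _ _ _ _ _ P h); apply: (measurableT_comp mf).
  have mx2 : measurable_fun setT (fun z : 'M[R]_n * O => x z.2).
    exact: measurableT_comp mx (@measurable_snd _ _ _ _).
  apply: measurable_mxD; first exact: measurable_fst.
  by apply: measurable_mulmx => //; exact: measurable_trmx.
exists c => B gB; apply: le_trans (Ex_norm (transfer_integ hf gB)) _.
rewrite -[leRHS](Ex_cst P); apply: le_Ex.
- exact/integ_norm/transfer_integ.
- exact: integ_cst.
- by move=> w; apply: fc; exact: gram_add_rank1.
Qed.

Lemma gram_bounded_iterT j f : gram_bounded f -> gram_bounded (iterT j f).
Proof. by move=> hf; elim: j => //= j; exact: gram_bounded_transfer. Qed.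

Lemma gram_bounded_cst c : gram_bounded (fun=> c).
Proof. by split=> //; exists `|c|. Qed.

Lemma gram_boundedD f g : gram_bounded f -> gram_bounded g ->
  gram_bounded (fun B => f B + g B).
Proof.
move=> [mf [c fc]] [mg [c' gc]]; split; first exact: measurable_add_fun.
exists (c + c') => B gB; apply: le_trans (ler_normD _ _) _.
by rewrite lerD ?fc ?gc.
Qed.

Lemma gram_boundedM f g : gram_bounded f -> gram_bounded g ->
  gram_bounded (fun B => f B * g B).
Proof.
move=> [mf [c fc]] [mg [c' gc]]; split; first exact: measurable_mul_fun.
by exists (c * c') => B gB; rewrite normrM ler_pM ?fc ?gc.
Qed.

Lemma gram_boundedN f : gram_bounded f -> gram_bounded (fun B => - f B).
Proof.
move=> [mf [c fc]]; split; first exact: measurable_opp_fun.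
by exists c => B gB; rewrite normrN fc.
Qed.

Lemma iterTS j f B :
  iterT j.+1 f B = Ex P (fun w => iterT j f (B + x w *m (x w)^T)).
Proof. by []. Qed.

Lemma iterTSr j f : iterT j.+1 f = iterT j (transfer f).
Proof. by rewrite /iterT iterSr. Qed.

Lemma iterT_cst j c B : iterT j (fun=> c) B = c.
Proof.
by elim: j B => // j IH B; rewrite iterTS; under eq_Ex do rewrite IH; rewrite Ex_cst.
Qed.

Lemma le_iterT i j f g B : gram_bounded f -> gram_bounded g ->
  (forall C, reach (i + j) C -> f C <= g C) -> reach i B ->
  iterT j f B <= iterT j g B.
Proof.
move=> hf hg fg; elim: j i B fg => [|j IH] i B fg rB.
  by apply: fg; rewrite addn0.
have gB := reach_gram rB.
rewrite !iterTS; apply: le_Ex.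
- exact: transfer_integ (gram_bounded_iterT j hf) gB.
- exact: transfer_integ (gram_bounded_iterT j hg) gB.
- by move=> w; apply: (IH i.+1); [rewrite addSnnS|exact: reachS].
Qed.

Lemma iterTD j f g B : gram_bounded f -> gram_bounded g -> gram B ->
  iterT j (fun C => f C + g C) B = iterT j f B + iterT j g B.
Proof.
move=> hf hg; elim: j B => // j IH B gB; rewrite !iterTS -ExD.
- by apply: eq_Ex => w; rewrite IH//; exact: gram_add_rank1.
- exact: transfer_integ (gram_bounded_iterT j hf) gB.
- exact: transfer_integ (gram_bounded_iterT j hg) gB.
Qed.

Lemma iterTZ j c f B : gram_bounded f -> gram B ->
  iterT j (fun C => c * f C) B = c * iterT j f B.
Proof.
move=> hf; elim: j B => // j IH B gB; rewrite !iterTS -ExZ.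
- by apply: eq_Ex => w; rewrite IH//; exact: gram_add_rank1.
- exact: transfer_integ (gram_bounded_iterT j hf) gB.
Qed.

Lemma iterTN j f B : gram_bounded f -> gram B ->
  iterT j (fun C => - f C) B = - iterT j f B.
Proof.
move=> hf gB; rewrite -mulN1r -iterTZ//; congr iterT.
by apply/funext => C; rewrite mulN1r.
Qed.

(** Adding y commutes with adding random rows, so a pointwise bound on the drop survives
    averaging. *)
Lemma iterT_mono j f c : gram_bounded f ->
  (forall B (y : 'cV[R]_n), gram B -> f B - c <= f (B + y *m y^T) <= f B) ->
  forall B (y : 'cV[R]_n), gram B -> iterT j f B - c <= iterT j f (B + y *m y^T) <= iterT j f B.
Proof.
move=> hf fm; elim: j => // j IH B y gB.
have gBy := gram_add_rank1 y gB.
have ij := gram_bounded_iterT j hf.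
have i1 := transfer_integ ij gB; have i2 := transfer_integ ij gBy.
rewrite !iterTS -[X in _ - X](Ex_cst P) -ExB//; last exact: integ_cst.
apply/andP; split; apply: le_Ex => //; first by apply: integB => //; exact: integ_cst.
- move=> w; rewrite addrAC.
  by have /andP[] := IH (B + x w *m (x w)^T) y (gram_add_rank1 _ gB).
- move=> w; rewrite addrAC.
  by have /andP[] := IH (B + x w *m (x w)^T) y (gram_add_rank1 _ gB).
Qed.

(* Each new term changes the conditional mean by at most [c], so the variance
   grows by at most [c ^+ 2] per step. *)
Lemma iterT_variance j f c : gram_bounded f -> 0 <= c ->
  (forall B (y : 'cV[R]_n), gram B -> f B - c <= f (B + y *m y^T) <= f B) ->
  forall B, gram B ->
  iterT j (fun C => f C * f C) B <= iterT j f B ^+ 2 + j%:R * c ^+ 2.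
Proof.
move=> hf c0 fm; elim: j => [|j IH] B gB.
  by rewrite mul0r addr0 /= expr2.
have hff := gram_boundedM hf hf.
have ij := gram_bounded_iterT j hf.
have i1 := transfer_integ ij gB.
have i2 := transfer_integ (gram_boundedM ij ij) gB.
have i3 := transfer_integ (gram_bounded_iterT j hff) gB.
rewrite iterTS [X in _ <= X ^+ 2 + _]iterTS.
set E1 := Ex P (fun w => iterT j f _).
apply: (@le_trans _ _ (Ex P (fun w => iterT j f (B + x w *m (x w)^T) *
    iterT j f (B + x w *m (x w)^T) + j%:R * c ^+ 2))).
  apply: le_Ex => //; first by apply: integD => //; exact: integ_cst.
  by move=> w; rewrite -expr2; apply: IH; exact: gram_add_rank1.
rewrite ExD//; last exact: integ_cst.
rewrite Ex_cst -natr1 mulrDl mul1r addrA [leRHS]addrAC lerD2r.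
(* Deviations are measured from b and not from the mean E1, because they are at most c pointwise;
   the second moment about b exceeds the variance by (E1 - b)^2. *)
set b := iterT j f B.
have h w : 0 <= c ^+ 2 - (iterT j f (B + x w *m (x w)^T) - b) ^+ 2.
  have /andP[h1 h2] := iterT_mono j hf fm (x w) gB; rewrite -/b in h1 h2.
  by rewrite subr_ge0 -sqrrN opprB ler_sqr ?nnegrE; lra.
have : 0 <= Ex P (fun w => (c ^+ 2 - b ^+ 2 + 2 * b * iterT j f (B + x w *m (x w)^T)) -
    iterT j f (B + x w *m (x w)^T) * iterT j f (B + x w *m (x w)^T)).
  apply: Ex_ge0 => w; have := h w; set t := iterT j f _ => hh.
  by have -> : c ^+ 2 - b ^+ 2 + 2 * b * t - t * t = c ^+ 2 - (t - b) ^+ 2 by ring.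
have ic := integ_cst P (c ^+ 2 - b ^+ 2); have iz := integZ (2 * b) i1.
rewrite ExB//; last exact: integD.
rewrite ExD// ExZ// Ex_cst -/E1.
have := sqr_ge0 (E1 - b); lra.
Qed.

End transfer_operator.

(** * From random sketches to iterates of the transfer operator *)

Section gram_of_rows.
Context {R : realType} {dO dO'} {O : measurableType dO} {O' : measurableType dO'}.
Context {m n q : nat}.
Variables (P : probability O R) (s : O -> 'cV[R]_m).
Variables (P' : probability O' R) (S : O' -> 'M[R]_(q, m)) (A : 'M[R]_(m, n)).
Hypothesis ms : measurable_fun setT s.
Hypothesis mS : measurable_fun setT S.
Hypothesis indS : mutually_independent P' (rowv S).
Hypothesis lawS : forall i, same_law P' P (rowv S i) s.
Local Notation x := (fun w => A^T *m s w).
Local Notation y := (fun i w => A^T *m rowv S i w).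

(** Indexed by a list of rows, so that a single row can be removed. *)
Definition partial_gram (l : seq 'I_q) w : 'M[R]_n :=
  \sum_(i <- l) y i w *m (y i w)^T.

Lemma measurable_rowv i : measurable_fun setT (rowv S i).
Proof. by apply: measurable_trmx; exact: measurable_row. Qed.

Lemma gram_partial_gram l w : gram (partial_gram l w).
Proof.
elim: l => [|i l IH]; first by rewrite /partial_gram big_nil; exact: gram0.
by rewrite /partial_gram big_cons addrC; exact: gram_add_rank1.
Qed.

Lemma measurable_partial_gram_of d (T : measurableType d) (X : 'I_q -> T -> 'cV[R]_m) l :
  (forall i, i \in l -> measurable_fun setT (X i)) ->
  measurable_fun setT (fun w => \sum_(i <- l) (A^T *m X i w) *m (A^T *m X i w)^T).
Proof.
elim: l => [|i l IH] ml.
  by under eq_fun do rewrite big_nil; exact: measurable_cst.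
under eq_fun do rewrite big_cons.
have mi : measurable_fun setT (fun w => A^T *m X i w).
  by apply: measurable_mulmx => //; apply: ml; rewrite inE eqxx.
apply: measurable_mxD; last by apply: IH => j jl; apply: ml; rewrite inE jl orbT.
by apply: measurable_mulmx => //; exact: measurable_trmx.
Qed.

Lemma indep_partial_gram l i : i \notin l ->
  measurable_fun setT (partial_gram l) /\
  indep_pair P' (partial_gram l) (rowv S i).
Proof.
move=> il.
have il' : ~ [set` l] i by apply/negP.
have h := @past_indep R _ _ O' _ P' _ (rowv S) measurable_rowv indS [set` l] i il'
  _ 'M[R]_n (partial_gram l).
apply: h; apply: measurable_partial_gram_of => j jl.
exact: measurable_past.
Qed.

(** The head row is independent of the others and is integrated out against its copy s, which turns
    f into [transfer f]; hence the induction runs over all f. *)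
Lemma Ex_partial_gram l f B : uniq l -> gram_bounded f -> gram B ->
  Ex P' (fun w => f (B + partial_gram l w)) = iterT P x (size l) f B.
Proof.
have mx : measurable_fun setT x by exact: measurable_mulmx.
elim: l f => [|i l IH] f.
  move=> _ _ _; rewrite /partial_gram; under eq_Ex do rewrite big_nil addr0.
  by rewrite Ex_cst.
rewrite cons_uniq => /andP[il ul] hf gB; rewrite -[size _]/(size l).+1 iterTSr -IH//; last exact: gram_bounded_transfer.
have [mY indY] := indep_partial_gram il.
have [mf [c fc]] := hf.
pose h (z : 'M[R]_n * 'cV[R]_m) := f (B + z.1 + (A^T *m z.2) *m (A^T *m z.2)^T).
have mh : measurable_fun setT h.
  apply: (measurableT_comp mf).
  have m1 : measurable_fun setT (fun z : 'M[R]_n * 'cV[R]_m => A^T *m z.2).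
    by apply: measurable_mulmx => //; exact: measurable_snd.
  apply: measurable_mxD; last by apply: measurable_mulmx => //; exact: measurable_trmx.
  by apply: measurable_mxD => //; exact: measurable_fst.
have gadd C D : gram C -> gram D -> gram (C + D).
  move=> [p1 [X1 ->]] [p2 [X2 ->]]; exists (p1 + p2)%N, (col_mx X1 X2).
  by rewrite tr_col_mx mul_row_col.
have hc w z : `|h (partial_gram l w, z)| <= `|c|.
  apply: le_trans (ler_norm c); apply: fc; apply: gram_add_rank1.
  by apply: gadd => //; exact: gram_partial_gram.
have [_] := Ex_indep (measurable_rowv i) ms (lawS i) mY indY mh
  (measurable_cst (`|c| : R)) (integ_cst P `|c|) hc.
rewrite /h /= => <-; apply: eq_Ex => w.
by rewrite /partial_gram big_cons addrAC addrA.
Qed.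

Lemma full_gram w : (S w *m A)^T *m (S w *m A) = partial_gram (index_enum 'I_q) w.
Proof.
rewrite /partial_gram; apply/matrixP => i j; rewrite summxE mxE.
apply: eq_bigr => l _; rewrite mxE [RHS]mxE big_ord1 !mxE.
by congr (_ * _); rewrite ?mxE; apply: eq_bigr => k _; rewrite !mxE// mulrC.
Qed.

Lemma Ex_full_gram f : gram_bounded f ->
  Ex P' (fun w => f ((S w *m A)^T *m (S w *m A))) = iterT P x q f 0.
Proof.
move=> hf; have e := Ex_partial_gram (index_enum_uniq 'I_q) hf gram0.
have sz : size (index_enum 'I_q) = q by rewrite -sum1_size sum_nat_const card_ord muln1.
rewrite sz in e; rewrite -e; apply: eq_Ex => w.
by rewrite add0r full_gram.
Qed.

End gram_of_rows.

(** * Functionals of the resolvent under rank-one updates *)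

Section ridge_functionals.
Context {R : realType} {m n : nat}.
Variables (A : 'M[R]_(m, n)) (lam : R).
Hypothesis lam0 : 0 < lam.
Implicit Types (B : 'M[R]_n) (v w y : 'cV[R]_n).
Local Notation G := (ridge lam).
Local Notation S := (specnorm A ^+ 2).
Local Notation F := (fnorm A ^+ 2).

Definition rform v w B := dotp v (G B *m w).
Definition rnorm v B := dotp (A *m (G B *m v)) (A *m (G B *m v)).
Definition rtrace B := wtr A (G B).

Lemma measurable_ridge_id : measurable_fun setT (G : 'M[R]_n -> 'M[R]_n).
Proof. exact: (measurable_ridge lam (@measurable_id _ _ setT)). Qed.

Lemma gram_bounded_rform v w : gram_bounded (rform v w).
Proof.
split.
  apply: measurable_dotp => //; apply: measurable_mulmx => //.
  exact: measurable_ridge_id.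
by exists (enorm v * enorm w) => B gB; exact: ridge_form_bound.
Qed.

Lemma rnorm_ge0 v B : 0 <= rnorm v B.
Proof. exact: dotpxx_ge0. Qed.

Lemma rnorm_le v B : gram B -> rnorm v B <= S * rform v v B.
Proof.
move=> gB; apply: le_trans (specnorm_bound _ _) _.
by rewrite ler_wpM2l ?sqr_ge0//; exact: ridge_norm.
Qed.

Lemma gram_bounded_rnorm v : gram_bounded (rnorm v).
Proof.
split.
  have mv : measurable_fun setT (fun B => A *m (G B *m v)).
    apply: measurable_mulmx => //; apply: measurable_mulmx => //.
    exact: measurable_ridge_id.
  exact: measurable_dotp.
exists (S * dotp v v) => B gB; rewrite ger0_norm ?rnorm_ge0//.
apply: le_trans (rnorm_le v gB) _.
by rewrite ler_wpM2l ?sqr_ge0//; exact: ridge_form_le.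
Qed.

Lemma rtrace_update B y : gram B -> rtrace (B + y *m y^T) =
  rtrace B - (lam + rform y y B)^-1 * rnorm y B.
Proof. by move=> gB; rewrite /rtrace ridge_rank1// wtrB wtrZ wtr_rank1. Qed.

(** As G^2 <= G, the numerator is at most |A|^2 y^T G y. Hence no row, however long, lowers the
    weighted trace by more than |A|^2. *)
Lemma rnorm_ratio y B : gram B ->
  0 <= (lam + rform y y B)^-1 * rnorm y B <= S.
Proof.
move=> gB; have d : 0 < lam + rform y y B by exact: ridge_den_gt0.
apply/andP; split; first by rewrite mulr_ge0 ?rnorm_ge0// invr_ge0 ltW.
rewrite ler_pdivrMl//; apply: le_trans (rnorm_le y gB) _.
by rewrite mulrC ler_wpM2r ?sqr_ge0// lerDr ltW.
Qed.

Lemma rtrace_mono B y : gram B ->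
  rtrace B - S <= rtrace (B + y *m y^T) <= rtrace B.
Proof. by move=> gB; rewrite rtrace_update//; have := rnorm_ratio y gB; lra. Qed.

Lemma rtrace_ge0 B : gram B -> 0 <= rtrace B.
Proof. by move=> gB; exact: wtr_ge0 (gram_ridge lam0 gB). Qed.

Lemma ridge0 : G 0 = 1%:M :> 'M[R]_n.
Proof.
by apply/esym/ridge_uniq => //; [exact: gram0|rewrite add0r mulmx1].
Qed.

Lemma rtrace_reach j B : reach j B -> F - j%:R * S <= rtrace B <= F.
Proof.
elim=> [|i C y rC /andP[h1 h2]].
  by rewrite mul0r subr0 /rtrace ridge0 wtr1 lexx.
have /andP[h3 h4] := rtrace_mono y (reach_gram rC).
by rewrite -natr1 mulrDl mul1r; lra.
Qed.

Lemma gram_bounded_rtrace : gram_bounded rtrace.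
Proof.
split.
  apply: measurable_mxtrace; apply: measurable_mulmx => //.
  by apply: measurable_mulmx => //; exact: measurable_ridge_id.
exists (S * (\sum_(i < n) enorm (delta_mx i 0 : 'cV[R]_n) * enorm (delta_mx i 0 : 'cV[R]_n))).
move=> B gB; rewrite ger0_norm ?rtrace_ge0//.
apply: le_trans (wtr_le A (gram_ridge lam0 gB)) _; rewrite ler_wpM2l ?sqr_ge0//.
rewrite /mxtrace; apply: ler_sum => i _; apply: le_trans (ridge_form_bound lam0 gB _ _).
by apply: le_trans (ler_norm _); rewrite -mx_entry_dotp.
Qed.

Lemma rform_update v w B y : gram B -> rform v w (B + y *m y^T) =
  rform v w B - rform v y B * rform y w B / (lam + rform y y B).
Proof. by move=> gB; rewrite /rform ridge_rank1_form. Qed.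

Lemma rformC v w B : gram B -> rform v w B = rform w v B.
Proof. by move=> gB; rewrite /rform dotp_trmx ridge_sym// dotpC. Qed.

End ridge_functionals.

(* Only the cases [W = w *m v^T] and [W = 1%:M] (the trace) are needed. *)
Section leave_one_out.
Context {R : realType} {dO dO'} {O : measurableType dO} {O' : measurableType dO'}.
Context {m n q : nat}.
Variables (P : probability O R) (s : O -> 'cV[R]_m).
Variables (P' : probability O' R) (S : O' -> 'M[R]_(q, m)) (A : 'M[R]_(m, n)).
Hypothesis ms : measurable_fun setT s.
Hypothesis mS : measurable_fun setT S.
Hypothesis indS : mutually_independent P' (rowv S).
Hypothesis lawS : forall i, same_law P' P (rowv S i) s.
Hypothesis s2 : integ P (fun w => dotp (s w) (s w)).
Variables (lam : R) (W : 'M[R]_n).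
Hypothesis lam0 : 0 < lam.
Local Notation x := (fun w => A^T *m s w).
Local Notation y := (fun i w => A^T *m rowv S i w).
Local Notation G := (ridge lam).

Let h (z : 'M[R]_n * 'cV[R]_m) : R :=
  dotp (A^T *m z.2) (W *m (G z.1 *m (A^T *m z.2))) /
  (lam + rform lam (A^T *m z.2) (A^T *m z.2) z.1).

Definition loo_fun B : R := Ex P (fun w => h (B, s w)).

Let g (z : 'cV[R]_m) : R := lam^-1 * fnorm W * specnorm A ^+ 2 * dotp z z.

Let mh : measurable_fun setT h.
Proof.
have m1 : measurable_fun setT (fun z : 'M[R]_n * 'cV[R]_m => A^T *m z.2).
  by apply: measurable_mulmx => //; exact: measurable_snd.
have m2 : measurable_fun setT (fun z : 'M[R]_n * 'cV[R]_m => G z.1 *m (A^T *m z.2)).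
  by apply: measurable_mulmx => //; apply: measurable_ridge; exact: measurable_fst.
apply: measurable_mul_fun.
  by apply: measurable_dotp => //; exact: measurable_mulmx.
apply: measurable_inv_fun; apply: measurable_add_fun => //.
exact: measurable_dotp.
Qed.

Let ig : integ P (fun w => g (s w)).
Proof. exact: integZ. Qed.

Let hg B z : gram B -> `|h (B, z)| <= g z.
Proof.
move=> gB; rewrite /h /g /=; set u := A^T *m z.
have d : 0 < lam + rform lam u u B by exact: ridge_den_gt0.
rewrite normrM normfV (gtr0_norm d) mulrC -!mulrA.
apply: ler_pM; rewrite ?invr_ge0 ?(ltW d)//.
  by rewrite lef_pV2 ?posrE// lerDl; exact: ridge_form_ge0.
apply: le_trans (dotp_cs_enorm _ _) _.
have h1 : enorm (W *m (G B *m u)) <= fnorm W * enorm u.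
  apply: le_trans (enorm_fnorm _ _) _; rewrite ler_wpM2l ?fnorm_ge0//.
  rewrite -ler_sqr ?nnegrE ?enorm_ge0// !enorm2.
  exact: le_trans (ridge_norm lam0 gB u) (ridge_form_le lam0 gB u).
apply: le_trans (ler_wpM2l (enorm_ge0 u) h1) _.
rewrite mulrCA ler_wpM2l ?fnorm_ge0// -expr2 enorm2.
by rewrite mulrA -expr2; exact: specnorm_tr_bound.
Qed.

Lemma gram_bounded_loo : gram_bounded loo_fun.
Proof.
split.
  pose k (z : 'M[R]_n * O) := h (z.1, s z.2).
  apply: (@measurable_Ex _ _ _ _ _ P k); apply: (measurableT_comp mh).
  apply/measurable_fun_pairP; split; first exact: measurable_fst.
  exact: measurableT_comp ms (@measurable_snd _ _ _ _).
exists (Ex P (fun w => g (s w))) => B gB.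
have ih : integ P (fun w => h (B, s w)).
  apply: (integ_dom _ ig) => [|w]; last exact: hg.
  apply: (measurableT_comp (f := fun z => h (B, z))) => //.
  by apply: (measurableT_comp mh); exact: measurable_pair1.
apply: le_trans (Ex_norm ih) _; apply: le_Ex => //; first exact: integ_norm.
by move=> w; exact: hg.
Qed.

(** Write 1 - G = G M / lam, expand M into its rows, and in each term pass by [ridge_rank1_vec] to
    the resolvent without that row; the factor lam cancels. *)
Let tr_split w : \tr (W *m (1%:M - G ((S w *m A)^T *m (S w *m A)))) =
  \sum_i h (partial_gram S A (rem i (index_enum 'I_q)) w, rowv S i w).
Proof.
have gM l := gram_partial_gram S A l w.
set M := (S w *m A)^T *m (S w *m A).
have ME : M = partial_gram S A (index_enum 'I_q) w by rewrite /M full_gram.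
have gMM : gram M by rewrite ME.
have -> : 1%:M - G M = lam^-1 *: (G M *m M).
  by rewrite ridgeB// scalerA mulVf ?gt_eqF// scale1r.
have eM : M = \sum_i y i w *m (y i w)^T by rewrite ME.
rewrite {2}eM mulmx_sumr scaler_sumr mulmx_sumr linear_sum/=.
apply: eq_bigr => i _; set u := y i w.
have Mi : M = partial_gram S A (rem i (index_enum 'I_q)) w + u *m u^T.
  by rewrite ME /partial_gram (big_rem i) ?mem_index_enum//= addrC.
set N := partial_gram _ _ _ _ in Mi *.
have gN : gram N by exact: gM.
rewrite mulmxA {1}Mi ridge_rank1_vec// /h /= -/u.
rewrite -[lam + _]/(lam + rform lam u u N).
have d : lam + rform lam u u N != 0 by rewrite gt_eqF//; exact: ridge_den_gt0.
rewrite -scalemxAl scalerA -scalemxAr linearZ/= mulrA mulVf ?gt_eqF// mul1r mulrC.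
congr (_ / _); rewrite !mulmxA mxtrace_mulC /dotp /mxtrace big_ord1.
by rewrite !mulmxA.
Qed.

(** In each of the q terms a row meets q - 1 others independent of it, and only their number
    matters, so all terms have the same mean. *)
Lemma leave_one_out :
  Ex P' (fun w => \tr (W *m (1%:M - G ((S w *m A)^T *m (S w *m A))))) =
  q%:R * iterT P x q.-1 loo_fun 0.
Proof.
have il i : i \notin rem i (index_enum 'I_q).
  by rewrite mem_rem_uniqF ?index_enum_uniq.
have mg : measurable_fun setT g.
  by apply: measurable_mul_fun => //; apply: measurable_dotp.
have hi i := Ex_indep (measurable_rowv mS i) ms (lawS i)
  (indep_partial_gram A mS indS (il i)).1 (indep_partial_gram A mS indS (il i)).2 mh mg ig
  (fun w z => hg z (gram_partial_gram S A _ w)).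
rewrite (eq_Ex _ (tr_split)) Ex_sum => [|i]; last exact: (hi i).1.
have e i : Ex P' (fun w => h (partial_gram S A (rem i (index_enum 'I_q)) w, rowv S i w)) =
    iterT P x q.-1 loo_fun 0.
  rewrite (hi i).2.
  have := Ex_partial_gram A ms mS indS lawS (rem_uniq i (index_enum_uniq 'I_q))
    gram_bounded_loo (@gram0 R n).
  under eq_Ex do rewrite add0r.
  by rewrite size_rem ?mem_index_enum// -sum1_size sum_nat_const card_ord muln1.
under eq_bigr do rewrite e.
by rewrite sumr_const card_ord mulr_natl.
Qed.

End leave_one_out.

(** * The spectral gap *)

Section spectral_gap.
Context {R : realType} {dO} {O : measurableType dO} {m n : nat}.
Variables (P : probability O R) (s : O -> 'cV[R]_m) (K L : R).
Hypothesis ms : measurable_fun setT s.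
Hypothesis iso : isotropic P s.
Hypothesis sub : vsubgaussian P K s.
Hypothesis conc : euclidean_concentration P L s.
Variables (A : 'M[R]_(m, n)) (k : nat) (eta delta : R).
Local Notation S := (specnorm A ^+ 2).
Local Notation F := (fnorm A ^+ 2).
Hypotheses (F0 : 0 < F) (eta0 : 0 < eta).
Hypothesis LS : L ^+ 2 * S <= eta ^+ 2 * F.
Hypothesis Keta : K ^+ 2 * eta <= delta.
Hypothesis etad : eta <= delta.
Hypothesis delta_small : delta <= 1 / 1000.
Hypothesis kS : k%:R * S <= F / 1000.
Hypothesis kSS : k%:R * S ^+ 2 <= (eta * F / 10) ^+ 2.

(** Here [eta] stands for L / sqrt r and [delta] for K^2 L / sqrt r. At this level the quartic term
    of [W_moment2] is of order eta^2, while every denominator is shifted by a relative order eta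
    only. *)
Definition ridge_level : R := eta * F.
Local Notation lam := ridge_level.
Local Notation G := (ridge lam).
Local Notation x := (fun w => A^T *m s w).

Lemma ridge_level_gt0 : 0 < lam.
Proof. exact: mulr_gt0. Qed.
Let lam0 := ridge_level_gt0.

Let gr0 : gram (0 : 'M[R]_n). Proof. exact: gram0. Qed.

Let mx : measurable_fun setT x.
Proof. exact: measurable_mulmx. Qed.

Let S0 : 0 <= S. Proof. exact: sqr_ge0. Qed.

Let F2 : 0 < 2 * F. Proof. exact: mulr_gt0. Qed.

Let small : [/\ 0 < F, 0 < eta, eta <= delta, delta <= 1 / 1000 & 0 < lam <= F / 1000].
Proof.
split=> //; rewrite lam0 /ridge_level mulrC ler_wpM2l ?(ltW F0)//.
by have := le_trans etad delta_small; lra.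
Qed.

Lemma rtrace_bounds j B : (j <= k)%N -> reach j B ->
  F / 2 <= rtrace A lam B /\ rtrace A lam B <= F.
Proof.
move=> jk rB; have /andP[h1 h2] := rtrace_reach A lam0 rB; split=> //.
have : j%:R * S <= k%:R * S by rewrite ler_wpM2r// ler_nat.
move=> h3; have := h3; have := kS; have := F0; have := h1; lra.
Qed.

Lemma W_moment2_le j B : (j <= k)%N -> reach j B ->
  Ex P (fun w => ((rform lam (x w) (x w) B - rtrace A lam B) /
    (lam + rform lam (x w) (x w) B)) ^+ 2) <= 104 * eta ^+ 2.
Proof.
move=> jk rB; have [t1 t2] := rtrace_bounds jk rB.
have tau0 : 0 < wtr A (G B) by apply: lt_le_trans t1; rewrite divr_gt0.
have [_ h] := W_moment2 ms conc lam0 (reach_gram rB) tau0.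
apply: le_trans h _.
(* 72 is 36 doubled by the lower bound F / 2 on the trace; 32 comes unchanged from lam = eta F. *)
have -> : 104 * eta ^+ 2 = 72 * eta ^+ 2 + 32 * eta ^+ 2 by ring.
apply: lerD.
  rewrite ler_pdivrMr//; apply: le_trans (_ : 36 * (eta ^+ 2 * F) <= _); last first.
    rewrite -/(rtrace A lam B); have := mulr_ge0 (sqr_ge0 eta) (ltW F0).
    have : eta ^+ 2 * (F / 2) <= eta ^+ 2 * rtrace A lam B by rewrite ler_wpM2l ?sqr_ge0.
    lra.
  by rewrite ler_wpM2l.
rewrite ler_pdivrMr ?exprn_gt0// /ridge_level.
have -> : 32 * eta ^+ 2 * (eta * F) ^+ 2 = 32 * (eta ^+ 2 * F) ^+ 2 by ring.
rewrite ler_wpM2l//.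
have -> : L ^+ 4 * S ^+ 2 = (L ^+ 2 * S) ^+ 2 by ring.
by rewrite ler_sqr ?nnegrE// mulr_ge0 ?sqr_ge0// ltW.
Qed.

Lemma Ex_ratio_le j B z z' : (j <= k)%N -> reach j B ->
  `|Ex P (fun w => dotp z (s w) * dotp z' (s w) / (lam + rform lam (x w) (x w) B)) -
    dotp z z' / (lam + rtrace A lam B)| <= 30 * delta * (enorm z * enorm z') / F.
Proof.
move=> jk rB; have [t1 t2] := rtrace_bounds jk rB.
have tau0 : 0 < wtr A (G B) by apply: lt_le_trans t1; rewrite divr_gt0.
apply: le_trans (Ex_ratio ms iso sub conc lam0 (reach_gram rB) tau0 z z'
  (W_moment2_le jk rB)) _.
have zz : 0 <= enorm z * enorm z' by rewrite mulr_ge0 ?enorm_ge0.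
(* 208 <= 15^2; the final 30 also contains the factor 2 from lam + tau >= F / 2. *)
have hs : Num.sqrt (2 * (104 * eta ^+ 2)) <= 15 * eta.
  rewrite -[leRHS]ger0_norm ?mulr_ge0 ?(ltW eta0)// -sqrtr_sqr ler_wsqrtr//.
  by have := sqr_ge0 eta; lra.
rewrite ler_pdivrMr ?addr_gt0// -/(rtrace A lam B).
apply: (@le_trans _ _ (15 * delta * (enorm z * enorm z'))).
  rewrite ler_wpM2r//; apply: (@le_trans _ _ (15 * eta * K ^+ 2)).
    by rewrite ler_wpM2r ?sqr_ge0.
  by have := Keta; lra.
have -> : 30 * delta * (enorm z * enorm z') / F * (lam + rtrace A lam B) =
  15 * delta * (enorm z * enorm z') * (2 * (lam + rtrace A lam B) / F) by ring.
rewrite ler_peMr//.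
  by rewrite mulr_ge0// mulr_ge0//; case: small => ? ? ? ? /andP[? ?]; lra.
by rewrite ler_pdivlMr//; case: small => ? ? ? ? /andP[? ?]; lra.
Qed.

(** * The evolution of v^T G v and |A G v|^2 along the chain *)

Section direction.
Variable v : 'cV[R]_n.

(** The mean drop of v^T G v caused by one fresh row. All errors are charged to it because its
    iterates telescope. *)
Definition gain B : R := rform lam v v B - transfer P x (rform lam v v) B.

Lemma gram_bounded_gain : gram_bounded gain.
Proof.
apply: gram_boundedD; first exact: gram_bounded_rform.
apply: gram_boundedN; apply: gram_bounded_transfer => //.
exact: gram_bounded_rform.
Qed.

Lemma form_x B y w : gram B -> rform lam y (x w) B = dotp (A *m (G B *m y)) (s w).
Proof.
move=> gB; rewrite /rform dotp_trmx ridge_sym// dotp_trmx trmxK.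
by [].
Qed.

Lemma gainE B : gram B -> gain B = Ex P (fun w =>
  dotp (A *m (G B *m v)) (s w) * dotp (A *m (G B *m v)) (s w) /
  (lam + rform lam (x w) (x w) B)).
Proof.
move=> gB; rewrite /gain /transfer -[X in X - _](Ex_cst P) -ExB.
- apply: eq_Ex => w; rewrite rform_update// opprB addrC subrK.
  by rewrite [rform lam (x w) v B]rformC// form_x.
- exact: integ_cst.
- exact: transfer_integ (gram_bounded_rform lam0 v v) gB.
Qed.

(** By [gainE] the gain is close to |A G v|^2 / (lam + tau) with lam + tau <= 1.001 F; the spare
    room in the factor 2 absorbs the concentration error. *)
Lemma gain_ge j B : (j <= k)%N -> reach j B -> rnorm A lam v B <= 2 * F * gain B.
Proof.
move=> jk rB; have [t1 t2] := rtrace_bounds jk rB.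
have gB := reach_gram rB; rewrite gainE//; set z := A *m (G B *m v).
have := Ex_ratio_le z z jk rB; set e := Ex P _.
rewrite ler_norml => /andP[h _]; rewrite -expr2 enorm2 -/(rnorm A lam v B) in h.
set a := rnorm A lam v B in h *; have a0 : 0 <= a by exact: rnorm_ge0.
have : 2 * F * (a / (lam + rtrace A lam B)) - 2 * F * (30 * delta * a / F) <= 2 * F * e.
  by rewrite -mulrBr ler_pM2l ?F2//; move: h; lra.
have -> : 2 * F * (30 * delta * a / F) = 60 * delta * a by field; rewrite -sqrf_eq0 gt_eqF.
have : 3 / 2 * a <= 2 * F * (a / (lam + rtrace A lam B)).
  rewrite mulrA ler_pdivlMr; last by case: small => ? ? ? ? /andP[? ?]; lra.
  have -> : 2 * F * a = a * (2 * F) by ring.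
  rewrite [X in X * _ <= _]mulrC -mulrA ler_wpM2l//.
  have : lam <= F / 1000.
    rewrite /ridge_level mulrC ler_wpM2l ?(ltW F0)//.
    by case: small => ? ? ? ? _; lra.
  by case: small => ? ? ? ? /andP[? ?]; lra.
have : 60 * delta * a <= 60 / 1000 * a.
  by rewrite ler_wpM2r//; case: small => ? ? ? ? _; lra.
lra.
Qed.

(** The expanded square, grouped so that the last factor is the ratio bounded by |A|^2 in
    [rnorm_ratio]. *)
Lemma rnorm_update B y : gram B -> rnorm A lam v (B + y *m y^T) =
  rnorm A lam v B
  - 2 * (dotp (A *m (G B *m v)) (A *m (G B *m y)) * rform lam v y B / (lam + rform lam y y B))
  + rform lam v y B ^+ 2 / (lam + rform lam y y B) *
    ((lam + rform lam y y B)^-1 * rnorm A lam y B).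
Proof.
move=> gB; set d := lam + rform lam y y B.
have e : A *m (G (B + y *m y^T) *m v) =
    A *m (G B *m v) - (rform lam v y B / d) *: (A *m (G B *m y)).
  rewrite ridge_rank1// mulmxBl mulmxBr; congr (_ - _).
  rewrite -scalemxAl -[_ *m v]mulmxA (mx11_scalar ((G B *m y)^T *m v)) mul_mx_scalar.
  rewrite -/(dotp (G B *m y) v) [dotp _ v]dotpC -/(rform lam v y B) scalerA mulrC.
  by rewrite -scalemxAr.
rewrite /rnorm e !dotp_lin [dotp (A *m (G B *m y)) (A *m (G B *m v))]dotpC.
have d0 : d != 0 by rewrite gt_eqF//; exact: ridge_den_gt0.
move: d0; set t := d; set a := rform _ _ _ _; set b := dotp _ _; set c := dotp _ _.
set f := dotp _ _ => t0.
by field.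
Qed.

(** The square term costs |A|^2 times the gain. The cross term is nearly -2 <z, z'> / (lam + tau),
    which is nonpositive because <z, z'> is the form of G at A^T z; only its concentration error
    remains, at most twice |A|^2 times the gain. *)
Lemma transfer_rnorm_le j B : (j <= k)%N -> reach j B ->
  transfer P x (rnorm A lam v) B <= rnorm A lam v B + 3 * S * gain B.
Proof.
move=> jk rB; have gB := reach_gram rB; have [t1 t2] := rtrace_bounds jk rB.
set z := A *m (G B *m v); set z' := A *m (G B *m (A^T *m z)).
set a := rnorm A lam v B.
have a0 : 0 <= a by exact: rnorm_ge0.
have zz' : 0 <= dotp z z'.
  by rewrite /z' dotp_trmx; exact: ridge_form_ge0.
have nz' : enorm z' <= S * enorm z.
  rewrite -ler_sqr ?nnegrE ?(mulr_ge0 S0) ?enorm_ge0// enorm2 exprMn.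
  apply: le_trans (specnorm_bound _ _) _; rewrite [S ^+ 2]expr2 -[S * S * _]mulrA ler_wpM2l//.
  apply: le_trans (ridge_norm lam0 gB _) _; apply: le_trans (ridge_form_le lam0 gB _) _.
  by rewrite enorm2; exact: specnorm_tr_bound.
have i1 := integ_ratio ms sub A lam0 gB z z.
have i2 := integ_ratio ms sub A lam0 gB z z'.
have iT := transfer_integ P mx (gram_bounded_rnorm A lam0 v) gB.
have ia := integ_cst P a.
have up w : rnorm A lam v (B + x w *m (x w)^T) <=
    a - 2 * (dotp z (s w) * dotp z' (s w) / (lam + rform lam (x w) (x w) B)) +
    S * (dotp z (s w) * dotp z (s w) / (lam + rform lam (x w) (x w) B)).
  rewrite rnorm_update// form_x// -/a -/z.
  have -> : dotp z (A *m (G B *m (A^T *m s w))) = dotp z' (s w).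
    by rewrite dotp_trmx dotp_trmx ridge_sym// dotp_trmx trmxK.
  rewrite [dotp z' _ * _]mulrC lerD2l [leRHS]mulrC expr2 ler_wpM2l//.
    by rewrite mulr_ge0 -?expr2 ?sqr_ge0// invr_ge0 ltW//; exact: ridge_den_gt0.
  by have /andP[] := rnorm_ratio A lam0 (x w) gB.
have iU := integD (integB ia (integZ 2 i2)) (integZ S i1).
apply: le_trans (le_Ex iT iU up) _.
rewrite ExD; [|apply: integB => //; exact: integZ|exact: integZ].
rewrite ExB//; last exact: integZ.
rewrite !ExZ// Ex_cst -gainE//.
have := Ex_ratio_le z z' jk rB; set e := Ex P _; rewrite ler_norml => /andP[h _].
have q0 : 0 <= dotp z z' / (lam + rtrace A lam B).
  by rewrite divr_ge0//; case: small => ? ? ? ? /andP[? ?]; lra.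
have hz : enorm z * enorm z' <= S * a.
  rewrite /a /rnorm -/z -enorm2 expr2 mulrA [S * _]mulrC -mulrA.
  by rewrite ler_wpM2l ?enorm_ge0.
have h2 : 30 * delta * (enorm z * enorm z') / F <= S * gain B.
  rewrite ler_pdivrMr//; have := gain_ge jk rB; rewrite -/a => ha.
  apply: (@le_trans _ _ (30 * delta * (S * a))).
    by rewrite ler_wpM2l//; case: small => ? ? ? ? /andP[? ?]; lra.
  apply: (@le_trans _ _ (30 * delta * (S * (2 * F * gain B)))).
    rewrite ler_wpM2l//; first by case: small => ? ? ? ? /andP[? ?]; lra.
    by rewrite ler_wpM2l.
  have g0 : 0 <= S * gain B * F.
    apply: mulr_ge0; last exact: ltW.
    apply: mulr_ge0 => //; move: (le_trans a0 ha).
    by rewrite pmulr_rge0 ?F2.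
  have -> : 30 * delta * (S * (2 * F * gain B)) = 60 * delta * (S * gain B * F) by ring.
  by rewrite ler_piMl//; case: small => ? ? ? ? _; lra.
lra.
Qed.

Local Notation e_ j := (iterT P x j (rform lam v v) 0).
Local Notation a_ j := (iterT P x j (rnorm A lam v) 0).

Lemma iterT_gain j : iterT P x j gain 0 = e_ j - e_ j.+1.
Proof.
have hr := gram_bounded_rform lam0 v v; have g0' := gr0.
rewrite iterTD//; last first.
- by apply: gram_boundedN; exact: gram_bounded_transfer.
by rewrite iterTN// ?iterTSr//; exact: gram_bounded_transfer.
Qed.

Lemma iterT_rnorm_gain j : (j < k)%N -> a_ j <= 2 * F * (e_ j - e_ j.+1).
Proof.
move=> jk; have g0' := gr0; rewrite -iterT_gain -iterTZ//; last exact: gram_bounded_gain.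
apply: (le_iterT P mx (i := 0%N)) reach0 => //.
- exact: gram_bounded_rnorm.
- by apply: gram_boundedM; [exact: gram_bounded_cst|exact: gram_bounded_gain].
- by move=> C; rewrite add0n => rC; apply: gain_ge rC; exact: ltnW.
Qed.

Lemma iterT_rnormS j : (j < k)%N -> a_ j.+1 <= a_ j + 3 * S * (e_ j - e_ j.+1).
Proof.
move=> jk; have g0' := gr0; rewrite iterTSr -iterT_gain -iterTZ//; last exact: gram_bounded_gain.
have hg : gram_bounded (fun B => 3 * S * gain B).
  by apply: gram_boundedM; [exact: gram_bounded_cst|exact: gram_bounded_gain].
have hn := gram_bounded_rnorm A lam0 v.
rewrite -iterTD//.
apply: (le_iterT P mx (i := 0%N)) reach0 => //.
- exact: gram_bounded_transfer.
- exact: gram_boundedD.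
- by move=> C; rewrite add0n => rC; apply: transfer_rnorm_le rC; exact: ltnW.
Qed.

Lemma iterT_rform_decr j : (j < k)%N -> e_ j.+1 <= e_ j.
Proof.
move=> jk; rewrite -subr_ge0.
have a0 : 0 <= a_ j.
  rewrite -(iterT_cst P x j 0 0); apply: (le_iterT P mx (i := 0%N)) reach0 => //.
  - exact: gram_bounded_cst.
  - exact: gram_bounded_rnorm.
  - by move=> C _; exact: rnorm_ge0.
by have := le_trans a0 (iterT_rnorm_gain jk); rewrite pmulr_rge0 ?F2.
Qed.

(* [a_ k.-1 <= a_ j + 3 S (e_ j - e_ k.-1)] for every [j < k]; sum over [j]. *)
Lemma iterT_rnorm_last : (0 < k)%N -> k%:R * a_ k.-1 <= 5 * F * (dotp v v - e_ k).
Proof.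
move=> k0.
have e0 : e_ 0 = dotp v v by rewrite /iterT /= /rform ridge0// mul1mx.
have edecr i j : (i <= j)%N -> (j <= k)%N -> e_ j <= e_ i.
  elim: j => [|j IH]; first by rewrite leqn0 => /eqP ->.
  rewrite leq_eqVlt => /predU1P[->//|ij] jk.
  by apply: le_trans (iterT_rform_decr jk) (IH _ (ltnW jk)).
have ainc i j : (i <= j)%N -> (j < k)%N -> a_ j <= a_ i + 3 * S * (e_ i - e_ j).
  elim: j => [|j IH]; first by rewrite leqn0 => /eqP ->; rewrite subrr mulr0 addr0.
  rewrite leq_eqVlt => /predU1P[->|ij jk]; first by rewrite subrr mulr0 addr0.
  have := IH ij (ltnW jk); have := iterT_rnormS (ltnW jk); lra.
have aj (j : 'I_k) : a_ k.-1 <= 2 * F * (e_ j - e_ j.+1) + 3 * S * (dotp v v - e_ k).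
  have jk : (j <= k.-1)%N by rewrite -ltnS prednK.
  have kk : (k.-1 < k)%N by rewrite prednK.
  apply: le_trans (ainc j k.-1 jk kk) _; apply: lerD; first exact: iterT_rnorm_gain.
  have S3 : 0 <= 3 * S by exact: mulr_ge0.
  rewrite (ler_wpM2l S3)//; apply: lerB.
    by rewrite -e0; apply: edecr => //; exact: ltnW.
  exact/edecr/leqnn/ltnW.
rewrite mulr_natl -[X in _ *+ X]card_ord -sumr_const.
apply: le_trans (ler_sum _ (fun j _ => aj j)) _.
rewrite big_split/= -mulr_sumr sumr_const card_ord.
have -> : \sum_(i < k) (e_ i - e_ i.+1) = dotp v v - e_ k.
  rewrite -e0 -(big_mkord xpredT (fun i => e_ i - e_ i.+1)).
  by rewrite -[RHS]opprB -(telescope_sumr (fun i => e_ i))// -sumrN;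
    apply: eq_bigr => i _; rewrite opprB.
have D0 : 0 <= dotp v v - e_ k by rewrite subr_ge0 -e0 edecr.
rewrite -[X in _ + X]mulr_natl mulrA -mulrDl ler_wpM2r//.
by have := kS; case: small => ? ? ? ? /andP[? ?]; lra.
Qed.

End direction.

(** * The spectral gap *)

Lemma le_half_sum (u y : R) : 0 < y -> u <= (u ^+ 2 / y + y) / 2.
Proof.
move=> y0; rewrite -subr_ge0.
have -> : (u ^+ 2 / y + y) / 2 - u = (u - y) ^+ 2 / (2 * y) by field; rewrite gt_eqF.
by rewrite divr_ge0 ?sqr_ge0// mulr_ge0// ltW.
Qed.

Definition mean_rtrace : R := iterT P x k.-1 (rtrace A lam) 0.
Local Notation tbar := mean_rtrace.

Lemma mean_rtrace_bounds : F / 2 <= tbar <= F.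
Proof.
have hc c : gram_bounded (fun _ : 'M[R]_n => c : R) by exact: gram_bounded_cst.
have ht := gram_bounded_rtrace A lam0.
rewrite -[X in X <= _ <= _](iterT_cst P x k.-1 _ 0) -[X in _ <= _ <= X](iterT_cst P x k.-1 _ 0).
apply/andP; split; apply: (le_iterT P mx (i := 0%N)) reach0 => // C; rewrite add0n => rC.
  exact: (rtrace_bounds (leq_pred k) rC).1.
exact: (rtrace_bounds (leq_pred k) rC).2.
Qed.

Lemma loo_rank1 v w B : gram B -> loo_fun P s A lam (w *m v^T) B =
  Ex P (fun u => dotp (A *m (G B *m v)) (s u) * dotp (A *m w) (s u) /
    (lam + rform lam (x u) (x u) B)).
Proof.
move=> gB; apply: eq_Ex => u /=; congr (_ / _).
rewrite -[w *m v^T *m _]mulmxA (mx11_scalar (v^T *m _)) mul_mx_scalar dotpZr.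
rewrite -/(dotp v (G B *m x u)) -/(rform lam v (x u) B) form_x//.
by congr (_ * _); rewrite dotpC dotp_trmx trmxK.
Qed.

(** The right side is k times a leave-one-out mean whose integrand is close to v^T G v / (lam +
    trace). It is bounded below by fluctuations of the trace, of size [c], and by the concentration
    error, proportional to |A G v| |A w|. *)
Lemma spectral_gap_le v w mu : (0 < k)%N -> enorm v = 1 -> A^T *m (A *m w) = v ->
  mu <= 1 -> iterT P x k (rform lam v v) 0 = mu ->
  (1 - mu) * dotp v w = k%:R * iterT P x k.-1 (loo_fun P s A lam (w *m v^T)) 0 ->
  k%:R / (lam + tbar) * (mu - 241 * delta) <= (1 - mu) * dotp v w.
Proof.
move=> k0 v1 Aw mu1 emu eloo.
have /andP[tb1 tb2] := mean_rtrace_bounds.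
set z0 := lam + tbar.
have [z01 z02] : F / 2 <= z0 /\ z0 <= 1001 / 1000 * F.
  by rewrite /z0; case: small => ? ? ? ? /andP[? ?]; split; lra.
have z0p : 0 < z0 by apply: lt_le_trans z01; rewrite divr_gt0.
have kp : 0 < k%:R :> R by rewrite ltr0n.
have delta0 : 0 < delta by exact: lt_le_trans eta0 etad.
have dvw : dotp v w = enorm (A *m w) ^+ 2.
  by rewrite -Aw dotpC dotp_trmx trmxK enorm2.
set q := enorm (A *m w) in dvw.
have q0 : 0 < q.
  rewrite lt_neqAle enorm_ge0 andbT; apply/eqP => e0.
  have Aw0 : A *m w = 0 by apply: dotpxx_eq0; rewrite -enorm2 -/q -e0 expr0n.
  by move/eqP: v1; rewrite -Aw Aw0 mulmx0 enorm0 eq_sym oner_eq0.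
have q20 : 0 < q ^+ 2 by rewrite exprn_gt0.
(* In the first case mu <= 1 concludes. In the second, the upper bound on (1 - mu) |A w|^2 is what
   makes a q^2 <= 10 follow from [iterT_rnorm_last]. *)
have [hY|hY] := lerP (k%:R / z0) ((1 - mu) * dotp v w).
  apply: le_trans hY; rewrite ler_piMr ?divr_ge0 ?(ltW kp) ?(ltW z0p)//; lra.
set a := iterT P x k.-1 (rnorm A lam v) 0.
set em := iterT P x k.-1 (rform lam v v) 0.
have emu1 : mu <= em.
  have kk : (k.-1 < k)%N by rewrite prednK.
  have := iterT_rform_decr v kk.
  by rewrite prednK// emu.
have a_le : a * q ^+ 2 <= 10.
  have := iterT_rnorm_last v k0.
  rewrite -enorm2 v1 expr1n emu -/a => ha.
  have h1 : k%:R * a * q ^+ 2 <= 5 * F * (1 - mu) * q ^+ 2 by rewrite ler_wpM2r// ltW.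
  have h2 : 5 * F * ((1 - mu) * q ^+ 2) <= 5 * F * (k%:R / z0).
    apply: ler_wpM2l; last by rewrite -dvw ltW.
    by case: small; lra.
  have h3 : 5 * F * (k%:R / z0) <= k%:R * 10.
    rewrite mulrA ler_pdivrMr//.
    have : k%:R * F <= k%:R * (2 * z0) by rewrite ler_wpM2l ?(ltW kp)//; lra.
    lra.
  by rewrite -(ler_pM2l kp); lra.
have a0 : 0 <= a.
  rewrite -(iterT_cst P x k.-1 0 0); apply: (le_iterT P mx (i := 0%N)) reach0 => //.
  - exact: gram_bounded_cst.
  - exact: gram_bounded_rnorm.
  - by move=> C _; exact: rnorm_ge0.
(* [c] dominates the standard deviation of the trace, by [kSS]. The weight [c'] matches the size of
   |A G v|, whose root mean square is at most sqrt 10 / q. The coefficients that follow are read off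
   from the expansion [gE]. *)
pose c := eta * F / 10; have c0 : 0 < c by rewrite divr_gt0// mulr_gt0.
pose c' := 4 / q; have c'0 : 0 < c' by rewrite divr_gt0.
pose al := z0^-1; pose be := - (2 * z0 ^+ 2 * c)^-1; pose ga := tbar / (z0 ^+ 2 * c).
pose de := - (15 * delta * q / (F * c')).
pose cst := - (tbar ^+ 2 / c + c) / (2 * z0 ^+ 2) - 15 * delta * q * c' / F.
(* [1/z >= 1/z0 - (z - z0)/z0^2] and AM-GM with weights [c], [c'] turn the
   integrand into a linear combination of functions with known means. *)
pose g B := al * rform lam v v B + be * (rtrace A lam B * rtrace A lam B) +
  ga * rtrace A lam B + de * rnorm A lam v B + cst.
have br := gram_bounded_rform lam0 v v.
have bt := gram_bounded_rtrace A lam0; have btt := gram_boundedM bt bt.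
have bn := gram_bounded_rnorm A lam0 v.
have bZ e f : gram_bounded f -> gram_bounded (fun B : 'M[R]_n => e * f B).
  by move=> hf; apply: gram_boundedM => //; exact: gram_bounded_cst.
have b1 := bZ al _ br; have b2 := bZ be _ btt; have b3 := bZ ga _ bt.
have b4 := bZ de _ bn; have b5 := @gram_bounded_cst R n cst.
have b12 := gram_boundedD b1 b2; have b123 := gram_boundedD b12 b3.
have b1234 := gram_boundedD b123 b4.
have bg : gram_bounded g.
  exact: gram_boundedD.
have s2 : integ P (fun w0 => dotp (s w0) (s w0)).
  under eq_fun do rewrite dotpE.
  apply: integ_sum => i; have := form_integM ms sub (delta_mx i 0) (delta_mx i 0).
  by under eq_fun do rewrite !dotp_delta.
have gle C : reach (0 + k.-1) C -> g C <= loo_fun P s A lam (w *m v^T) C.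
  rewrite add0n => rC; have gC := reach_gram rC.
  have [t1 t2] := rtrace_bounds (leq_pred k) rC.
  rewrite loo_rank1//.
  have := Ex_ratio_le
    (A *m (G C *m v)) (A *m w) (leq_pred k) rC.
  set H := Ex P _; rewrite ler_norml => /andP[hH _].
  have ev : dotp (A *m (G C *m v)) (A *m w) = rform lam v v C.
    by rewrite dotpC dotp_trmx Aw.
  rewrite ev -/q in hH.
  set rho := rform lam v v C in hH *; set t := rtrace A lam C in hH t1 t2 *.
  have rho0 : 0 <= rho by exact: ridge_form_ge0.
  have rho1 : rho <= 1.
    have := ridge_form_le lam0 gC v; rewrite -enorm2 v1 expr1n.
    by [].
  set N := enorm (A *m (G C *m v)) in hH.
  have pN : rnorm A lam v C = N ^+ 2 by rewrite enorm2.
  have zp : 0 < lam + t by case: small => ? ? ? ? /andP[? ?]; lra.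
  have gE : g C = rho / z0 - ((t - tbar) ^+ 2 / c + c) / (2 * z0 ^+ 2) -
      15 * delta * q / F * (N ^+ 2 / c' + c').
    rewrite /g -/rho -/t pN /al /be /ga /de /cst.
    have n1 : z0 != 0 by rewrite gt_eqF.
    have n2 : c != 0 by rewrite gt_eqF.
    have n3 : c' != 0 by rewrite gt_eqF.
    have n4 : F != 0 by rewrite gt_eqF.
    by field; rewrite n1 n2 n3 -sqrf_eq0 n4.
  have i1 : rho / z0 - rho * (t - tbar) / z0 ^+ 2 <= rho / (lam + t).
    rewrite -subr_ge0.
    have -> : rho / (lam + t) - (rho / z0 - rho * (t - tbar) / z0 ^+ 2) =
        rho * (t - tbar) ^+ 2 / ((lam + t) * z0 ^+ 2).
      have n1 : z0 != 0 by rewrite gt_eqF.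
      have n2 : lam + t != 0 by rewrite gt_eqF.
      have -> : t - tbar = lam + t - z0 by rewrite /z0; ring.
      by field; rewrite n1 n2.
    by apply: divr_ge0; rewrite mulr_ge0 ?sqr_ge0 ?(ltW zp).
  have i2 : rho * (t - tbar) <= ((t - tbar) ^+ 2 / c + c) / 2.
    apply: (@le_trans _ _ `|t - tbar|).
      apply: le_trans (ler_norm _) _; rewrite normrM ger0_norm//.
      by rewrite ler_piMl.
    by rewrite -[(t - tbar) ^+ 2]real_normK ?num_real//; exact: le_half_sum.
  have i3 : N <= (N ^+ 2 / c' + c') / 2 by exact: le_half_sum.
  have i2' : rho * (t - tbar) / z0 ^+ 2 <= ((t - tbar) ^+ 2 / c + c) / (2 * z0 ^+ 2).
    by rewrite [(2 * _)^-1]invfM [leRHS]mulrA ler_wpM2r// invr_ge0 sqr_ge0.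
  have i3' : 30 * delta * (N * q) / F <= 15 * delta * q / F * (N ^+ 2 / c' + c').
    have -> : 30 * delta * (N * q) / F = 30 * delta * q / F * N by ring.
    have dbl (y : R) : 15 * delta * q / F * y = 30 * delta * q / F * (y / 2).
      by field; rewrite -sqrf_eq0 gt_eqF.
    rewrite dbl ler_wpM2l// divr_ge0 ?(ltW F0)// mulr_ge0 ?(ltW q0)//.
    by rewrite mulr_ge0// ltW.
  by rewrite gE; lra.
have V2 := iterT_variance P mx k.-1 bt S0 (fun B y gB => rtrace_mono A lam0 y gB) gr0.
rewrite -/tbar in V2.
have V3 : k.-1%:R * S ^+ 2 <= c ^+ 2.
  by apply: le_trans kSS; rewrite ler_wpM2r ?sqr_ge0// ler_nat leq_pred.
have hloo : iterT P x k.-1 g 0 <= iterT P x k.-1 (loo_fun P s A lam (w *m v^T)) 0.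
  apply: (le_iterT P mx (i := 0%N) bg _ gle reach0).
  exact: (gram_bounded_loo _ ms s2).
have Eg : iterT P x k.-1 g 0 = al * em +
    be * iterT P x k.-1 (fun B => rtrace A lam B * rtrace A lam B) 0 + ga * tbar + de * a + cst.
  rewrite /g (iterTD P mx)// (iterTD P mx)// (iterTD P mx)// (iterTD P mx)//.
  by rewrite iterT_cst !(iterTZ P mx).
set V := iterT P x k.-1 (fun B => rtrace A lam B * rtrace A lam B) 0 in V2 Eg.
have hbe : be * (tbar ^+ 2 + c ^+ 2) <= be * V.
  rewrite ler_wnM2l//; first by rewrite oppr_le0 invr_ge0 (mulr_ge0 (mulr_ge0 _ (sqr_ge0 _)) (ltW c0)).
  by apply: le_trans V2 _; rewrite lerD2l.
have ide : al * em + be * (tbar ^+ 2 + c ^+ 2) + ga * tbar + de * a + cst =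
    em / z0 - c / z0 ^+ 2 - 15 * delta / F * (a * q ^+ 2 / 4 + 4).
  rewrite /al /be /ga /de /cst.
  have n1 : z0 != 0 by rewrite gt_eqF.
  have n2 : c != 0 by rewrite gt_eqF.
  have n3 : q != 0 by rewrite gt_eqF.
  have n4 : fnorm A != 0 by rewrite -sqrf_eq0 gt_eqF.
  rewrite /c'; move: n2; move: (c) => C1 n2.
  by field; rewrite n1 n2 n3 n4.
(* 15 (10/4 + 4) = 97.5, using a q^2 <= 10. *)
have t1 : 15 * delta / F * (a * q ^+ 2 / 4 + 4) <= 98 * delta / F.
  have -> : 98 * delta / F = 15 * delta / F * (98 / 15) by field; rewrite -sqrf_eq0 gt_eqF.
  rewrite ler_wpM2l//; last by lra.
  by rewrite divr_ge0 ?(ltW F0)// mulr_ge0// ltW.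
have t2 : 98 * delta / F <= 100 * delta / z0.
  rewrite ler_pdivrMr// mulrAC ler_pdivlMr//.
  have : delta * z0 <= delta * (1001 / 1000 * F) by rewrite ler_wpM2l// ltW.
  have := mulr_gt0 delta0 F0; lra.
have t3 : c / z0 ^+ 2 <= delta / z0.
  rewrite [z0 ^+ 2]expr2 invfM mulrA ler_wpM2r ?invr_ge0 ?(ltW z0p)//.
  rewrite ler_pdivrMr// /c.
  have : eta * F <= delta * F by rewrite ler_wpM2r// ltW.
  have : delta * (F / 2) <= delta * z0 by rewrite ler_wpM2l// ltW.
  have := mulr_gt0 delta0 F0; lra.
have t4 : mu / z0 <= em / z0 by rewrite ler_wpM2r// invr_ge0 ltW.
rewrite eloo -mulrA ler_wpM2l ?(ltW kp)//.
have -> : z0^-1 * (mu - 241 * delta) = mu / z0 - 241 * delta / z0 by ring.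
have t5 : 0 <= delta / z0 by rewrite divr_ge0// ltW.
have : 241 * delta / z0 = 241 * (delta / z0) by ring.
have : 100 * delta / z0 = 100 * (delta / z0) by ring.
lra.
Qed.

(** * The spectral gap *)

(** For W = 1 the integrand is 1 - lam / (lam + xi), and xi is typically near the trace, at least F
    / 2, which dwarfs lam = eta F: each row captures almost a full unit of trace. *)
Lemma loo_trace_ge j B : (j <= k)%N -> reach j B ->
  1 - 4 * eta <= loo_fun P s A lam 1%:M B.
Proof.
move=> jk rB; have gB := reach_gram rB.
have [t1 t2] := rtrace_bounds jk rB.
have tau0 : 0 < wtr A (G B) by apply: lt_le_trans t1; rewrite divr_gt0.
have iL : integ P (fun w => lam / (lam + rform lam (x w) (x w) B)).
  have mxi := measurable_xi ms A lam B.
  apply: (@integ_bounded _ _ _ P _ 1) => [|w].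
    by apply: measurable_mul_fun => //; apply: measurable_inv_fun; apply: measurable_add_fun.
  have d : 0 < lam + rform lam (x w) (x w) B by exact: ridge_den_gt0.
  rewrite ger0_norm ?divr_ge0 ?(ltW lam0) ?(ltW d)// ler_pdivrMr// mul1r lerDl.
  exact: ridge_form_ge0.
have -> : loo_fun P s A lam 1%:M B =
    1 - Ex P (fun w => lam / (lam + rform lam (x w) (x w) B)).
  rewrite -[X in X - _](Ex_cst P) -ExB//; last exact: integ_cst.
  apply: eq_Ex => w /=; rewrite mul1mx -/(rform lam (x w) (x w) B).
  have d : lam + rform lam (x w) (x w) B != 0 by rewrite gt_eqF//; exact: ridge_den_gt0.
  by move: d; set y := rform _ _ _ _ => d; field.
have h := Ex_shrink ms conc lam0 gB tau0
  (W_moment2_le jk rB).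
have hs : Num.sqrt (104 * eta ^+ 2) <= 11 * eta.
  rewrite -[leRHS]ger0_norm ?mulr_ge0 ?(ltW eta0)// -sqrtr_sqr ler_wsqrtr//.
  by have := sqr_ge0 eta; lra.
have h2 : lam / (lam + wtr A (G B)) <= 2 * eta.
  rewrite ler_pdivrMr ?addr_gt0// -/(rtrace A lam B) mulrDr.
  have : eta * (F / 2) <= eta * rtrace A lam B by rewrite ler_wpM2l// ltW.
  have : 0 <= 2 * eta * lam by rewrite mulr_ge0 ?(ltW lam0)// mulr_ge0// ltW.
  by have : lam = eta * F by []; lra.
rewrite lerD2l lerN2; apply: le_trans h _.
have -> : 4 * eta = 2 * eta * 2 by ring.
apply: ler_pM => //.
- by rewrite divr_ge0 ?(ltW lam0)// ltW// addr_gt0.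
- by case: small => ? ? ? ? _; lra.
Qed.

(** * The mean trace against the error of the best-known sketch size k - 1 *)

Section error_term.
Context {dO'} {O' : measurableType dO'}.
Variables (P' : probability O' R) (S' : O' -> 'M[R]_(k.-1, m)).
Hypothesis mS' : measurable_fun setT S'.
Hypothesis indS' : mutually_independent P' (rowv S').
Hypothesis lawS' : forall i, same_law P' P (rowv S' i) s.

Lemma form_integ_norm : integ P (fun w => dotp (s w) (s w)).
Proof.
under eq_fun do rewrite dotpE.
apply: integ_sum => i; have := form_integM ms sub (delta_mx i 0) (delta_mx i 0).
by under eq_fun do rewrite !dotp_delta.
Qed.

Let measurable_gramS : measurable_fun setT (fun w => (S' w *m A)^T *m (S' w *m A)).
Proof.
by do !apply: measurable_mulmx => //; apply: measurable_trmx; exact: measurable_mulmx.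
Qed.

Let gramS w : gram ((S' w *m A)^T *m (S' w *m A)).
Proof. by exists k.-1, (S' w *m A). Qed.

Lemma ErrE : Err P' S' A = Ex P' (fun w => wtr A (kerproj (S' w *m A))).
Proof.
rewrite /Err expectationE /Ex /Rintegral; congr fine; apply: eq_integral => w _.
congr EFin; rewrite -/(kerproj (S' w *m A)) fnorm2 trmx_mul kerproj_sym mxtrace_mulC.
by rewrite /wtr -!mulmxA [kerproj _ *m (_ *m _)]mulmxA kerproj_idem.
Qed.

Lemma integ_kerproj : integ P' (fun w => wtr A (kerproj (S' w *m A))).
Proof.
have [_ [c hc]] := gram_bounded_rtrace A lam0.
apply: (@integ_bounded _ _ _ P' _ c) => [|w].
  apply: measurable_mxtrace; apply: measurable_mulmx => //; apply: measurable_mulmx => //.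
  by apply: measurable_kerproj; exact: measurable_mulmx.
rewrite ger0_norm; last exact: wtr_ge0 (gram_kerproj _).
apply: le_trans (hc _ (gramS w)); apply: le_trans (ler_norm _).
have := wtr_ge0 A (gram_ridge_sub_kerproj (S' w *m A) lam0).
by rewrite wtrB subr_ge0.
Qed.

(* The resolvent exceeds the kernel projection by at most the trace deficiency
   [(k - 1) - tr (I - G)], whose mean is given by the leave-one-out identity. *)
Lemma mean_rtrace_le_Err : tbar <= Err P' S' A + eta * F / 100.
Proof.
have ht := gram_bounded_rtrace A lam0.
have bt : Ex P' (fun w => rtrace A lam ((S' w *m A)^T *m (S' w *m A))) = tbar.
  exact: (Ex_full_gram A ms mS' indS' lawS' ht).
have hl := leave_one_out A ms mS' indS' lawS' form_integ_norm 1%:M lam0.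
set T := Ex P' _ in hl.
have iT : integ P' (fun w => \tr (1%:M *m (1%:M - G ((S' w *m A)^T *m (S' w *m A))))).
  have [_ [c hc]] := gram_bounded_rtrace (1%:M : 'M[R]_n) lam0.
  apply: (@integ_bounded _ _ _ P' _ (`|n%:R| + c)) => [|w].
    apply: measurable_mxtrace; apply: measurable_mulmx => //; apply: measurable_mxD => //.
    by apply: measurable_mxN; exact: measurable_ridge.
  rewrite mul1mx linearB/= mxtrace1; apply: le_trans (ler_normB _ _) _.
  rewrite lerD2l; have := hc _ (gramS w).
  by rewrite /rtrace /wtr trmx1 mulmx1 mul1mx.
have ir : integ P' (fun w => rtrace A lam ((S' w *m A)^T *m (S' w *m A))).
  have [mt [c hc]] := ht; apply: (@integ_bounded _ _ _ P' _ c) => [|w]; last exact: hc.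
  exact: (measurableT_comp mt measurable_gramS).
have hE : tbar - S * (k.-1%:R - T) <= Err P' S' A.
  rewrite ErrE -bt /T -[X in S * (X - _)](Ex_cst P') -ExB//; last exact: integ_cst.
  rewrite -ExZ; last by apply: integB => //; exact: integ_cst.
  have i1 := integZ S (integB (integ_cst P' k.-1%:R) iT).
  rewrite -ExB//; apply: le_Ex; [exact: integB|exact: integ_kerproj|].
  by move=> w; rewrite mul1mx; exact: wtr_ridge_le.
have hT : k.-1%:R * (1 - 4 * eta) <= T.
  (* S' has k - 1 rows, so leaving one out keeps k - 2 of them; for k = 1 the factor k - 1
     annihilates both sides. *)
  rewrite hl ler_wpM2l// -[leLHS](iterT_cst P x k.-2 _ 0).
  apply: (le_iterT P mx (i := 0%N)) reach0.
  - exact: gram_bounded_cst.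
  - exact: (gram_bounded_loo _ ms form_integ_norm).
  - move=> C; rewrite add0n => rC; apply: loo_trace_ge rC.
    exact: leq_trans (leq_pred _) (leq_pred _).
have h1 : S * (k.-1%:R - T) <= S * (k.-1%:R * (4 * eta)) by rewrite ler_wpM2l//; lra.
have h2 : S * (k.-1%:R * (4 * eta)) <= F / 1000 * (4 * eta).
  have -> : S * (k.-1%:R * (4 * eta)) = k.-1%:R * S * (4 * eta) by ring.
  rewrite ler_wpM2r ?mulr_ge0 ?(ltW eta0)//; apply: le_trans kS.
  by rewrite ler_wpM2r// ler_nat leq_pred.
have := mulr_gt0 eta0 F0; lra.
Qed.

(** As F <= (100/49) Err, the absolute errors lam = eta F and eta F / 100 become relative ones,
    below 3 eta together. *)
Lemma ridge_level_mean_le : lam + tbar <= (1 + 3 * eta) * Err P' S' A /\ 0 < Err P' S' A.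
Proof.
have h := mean_rtrace_le_Err.
have /andP[tb _] := mean_rtrace_bounds.
case: small => ? ? ? ? /andP[? ?].
have h1 : eta * F <= F / 1000 by rewrite mulrC ler_wpM2l ?(ltW F0)//; lra.
have E1 : 49 / 100 * F <= Err P' S' A by lra.
split; last by lra.
have : eta * (49 / 100 * F) <= eta * Err P' S' A by rewrite ler_wpM2l// ltW.
have : lam = eta * F by [].
have := mulr_gt0 eta0 F0; lra.
Qed.

(** The kernel of S' A has dimension at least n - (k - 1). This yields the factor 1 - k/n of the
    second inequality. *)
Lemma Err_ge c : 0 <= c -> (forall v, c * dotp v v <= dotp (A *m v) (A *m v)) ->
  c * (n%:R - k.-1%:R) <= Err P' S' A.
Proof.
move=> c0 hc; rewrite ErrE -[leLHS](Ex_cst P'); apply: le_Ex.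
- exact: integ_cst.
- exact: integ_kerproj.
move=> w; apply: le_trans (wtr_ge (gram_kerproj _) hc).
rewrite ler_wpM2l// /kerproj linearB/= mxtrace1 lerD2l lerN2.
exact: tr_pinv_le.
Qed.

(** * From the top eigenvalue to the contraction factor *)

Section rate.
Context {dO1} {O1 : measurableType dO1}.
Variables (P1 : probability O1 R) (S1 : O1 -> 'M[R]_(k, m)).
Hypothesis mS1 : measurable_fun setT S1.
Hypothesis indS1 : mutually_independent P1 (rowv S1).
Hypothesis lawS1 : forall i, same_law P1 P (rowv S1 i) s.
Hypotheses (n0 : (0 < n)%N) (k0 : (0 < k)%N).
Hypothesis unitA : A^T *m A \in unitmx.
Variable c : R.
Hypothesis c0 : 0 <= c.
Hypothesis hc : forall v, c * dotp v v <= dotp (A *m v) (A *m v).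

(** mu is the top eigenvalue of the entrywise mean [Gb] of the resolvent. Domination of the
    projection by the resolvent gives the contraction; symmetry of [Gb] moves it onto the
    eigenvector and produces the hypothesis of [spectral_gap_le]. *)
Lemma contraction_factor : exists mu : R, [/\ mu <= 1,
  (1 - 250 * delta) * (k%:R / Err P' S' A * c / (k%:R / Err P' S' A * c + 1)) <= 1 - mu &
  forall e, Ex P1 (fun w => dotp e (kerproj (S1 w *m A) *m e)) <= mu * dotp e e].
Proof.
pose Gw w := G ((S1 w *m A)^T *m (S1 w *m A)).
have gw w : gram ((S1 w *m A)^T *m (S1 w *m A)) by exists k, (S1 w *m A).
have mG : measurable_fun setT Gw.
  apply: measurable_ridge; apply: measurable_mulmx; last exact: measurable_mulmx.
  by apply: measurable_trmx; exact: measurable_mulmx.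
have iform u w : integ P1 (fun o => dotp u (Gw o *m w)).
  apply: (@integ_bounded _ _ _ P1 _ (enorm u * enorm w)) => [|o].
    by apply: measurable_dotp => //; exact: measurable_mulmx.
  exact: ridge_form_bound.
have iGij i j : integ P1 (fun o => Gw o i j).
  by under eq_fun do rewrite mx_entry_dotp.
pose Gb : 'M[R]_n := \matrix_(i, j) Ex P1 (fun o => Gw o i j).
have form_sum (M : 'M[R]_n) u w : dotp u (M *m w) = \sum_i \sum_j (u i 0 * w j 0) * M i j.
  rewrite dotpE; apply: eq_bigr => i _; rewrite mxE mulr_sumr; apply: eq_bigr => j _.
  by ring.
have GbE u w : dotp u (Gb *m w) = Ex P1 (fun o => dotp u (Gw o *m w)).
  rewrite form_sum; under [RHS]eq_Ex do rewrite form_sum.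
  rewrite Ex_sum => [|i]; last by apply: integ_sum => j; exact: integZ.
  apply: eq_bigr => i _; rewrite Ex_sum => [|j]; last exact: integZ.
  by apply: eq_bigr => j _; rewrite ExZ// mxE.
have sG : Gb^T = Gb.
  apply/matrixP => i j; rewrite !mxE; apply: eq_Ex => o.
  by have /matrixP/(_ i j) := ridge_sym lam0 (gw o); rewrite mxE.
have [mu [v [v1 ev hmu]]] := max_eigen n0 sG.
exists mu.
have vv : dotp v v = 1 by rewrite -enorm2 v1 expr1n.
have emu : iterT P x k (rform lam v v) 0 = mu.
  rewrite -(Ex_full_gram A ms mS1 indS1 lawS1 (gram_bounded_rform lam0 v v)).
  by rewrite -[LHS]GbE ev dotpZr vv mulr1.
have mu1 : mu <= 1.
  have -> : mu = dotp v (Gb *m v) by rewrite ev dotpZr vv mulr1.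
  rewrite GbE -vv -[leRHS](Ex_cst P1); apply: le_Ex => //; first exact: integ_cst.
  by move=> o; exact: ridge_form_le.
split=> //; last first.
  move=> e; apply: le_trans (hmu e); rewrite GbE; apply: le_Ex => //; last first.
    by move=> o; exact: kerproj_le_ridge.
  apply: (@integ_bounded _ _ _ P1 _ (dotp e e)) => [|o].
    apply: measurable_dotp => //; apply: measurable_mulmx => //.
    by apply: measurable_kerproj; exact: measurable_mulmx.
  rewrite ger0_norm; last exact: gram_ge0 (gram_kerproj _).
  apply: le_trans (kerproj_le_ridge _ lam0 _) _.
  exact: ridge_form_le.
pose w := invmx (A^T *m A) *m v.
have Aw : A^T *m (A *m w) = v by rewrite mulmxA mulKVmx.
have hl := leave_one_out A ms mS1 indS1 lawS1 form_integ_norm (w *m v^T) lam0.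
have eloo : (1 - mu) * dotp v w = k%:R * iterT P x k.-1 (loo_fun P s A lam (w *m v^T)) 0.
  rewrite -hl mulrBl mul1r.
  have -> : mu * dotp v w = dotp v (Gb *m w) by rewrite dotp_trmx sG ev dotpZl.
  rewrite GbE -[X in X - _](Ex_cst P1) -ExB//; last exact: integ_cst.
  apply: eq_Ex => o; rewrite -mulmxA mxtrace_mulC /mxtrace big_ord1.
  by rewrite -mulmxA -/(dotp v _) mulmxBl mul1mx dotpDr dotpNr.
have key := spectral_gap_le k0 v1 Aw mu1 emu eloo.
have [hE E0] := ridge_level_mean_le.
set E := Err P' S' A in hE E0 *.
have /andP[tb1 _] := mean_rtrace_bounds.
case: small => _ _ _ _ /andP[lp lq].
have z0p : 0 < lam + tbar by lra.
have kp : 0 < k%:R :> R by rewrite ltr0n.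
have d0 : 0 < delta by exact: lt_le_trans eta0 etad.
(* c |w|^2 <= |A w|^2 = <v, w> <= |w| since |v| = 1, so c |w| <= 1; this is where the smallest
   singular value enters. *)
have cq : c * dotp v w <= 1.
  have dvw : dotp v w = dotp (A *m w) (A *m w) by rewrite -{1}Aw dotpC dotp_trmx trmxK.
  have h1 : c * enorm w ^+ 2 <= enorm w.
    rewrite enorm2; apply: le_trans (hc w) _; rewrite -dvw.
    apply: le_trans (ler_norm _) _; apply: le_trans (dotp_cs_enorm _ _) _.
    by rewrite v1 mul1r.
  have h2 : dotp v w <= enorm w.
    apply: le_trans (ler_norm _) _; apply: le_trans (dotp_cs_enorm _ _) _.
    by rewrite v1 mul1r.
  have e0 := enorm_ge0 w.
  apply: (@le_trans _ _ (c * enorm w)); first by rewrite ler_wpM2l.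
  have [ez|en] := eqVneq (enorm w) 0; first by rewrite ez mulr0.
  have ep : 0 < enorm w by rewrite lt_neqAle eq_sym en.
  by rewrite -(ler_pM2r ep) mul1r -mulrA -expr2.
set g' := k%:R / (lam + tbar) * c.
have g'0 : 0 <= g' by rewrite mulr_ge0// divr_ge0// ltW.
have key2 : g' * (mu - 241 * delta) <= 1 - mu.
  have h1 : (k%:R / (lam + tbar) * (mu - 241 * delta)) * c <= (1 - mu) * dotp v w * c.
    by rewrite ler_wpM2r.
  have h2 : (1 - mu) * (c * dotp v w) <= (1 - mu) * 1.
    by rewrite ler_wpM2l// subr_ge0.
  by rewrite /g'; lra.
set g := k%:R / E * c.
have g0 : 0 <= g by rewrite mulr_ge0// divr_ge0// ltW.
have hg : g <= (1 + 3 * eta) * g'.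
  rewrite /g /g' mulrA ler_wpM2r// ler_pdivrMr//.
  have -> : (1 + 3 * eta) * (k%:R / (lam + tbar)) * E = k%:R * ((1 + 3 * eta) * E / (lam + tbar)).
    by ring.
  by rewrite -[leLHS]mulr1 ler_wpM2l// ler_pdivlMr// mul1r.
have g1 : 0 < g + 1 by lra.
have g'1 : 0 < g' + 1 by lra.
(* Adding g' (1 - mu) to both sides of [key2] collects mu on the right. *)
have step1 : (1 - 241 * delta) * (g' / (g' + 1)) <= 1 - mu.
  by rewrite mulrA ler_pdivrMr//; lra.
apply: le_trans step1.
have step2 : g / (g + 1) <= (1 + 3 * eta) * (g' / (g' + 1)).
  rewrite mulrA ler_pdivlMr// mulrAC ler_pdivrMr//.
  have := mulr_ge0 (mulr_ge0 (ltW eta0) g0) g'0.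
  have := mulr_ge0 (ltW eta0) g'0.
  lra.
have r0 : 0 <= g' / (g' + 1) by rewrite divr_ge0// ltW.
(* The loss 241 delta and the relative error 3 eta <= 3 delta in Err fit within 250 delta. *)
apply: (@le_trans _ _ ((1 - 250 * delta) * ((1 + 3 * eta) * (g' / (g' + 1))))).
  by rewrite ler_wpM2l//; case: small; lra.
rewrite mulrA ler_wpM2r//.
have : delta * eta >= 0 by rewrite mulr_ge0// ltW.
by case: small; lra.
Qed.

End rate.
End error_term.

End spectral_gap.

(** * Sketch-and-project *)

Section sketch_and_project.
Context {R : realType} {k m n : nat} (A : 'M[R]_(m, n)).

Fixpoint error_vector (S : nat -> 'M[R]_(k, m)) (e0 : 'cV[R]_n) (t : nat) :=
  if t is t'.+1 then kerproj (S t' *m A) *m error_vector S e0 t' else e0.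

Lemma sketch_project_error b xstar S x0 t : A *m xstar = b ->
  sketch_project A b S x0 t - xstar = error_vector S (x0 - xstar) t.
Proof.
move=> <-; elim: t => //= t <-; set y := sketch_project _ _ _ _ _.
rewrite -mulmxBr /kerproj mulmxBl mul1mx !mulmxA addrAC.
by [].
Qed.

Lemma measurable_error_vector dT (T : measurableType dT)
    (X : nat -> T -> 'M[R]_(k, m)) e0 t :
  (forall i, (i < t)%N -> measurable_fun setT (X i)) ->
  measurable_fun setT (fun w => error_vector (X ^~ w) e0 t).
Proof.
elim: t => [|t IH] mX; first exact: measurable_cst.
apply: measurable_mulmx; last by apply: IH => i it; apply: mX; exact: ltnW.
by apply: measurable_kerproj; apply: measurable_mulmx => //; exact: mX.
Qed.

Context {dO dO''} {O : measurableType dO} {O'' : measurableType dO''}.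
Variables (P : probability O R) (S : O -> 'M[R]_(k, m)).
Variables (P'' : probability O'' R) (Sc : nat -> O'' -> 'M[R]_(k, m)).
Hypothesis mS : measurable_fun setT S.
Hypothesis mSc : forall t, measurable_fun setT (Sc t).
Hypothesis indSc : mutually_independent P'' Sc.
Hypothesis lawSc : forall t, same_law P'' P (Sc t) S.
Variable mu : R.
Hypothesis mu0 : 0 <= mu.
Hypothesis contr : forall e, Ex P (fun w => dotp e (kerproj (S w *m A) *m e)) <= mu * dotp e e.

Lemma integ_kerproj_form e : integ P (fun w => dotp e (kerproj (S w *m A) *m e)).
Proof.
apply: (@integ_bounded _ _ _ P _ (dotp e e)) => [|w].
  apply: measurable_dotp => //; apply: measurable_mulmx => //.
  by apply: measurable_kerproj; exact: measurable_mulmx.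
rewrite ger0_norm; last exact: gram_ge0 (gram_kerproj _).
apply: le_trans (kerproj_le_ridge _ (@ltr01 R) _) _.
by apply: ridge_form_le => //; exists k, (S w *m A).
Qed.

(** The current sketch is independent of the past error Y, and |P y|^2 = y^T P y for a projection P,
    so the contraction bound applies at fixed Y. Nonnegative extended integrals spare an
    integrability proof for the iterates. *)
Lemma error_vector_decay e0 t :
  (\int[P'']_w (enorm (error_vector (Sc ^~ w) e0 t) ^+ 2)%:E <=
   (mu ^+ t * enorm e0 ^+ 2)%:E)%E.
Proof.
elim: t => [|t IH].
  by rewrite (EFin_Ex (integ_cst P'' (enorm e0 ^+ 2))) Ex_cst expr0 mul1r.
have tt : ~ [set i | (i < t)%N] t by rewrite /= ltnn.
pose Y w := error_vector (Sc ^~ w) e0 t.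
have [mY indY] : measurable_fun setT Y /\ indep_pair P'' Y (Sc t).
  have h := @past_indep R _ _ O'' _ P'' _ Sc mSc indSc [set i | (i < t)%N] t tt
    _ 'cV[R]_n Y.
  by apply: h; apply: measurable_error_vector => i it; exact: measurable_past.
pose h (z : 'cV[R]_n * 'M[R]_(k, m)) : \bar R :=
  (enorm (kerproj (z.2 *m A) *m z.1) ^+ 2)%:E.
have mh : measurable_fun setT h.
  apply/measurable_EFinP; under eq_fun do rewrite enorm2.
  have mK : measurable_fun setT (fun z : 'cV[R]_n * 'M[R]_(k, m) => kerproj (z.2 *m A) *m z.1).
    apply: measurable_mulmx; last exact: measurable_fst.
    by apply: measurable_kerproj; apply: measurable_mulmx => //; exact: measurable_snd.
  exact: measurable_dotp.
have h0 z : (0 <= h z)%E by rewrite lee_fin sqr_ge0.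
have mYY : measurable_fun setT (fun w => dotp (Y w) (Y w)) by exact: measurable_dotp.
rewrite (ge0_integral_indep mY (mSc t) mS (lawSc t) indY mh h0).
apply: (@le_trans _ _ (\int[P'']_w (mu%:E * (enorm (Y w) ^+ 2)%:E))%E).
  apply: ge0_le_integral => //.
  - by move=> w _; apply: integral_ge0.
  - pose k1 (z : O'' * O) := h (Y z.1, S z.2).
    apply: (measurable_fun_fubini_tonelli_F k1); last by move=> z; exact: h0.
    apply: (measurableT_comp mh); apply/measurable_fun_pairP; split.
      exact: measurableT_comp mY (@measurable_fst _ _ _ _).
    exact: measurableT_comp mS (@measurable_snd _ _ _ _).
  - under eq_fun do rewrite -EFinM enorm2.
    by apply/measurable_EFinP; exact: measurable_mul_fun.
  move=> w _; rewrite -EFinM enorm2.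
  have := contr (Y w); rewrite -lee_fin -(EFin_Ex (integ_kerproj_form _)).
  apply: le_trans; rewrite le_eqVlt; apply/orP; left; apply/eqP.
  by apply: eq_integral => w' _; rewrite /h /= enorm2 kerproj_norm.
rewrite ge0_integralZl//; first last.
- by move=> w _; rewrite lee_fin sqr_ge0.
- by apply/measurable_EFinP; under eq_fun do rewrite enorm2.
rewrite exprS -mulrA EFinM lee_wpmul2l//.
Qed.

Lemma Rate_ge b xstar : A *m xstar = b -> ((1 - mu)%:E <= Rate P'' Sc A b xstar)%E.
Proof.
move=> Ax; apply: ereal_sup_ubound; exists (1 - mu) => // x0 t.
rewrite expectationE subKr; under eq_integral do rewrite (sketch_project_error _ _ _ Ax).
exact: error_vector_decay.
Qed.

End sketch_and_project.

(* [2 |p| |q| = ||a| - |b|| (|a| + |b|)] for [p = c (a + b)] and [q = c (a - b)]. *)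
Lemma sum_sqr_le_abs_sub1 {R : realType} (a b c : R) : c ^+ 2 = 2^-1 ->
  a ^+ 2 + b ^+ 2 <= 4 * ((`|a| - 1) ^+ 2 + (`|b| - 1) ^+ 2 +
    ((`|c * (a + b)| - 1) ^+ 2 + (`|c * (a - b)| - 1) ^+ 2)).
Proof.
move=> c2.
set p := `|c * (a + b)|; set q := `|c * (a - b)|.
have p2 : p ^+ 2 = (a + b) ^+ 2 / 2 by rewrite /p real_normK ?num_real// exprMn c2; ring.
have q2 : q ^+ 2 = (a - b) ^+ 2 / 2 by rewrite /q real_normK ?num_real// exprMn c2; ring.
have a2 : `|a| ^+ 2 = a ^+ 2 by rewrite real_normK ?num_real.
have b2 : `|b| ^+ 2 = b ^+ 2 by rewrite real_normK ?num_real.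
have p0 : 0 <= p := normr_ge0 _; have q0 : 0 <= q := normr_ge0 _.
have pq : 2 * (p * q) = `|(`|a| - `|b|)| * (`|a| + `|b|).
  apply: (@pexpIrn _ 2) => //; rewrite ?nnegrE ?mulr_ge0// ?addr_ge0//.
  have -> : (2 * (p * q)) ^+ 2 = 4 * (p ^+ 2 * q ^+ 2) by ring.
  rewrite p2 q2 exprMn real_normK ?num_real//.
  have -> : (`|a| - `|b|) ^+ 2 * (`|a| + `|b|) ^+ 2 = (`|a| ^+ 2 - `|b| ^+ 2) ^+ 2 by ring.
  by rewrite a2 b2; field.
rewrite -a2 -b2; set a' := `|a| in a2 pq *; set b' := `|b| in b2 pq *.
set r := `|a' - b'| in pq.
have r2 : r ^+ 2 = (a' - b') ^+ 2 by rewrite /r real_normK ?num_real.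
have pq2 : p ^+ 2 + q ^+ 2 = a' ^+ 2 + b' ^+ 2 by rewrite p2 q2 a2 b2; field.
have t1 : 0 <= (2 * r - (a' + b')) ^+ 2 := sqr_ge0 _.
have t2 : 0 <= (a' - 1 + (b' - 1)) ^+ 2 := sqr_ge0 _.
have t3 : 0 <= (p - 1 + (q - 1)) ^+ 2 := sqr_ge0 _.
have t4 : 0 <= (a' - b') ^+ 2 := sqr_ge0 _.
lra.
Qed.

(** * Absolute lower bounds on K and L *)

Section constants_lower_bounds.
Context {R : realType} {dO} {O : measurableType dO} {m : nat}.
Variables (P : probability O R) (s : O -> 'cV[R]_m) (K L : R).
Hypothesis ms : measurable_fun setT s.
Hypothesis iso : isotropic P s.
Hypothesis sub : vsubgaussian P K s.
Hypothesis conc : euclidean_concentration P L s.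

(** Isotropy makes the second moment in a unit direction equal to 1, and K^2 bounds it. This gives
    eta <= delta. *)
Lemma subgaussian_const_ge1 : (0 < m)%N -> 0 <= K /\ 1 <= K ^+ 2.
Proof.
move=> m0; have [v v1] := exists_enorm1 (R := R) m0.
have mv := measurable_form ms v; split; first exact: subgaussian_ge0 (sub v1).
have [_] := subgaussian_moment2 mv (sub v1).
by have := Ex_form ms iso sub v v; rewrite /dotp -/(dotp v v) -enorm2 v1 expr1n => ->.
Qed.

(** Euclidean concentration applied to the one-row matrix v^T, whose Frobenius norm is 1. *)
Lemma concentration_abs v : enorm v = 1 -> 0 <= L /\
  integ P (fun w => (`|dotp v (s w)| - 1) ^+ 2) /\
  Ex P (fun w => (`|dotp v (s w)| - 1) ^+ 2) <= L ^+ 2.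
Proof.
move=> v1; have cv := conc v^T.
have fv : fnorm v^T = 1.
  apply: (@pexpIrn _ 2) => //; rewrite ?nnegrE ?fnorm_ge0//.
  by rewrite fnorm2 mxtrace_mulC trmxK /mxtrace big_ord1 -/(dotp v v) -enorm2 v1.
have e w : enorm (v^T *m s w) = `|dotp v (s w)|.
  by rewrite /enorm big_ord1 sqrtr_sqr.
have e1 (u : 'cV[R]_m) : dotp (v^T *m u) (v^T *m u) = dotp v u ^+ 2.
  by rewrite dotpE big_ord1 expr2.
have sv1 : specnorm v^T <= 1.
  by apply: specnorm_le => // u; rewrite e1 expr1n -[1](expr1n _ 2) -v1 enorm2 dotp_cs.
have sv0 : 0 < specnorm v^T.
  rewrite lt_neqAle specnorm_ge0 andbT; apply/eqP => e0.
  have := specnorm_bound v^T v; rewrite e1 -e0 -enorm2 v1 !expr1n expr0n mul0r.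
  by rewrite ler10.
rewrite fv in cv; have cE : (fun w => enorm (v^T *m s w) - 1) = (fun w => `|dotp v (s w)| - 1).
  by apply/funext => w; rewrite e.
rewrite cE in cv.
have L0 : 0 <= L by move: (subgaussian_ge0 cv); rewrite pmulr_lge0.
have mc : measurable_fun setT (fun w => `|dotp v (s w)| - 1).
  apply: measurable_add_fun => //; apply: measurable_norm_fun.
  exact: measurable_form.
have [i2 h2] := subgaussian_moment2 mc cv; split=> //; split=> //.
apply: le_trans h2 _; rewrite exprMn -[leRHS]mulr1 ler_wpM2l ?sqr_ge0//.
by rewrite exprn_ile1 ?specnorm_ge0.
Qed.

(* Two orthonormal directions and their normalized sum and difference cannot
   all have [|<v, s>|] close to 1. *)
Lemma concentration_const_ge : (1 < m)%N -> 0 <= L /\ 1 <= 8 * L ^+ 2.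
Proof.
move=> m1; pose i := Ordinal (ltnW m1); pose j := Ordinal m1.
pose e l : 'cV[R]_m := delta_mx l 0.
have ee l l' : dotp (e l) (e l') = (l == l')%:R.
  by rewrite dotp_delta mxE eqxx andbT.
have ij : (i == j) = false by [].
pose c : R := (Num.sqrt 2)^-1.
have c2 : c ^+ 2 = 2^-1 by rewrite exprVn sqr_sqrtr.
have unit u : dotp u u = 1 -> enorm u = 1.
  by move=> h; apply: (@pexpIrn _ 2) => //; rewrite ?nnegrE ?enorm_ge0// enorm2 h expr1n.
have u1 : enorm (e i) = 1 by apply: unit; rewrite ee eqxx.
have u2 : enorm (e j) = 1 by apply: unit; rewrite ee eqxx.
have cc : c * (c * 2) = 1 by rewrite mulrA -expr2 c2 mulVf.
have u3 : enorm (c *: (e i + e j)) = 1.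
  apply: unit; rewrite !dotp_lin !ee !eqxx ij eq_sym ij /=; rewrite -[RHS]cc; ring.
have u4 : enorm (c *: (e i - e j)) = 1.
  apply: unit; rewrite !dotp_lin !ee !eqxx ij eq_sym ij /=; rewrite -[RHS]cc; ring.
have [L0 [i1 h1]] := concentration_abs u1; have [_ [i2 h2]] := concentration_abs u2.
have [_ [i3 h3]] := concentration_abs u3; have [_ [i4 h4]] := concentration_abs u4.
split=> //.
have j1 := form_integ2 ms sub (e i); have j2 := form_integ2 ms sub (e j).
have E1 : Ex P (fun w => dotp (e i) (s w) ^+ 2) = 1.
  by have := Ex_form ms iso sub (e i) (e i); rewrite ee eqxx.
have E2 : Ex P (fun w => dotp (e j) (s w) ^+ 2) = 1.
  by have := Ex_form ms iso sub (e j) (e j); rewrite ee eqxx.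
have iS := integD (integD i1 i2) (integD i3 i4).
have : Ex P (fun w => dotp (e i) (s w) ^+ 2 + dotp (e j) (s w) ^+ 2) <=
  Ex P (fun w => 4 * ((`|dotp (e i) (s w)| - 1) ^+ 2 + (`|dotp (e j) (s w)| - 1) ^+ 2 +
   ((`|dotp (c *: (e i + e j)) (s w)| - 1) ^+ 2 + (`|dotp (c *: (e i - e j)) (s w)| - 1) ^+ 2))).
  apply: le_Ex; [exact: integD|exact: integZ|] => w.
  by rewrite !dotp_lin; exact: sum_sqr_le_abs_sub1.
rewrite ExD// E1 E2 ExZ// => /le_trans h.
have {h} : 1 + 1 <= 4 * (L ^+ 2 + L ^+ 2 + (L ^+ 2 + L ^+ 2)).
  apply: h; rewrite ler_wpM2l// ExD; [|exact: integD|exact: integD].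
  by rewrite !ExD//; apply: lerD; apply: lerD.
have -> : 4 * (L ^+ 2 + L ^+ 2 + (L ^+ 2 + L ^+ 2)) = (1 + 1) * (8 * L ^+ 2) by ring.
by rewrite -[leLHS]mulr1 ler_pM2l.
Qed.

End constants_lower_bounds.

Theorem corollary3p9 (R : realType) :
  exists C1 C2 : R, [/\ 0 < C1, 0 < C2 &
  forall (m n k : nat) (A : 'M[R]_(m, n)) (K L : R)
    (* the sketching matrix S *)
    (d : measure_display) (Omega : measurableType d) (P : probability Omega R)
    (S : {RV P >-> 'M[R]_(k, m)})
    (* the matrix S' with k - 1 rows defining Err(A, k-1) *)
    (d' : measure_display) (Omega' : measurableType d')
    (P' : probability Omega' R) (S' : {RV P' >-> 'M[R]_(k.-1, m)})
    (* the independent copies of S driving sketch-and-project *)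
    (d'' : measure_display) (Omega'' : measurableType d'')
    (P'' : probability Omega'' R) (Scopy : nat -> {RV P'' >-> 'M[R]_(k, m)})
    (* the linear system *)
    (b : 'cV[R]_m) (xstar : 'cV[R]_n),
  (0 < k)%N ->
  \rank A = n ->
  iid_rows P S ->
  (forall i : 'I_k, [/\ isotropic P (rowv S i), vsubgaussian P K (rowv S i) &
                        euclidean_concentration P L (rowv S i)]) ->
  iid_rows P' S' ->
  (forall (i : 'I_k.-1) (j : 'I_k), same_law P' P (rowv S' i) (rowv S j)) ->
  mutually_independent P'' (fun t => Scopy t : Omega'' -> 'M[R]_(k, m)) ->
  (forall t, same_law P'' P (Scopy t) S) ->
  A *m xstar = b ->
  let kappa := cond_number A in
  let r := stable_rank A in
  C1 * Num.max k%:R (Num.max (L ^+ 2 * ln kappa) (K ^+ 4 * L ^+ 2)) <= r ->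
  let err := Err P' S' A in
  let gamma := k%:R / err in
  let smin2 := sigma_min A ^+ 2 in
  exists eps : R,
    [/\ eps <= C2 * K ^+ 2 * L / Num.sqrt r,
        (((1 - eps) * (gamma * smin2 / (gamma * smin2 + 1)))%:E
           <= Rate P'' (fun t => Scopy t : Omega'' -> 'M[R]_(k, m))
                A b xstar)%E &
        (1 - eps) * (1 - k%:R / n%:R) * (k%:R * smin2 / err)
           <= (1 - eps) * (gamma * smin2 / (gamma * smin2 + 1))]].
Proof.
(* C1 is the square of c because delta^2 = K^4 L^2 / r must be at most 1 / c^2. Keeping c behind an
   equation prevents computation with the numeral. *)
have [c cE] : exists c : R, c = 1000 by exists 1000.
have c2 : 2 <= c by rewrite cE ler_nat.
have c800 : 800 <= c by rewrite cE ler_nat.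
have c0 : 0 < c by apply: lt_le_trans c2.
have cc0 : 0 < c * c by exact: mulr_gt0.
exists (c * c), 250; split=> //.
move=> m n k A K L d Omega P S d' Omega' P' S' d'' Omega'' P'' Scopy b xstar
  k0 rkA [indS sameS] rows [indS' sameS'] law' indc lawc Ax kappa r hr err gamma smin2.
set F := fnorm A ^+ 2; set Sp := specnorm A ^+ 2.
have rE : r = F / Sp by [].
have rk : c * c * k%:R <= r.
  by apply: le_trans hr; rewrite ler_wpM2l ?(ltW cc0)// le_max lexx.
have rKL : c * c * (K ^+ 4 * L ^+ 2) <= r.
  by apply: le_trans hr; rewrite ler_wpM2l ?(ltW cc0)// !le_max lexx !orbT.
have k1 : 1 <= k%:R :> R by rewrite ler1n.
have rc : c * c <= r by apply: le_trans rk; rewrite ler_peMr// ltW.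
have r0 : 0 < r by apply: lt_le_trans rc.
(* Division by 0 gives 0, so a vanishing spectral norm would make r = 0. *)
have Sp0 : 0 < Sp.
  rewrite lt_neqAle sqr_ge0 andbT; apply/eqP => e.
  by move: r0; rewrite rE -e invr0 mulr0 ltxx.
have FE : F = r * Sp by rewrite rE divfK// gt_eqF.
have F0 : 0 < F by rewrite FE mulr_gt0.
(* The stable rank is at most n, so a large r forces n >= 2 and hence m >= 2, as the two orthonormal
   directions behind the bound on L require. *)
have rn : r <= n%:R by rewrite rE ler_pdivrMr// fnorm_specnorm.
have n2 : (1 < n)%N.
  rewrite -(@ltr_nat R); apply: lt_le_trans rn; apply: lt_le_trans rc.
  by rewrite (lt_le_trans (_ : 1 < 2)) ?ltr1n// (le_trans c2)// ler_peMr ?(ltW c0)//; lra.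
have nm : (n <= m)%N by rewrite -rkA rank_leq_row.
have m2 : (1 < m)%N by exact: leq_trans nm.
pose i0 := Ordinal k0; pose s := rowv S i0.
have mS : measurable_fun setT S by exact: measurable_funP.
have mS' : measurable_fun setT S' by exact: measurable_funP.
have ms : measurable_fun setT s by exact: measurable_rowv.
have [iso sub conc] := rows i0.
have [K0 K1] := subgaussian_const_ge1 ms iso sub (ltnW m2).
have [L0 L1] := concentration_const_ge ms iso sub conc m2.
have Lp : 0 < L.
  by rewrite lt_neqAle L0 andbT; apply/eqP => e; move: L1; rewrite -e expr0n mulr0 ler10.
pose q := Num.sqrt r; have q0 : 0 < q by rewrite sqrtr_gt0.
have q2 : q ^+ 2 = r by rewrite sqr_sqrtr// ltW.
pose eta := L / q; pose delta := K ^+ 2 * eta.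
have eta0 : 0 < eta by rewrite divr_gt0.
have eta2 : eta ^+ 2 * r = L ^+ 2 by rewrite /eta expr_div_n q2 divfK// gt_eqF.
have LS : L ^+ 2 * Sp <= eta ^+ 2 * F by rewrite FE mulrA eta2.
have Keta : K ^+ 2 * eta <= delta by [].
have etad : eta <= delta by rewrite ler_peMl// ltW.
have delta0 : 0 <= delta by apply: le_trans etad; exact: ltW.
have dsmall : delta <= 1 / 1000.
  rewrite -cE ler_pdivlMr// -ler_sqr ?nnegrE ?(mulr_ge0 delta0 (ltW c0))// expr1n.
  have e : delta ^+ 2 * r = K ^+ 4 * L ^+ 2 by rewrite /delta -eta2; ring.
  rewrite -(ler_pM2r r0) mul1r exprMn; apply: le_trans rKL; rewrite -e.
  by have -> : delta ^+ 2 * c ^+ 2 * r = c * c * (delta ^+ 2 * r) by ring.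
have kc : 800 * k%:R <= r.
  apply: le_trans rk; rewrite ler_wpM2r ?ler0n//; apply: le_trans c800 _.
  by rewrite ler_peMr ?(ltW c0)//; lra.
have kS : k%:R * Sp <= F / 1000.
  rewrite FE mulrAC ler_wpM2r ?(ltW Sp0)// -cE ler_pdivlMr//.
  apply: le_trans rk; rewrite mulrC ler_wpM2r ?ler0n//.
  by rewrite ler_peMr ?(ltW c0)//; lra.
have kSS : k%:R * Sp ^+ 2 <= (eta * F / 10) ^+ 2.
  have -> : (eta * F / 10) ^+ 2 = L ^+ 2 * (r / 100) * Sp ^+ 2 by rewrite FE -eta2; field.
  rewrite ler_wpM2r ?sqr_ge0//.
  have : 8^-1 * r <= L ^+ 2 * r by rewrite ler_wpM2r ?(ltW r0)//; lra.
  lra.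
have uA : A^T *m A \in unitmx.
  have := @gram_unit R n m A^T; rewrite trmxK; apply.
  by rewrite /row_free mxrank_tr rkA.
have n0 : (0 < n)%N by exact: ltnW.
have smin0 : 0 <= smin2 by exact: sqr_ge0.
have sminP v : smin2 * dotp v v <= dotp (A *m v) (A *m v) by exact: sigma_min_bound.
have lawS' i : same_law P' P (rowv S' i) s by exact: law'.
have lawS i : same_law P P (rowv S i) s by exact: sameS.
have [mu [mu1 hmu hcon]] := contraction_factor ms iso sub conc F0 eta0 LS Keta etad dsmall kS kSS
  mS' indS' lawS' mS indS lawS n0 k0 uA smin0 sminP.
have mu0 : 0 <= mu.
  have [e e1] := exists_enorm1 (R := R) n0.
  have := hcon e; rewrite -enorm2 e1 expr1n mulr1; apply: le_trans.
  by apply: Ex_ge0 => w; exact: gram_ge0 (gram_kerproj _).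
have [_ E0] := ridge_level_mean_le ms sub conc F0 eta0 LS etad dsmall kS mS' indS' lawS'.
have E1 := Err_ge F0 eta0 P' mS' smin0 sminP.
exists (250 * delta); split.
- by rewrite /delta /eta !mulrA.
- apply: le_trans (Rate_ge mS (fun t => measurable_funP (Scopy t)) indc lawc mu0 hcon Ax).
  by rewrite lee_fin.
have d1 : 0 <= 1 - 250 * delta by move: dsmall; lra.
rewrite -mulrA ler_wpM2l//.
have gE : k%:R * smin2 / err = gamma * smin2 by rewrite /gamma mulrAC.
rewrite gE; set g := gamma * smin2.
have np : 0 < n%:R :> R by rewrite ltr0n.
have g0 : 0 <= g by rewrite mulr_ge0// divr_ge0 ?ler0n// ltW.
have kn : k%:R <= n%:R :> R by apply: le_trans rn; apply: le_trans kc; rewrite ler_peMl ?ler0n// ler1n.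
(* After division by g, the second inequality reads (1 - k/n) (g + 1) <= 1, which is equivalent to
   this bound; it follows from Err >= sigma_min^2 (n - k + 1). *)
have gk : (n%:R - k%:R) * g <= k%:R.
  rewrite /g -gE mulrA ler_pdivrMr//.
  have -> : (n%:R - k%:R) * (k%:R * smin2) = k%:R * (smin2 * (n%:R - k%:R)) by ring.
  rewrite ler_wpM2l ?ler0n//; apply: le_trans E1.
  by rewrite ler_wpM2l// lerD2l lerN2 ler_nat leq_pred.
rewrite ler_pdivlMr; last by rewrite ltr_wpDl.
rewrite mulrAC -[leRHS]mul1r ler_wpM2r//.
have -> : (1 - k%:R / n%:R) * (g + 1) = ((n%:R - k%:R) * g + (n%:R - k%:R)) / n%:R.
  by field; rewrite gt_eqF.
by rewrite ler_pdivrMr//; lra.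
Qed.
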